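(* Let $\varphi:M^2\to\mathbb{H}^4$ be a PNMC biconservative immersion with $C<0$ (where $C$ is the integration constant attached to $\varphi$, as defined in the context), and let $\Phi=\iota\circ\varphi:M\to\mathbb{R}^5_1$. Identifying $M$ with its image, the surface $M$ can be locally (around each of its points) parametrized as $$ \Phi(u,t)=\hat{\sigma}(u)+\frac{1}{\hat{\kappa}(u)}\left(\sinh t\ \overline{b}_1+(\cosh t-1)\,\overline{b}_2\right), $$ where: (i) $f=f(u)$ (the mean curvature function) is a positive solution of the first-order ordinary differential equation $$ f'=\frac{4}{3}f\sqrt{1+9Cf^{3/2}-9f^2-c^2f^3}>0, $$ where $c$ is a non-zero real constant and $C$ is a negative real constant; (ii) $\hat{\kappa}=\hat{\kappa}(u)$ is the positive function given by $\hat{\kappa}(u)=3\sqrt{-C}f^{3/4}(u)$; (iii) $\overline{b}_1$ and $\overline{b}_2$ are two constant vectors in $\mathbb{R}^5_1$ such that $$ \langle\overline{b}_1,\overline{b}_2\rangle=0\qquad\text{and}\qquad\langle\overline{b}_1,\overline{b}_1\rangle=-\langle\overline{b}_2,\overline{b}_2\rangle=1; $$ (iv) $\hat{\sigma}=\hat{\sigma}(u)$ is a curve in $\mathbb{R}^5_1$ such that $\hat{\sigma}=\iota\circ\tilde{\sigma}$, where $\tilde{\sigma}$ is a curve parametrized by arc-length which lies in a totally geodesic hypersurface $\mathbb{H}^3=\mathbb{H}^4\cap\Pi$ of $\mathbb{H}^4$, the hyperplane $\Pi\subset\mathbb{R}^5_1$ containing the origin and being orthogonal to $\overline{b}_1$.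 Moreover, the curvature and torsion of $\tilde{\sigma}$, as a curve in $\mathbb{H}^3$, are $$ \kappa(u)=f(u)\sqrt{1+c^2f(u)},\qquad \tau(u)=\frac{2|c|\sqrt{f(u)}}{3\left(1+c^2f(u)\right)}\sqrt{1+9Cf^{3/2}(u)-9f^2(u)-c^2f^3(u)}, $$ and the curve $\hat{\sigma}$ satisfies $$ \langle\hat{\sigma}(u),\overline{b}_2\rangle=-\frac{1}{\hat{\kappa}(u)}. $$
   Context: $\mathbb{R}^5_1$ is $\mathbb{R}^5$ with the bilinear form $\langle\overline{x},\overline{y}\rangle=\sum_{i=1}^4x^iy^i-x^5y^5$; orthogonality in $\mathbb{R}^5_1$ is with respect to this form. $\mathbb{H}^4=\{\overline{x}\in\mathbb{R}^5_1:\langle\overline{x},\overline{x}\rangle=-1,\ x^5>0\}$ is the hyperboloid model of hyperbolic space, and $\iota:\mathbb{H}^4\to\mathbb{R}^5_1$ is the canonical inclusion. Surfaces $M$ are connected and oriented; immersions are smooth and isometric. For an isometric immersion $\varphi:M^2\to\mathbb{H}^4$ with second fundamental form $B$, let $H=\frac12\operatorname{trace}B$ be the mean curvature vector field, $f=|H|$ the mean curvature function, $\nabla^\perp$ the normal connection. The bitension field is $\tau_2(\varphi)=-\Delta^\varphi\tau(\varphi)-\operatorname{trace}R^{\mathbb{H}^4}(\varphi_*,\tau(\varphi))\varphi_*$, with $\tau(\varphi)=2H$, $\Delta^\varphi=-\operatorname{trace}(\nabla^\varphi\nabla^\varphi-\nabla^\varphi_\nabla)$ and $R(X,Y)Z=[\nabla_X,\nabla_Y]Z-\nabla_{[X,Y]}Z$;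 $\varphi$ is biconservative if the tangential part $\tau_2(\varphi)^\top$ vanishes. ''PNMC biconservative immersion (surface)'' means: $\varphi$ is biconservative, $f>0$ on $M$, $\operatorname{grad}f$ is nowhere zero, $\nabla^\perp(H/|H|)=0$, and $M$ is completely contained in $\mathbb{H}^4$, i.e. no open subset of $M$ lies in a totally geodesic hypersurface $\mathbb{H}^3\subset\mathbb{H}^4$. Set $E_1=\operatorname{grad}f/|\operatorname{grad}f|$, $E_3=H/f$, and let $\{E_1,E_2\}$, $\{E_3,E_4\}$ be positively oriented orthonormal frame fields of the tangent and the normal bundle of $\varphi$. With this notation, biconservativity is equivalent to $A_3(\operatorname{grad}f)=-f\operatorname{grad}f$, where $A_3$ is the shape operator of $E_3$. Constants attached to $\varphi$: it is known that $E_2f=0$ and that the shape operator of $E_4$ is $A_4=\operatorname{diag}(cf^{3/2},-cf^{3/2})$ with respect to $\{E_1,E_2\}$, for a non-zero real constant $c$; moreover there is a real constant $C$ (integration constant) such that $E_1f=\frac43f\sqrt{1+9Cf^{3/2}-9f^2-c^2f^3}>0$ on $M$. For a unit speed curve in a Riemannian $3$-manifold, curvature and torsion are its first and second Frenet curvatures, the torsion here being taken non-negative (i.e. up to the choice of orientation). *)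

(* Defs.v *)
From HB Require Import structures.
From mathcomp Require Import all_boot all_order all_algebra.
From mathcomp Require Import all_classical all_reals all_analysis.

Set Implicit Arguments.
Unset Strict Implicit.
Unset Printing Implicit Defensive.

Import Order.TTheory GRing.Theory Num.Theory.
Import numFieldNormedType.Exports.
Local Open Scope classical_set_scope.
Local Open Scope ring_scope.

Section Smooth.
Context {R : realType} {V W : normedModType R}.

(* the iterated directional derivative of F along the vectors of vs *)
Definition iter_derive (vs : seq V) (F : V -> W) : V -> W :=
  foldr (fun v G => 'D_v G) F vs.

(* C^oo on U, which is open in every use *)
Definition smooth_on (U : set V) (F : V -> W) : Prop :=
  forall (vs : seq V) (x : V), U x ->
    {for x, continuous (iter_derive vs F)} /\
    (forall v, derivable (iter_derive vs F) x v).

End Smooth.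

Definition cosh {R : realType} (t : R) : R := (expR t + expR (- t)) / 2.
Definition sinh {R : realType} (t : R) : R := (expR t - expR (- t)) / 2.

Section Charts.
Context {R : realType}.

Record chart (M : topologicalType) := Chart {
  cdom : set M;
  cmap : M -> 'rV[R]_2;
  cinv : 'rV[R]_2 -> M;
  cdom_open : open cdom;
  crange_open : open (cmap @` cdom);
  cmapK : forall p, cdom p -> cinv (cmap p) = p;
  cmap_cont : forall p, cdom p -> {for p, continuous cmap};
  cinv_cont : forall q, (cmap @` cdom) q -> {for q, continuous cinv} }.

Definition crange (M : topologicalType) (chi : chart M) : set 'rV[R]_2 :=
  cmap chi @` cdom chi.

Definition transition (M : topologicalType) (chi chi' : chart M) :
  'rV[R]_2 -> 'rV[R]_2 := cmap chi' \o cinv chi.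

Definition overlap (M : topologicalType) (chi chi' : chart M) : set 'rV[R]_2 :=
  crange chi `&` cinv chi @^-1` cdom chi'.

Definition compatible (M : topologicalType) (chi chi' : chart M) : Prop :=
  smooth_on (overlap chi chi') (transition chi chi') /\
  smooth_on (overlap chi' chi) (transition chi' chi).

Definition same_orientation (M : topologicalType) (chi chi' : chart M) : Prop :=
  forall q, overlap chi chi' q -> 0 < \det (jacobian (transition chi chi') q).

End Charts.

(* Connected oriented smooth surfaces. No metric is recorded: immersions are
   isometric, so the metric is always the one induced by the immersion. *)
Record surface (R : realType) := Surface {
  carrier :> topologicalType;
  surface_hausdorff : hausdorff_space carrier;
  surface_countable : @second_countable carrier;
  surface_connected : connected [set: carrier];
  atlas : set (@chart R carrier);
  atlas_cover : forall p, exists2 chi, atlas chi & cdom chi p;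
  atlas_compatible : forall chi chi', atlas chi -> atlas chi' ->
    compatible chi chi' /\ same_orientation chi chi' }.

Section Hyperbolic.
Context {R : realType}.
Local Notation E5 := 'rV[R]_5.

Definition mink (x y : E5) : R :=
  \sum_(i < 5 | i != ord_max) x 0 i * y 0 i - x 0 ord_max * y 0 ord_max.

Definition H4 : set E5 := [set x | mink x x = -1 /\ 0 < x 0 ord_max].

(* For unit spacelike n, these are the totally geodesic hypersurfaces H^3. *)
Definition H3 (n : E5) : set E5 := H4 `&` [set x | mink x n = 0].

(* For x in H^4: the orthogonal projection onto T_x H^4 = x^perp
   (recall that <x, x> = -1). *)
Definition projH (x w : E5) : E5 := w + mink w x *: x.

(* Levi-Civita connection of H^4 on vector fields extended to R^5_1 *)
Definition covH (U V : E5 -> E5) : E5 -> E5 :=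
  fun y => projH y ('D_(U y) V y).

Definition lie (U V : E5 -> E5) : E5 -> E5 :=
  fun y => 'D_(U y) V y - 'D_(V y) U y.

(* R(u, v) w at x in H^4, for u, v, w in T_x H^4. By tensoriality any tangent
   extensions may be used; here they are y |-> projH y u, etc. *)
Definition curvH (x u v w : E5) : E5 :=
  let U := projH^~ u in let V := projH^~ v in let W := projH^~ w in
  covH U (covH V W) x - covH V (covH U W) x - covH (lie U V) W x.

End Hyperbolic.

(* Geometry of an immersion X into H^4 (composed with the inclusion in R^5_1)
   of an open subset of R^2, at a point q of that subset. Tangent vectors of
   the surface are represented by their coordinates v : 'rV_2, so that
   dX(v) = 'D_v X q. Everything that the conditions on surfaces use is
   invariant under orientation preserving changes of coordinates, so these
   conditions may be expressed in the charts of an oriented atlas. The mean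
   curvature function mean_curv is invariant under all changes of coordinates. *)
Section LocalGeometry.
Context {R : realType}.
Local Notation E2 := 'rV[R]_2.
Local Notation E5 := 'rV[R]_5.

Definition pd {W : normedModType R} (a : 'I_2) (F : E2 -> W) : E2 -> W :=
  'D_(delta_mx 0 a) F.

Variable X : E2 -> E5.

Definition gdot (q v w : E2) : R := mink ('D_v X q) ('D_w X q).

Definition metric (q : E2) : 'M[R]_2 :=
  \matrix_(a, b) mink (pd a X q) (pd b X q).

Definition imetric (q : E2) : 'M[R]_2 := invmx (metric q).

Definition trace2 (T : 'I_2 -> 'I_2 -> E5) (q : E2) : E5 :=
  \sum_a \sum_b imetric q a b *: T a b.

Definition christoffel (k a b : 'I_2) (q : E2) : R :=
  2^-1 * \sum_l imetric q k l *
    (pd a (fun r => metric r b l) q + pd b (fun r => metric r a l) q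
     - pd l (fun r => metric r a b) q).

(* the pull-back connection nabla^phi on sections of phi^*(T H^4) *)
Definition nabla (a : 'I_2) (S : E2 -> E5) : E2 -> E5 :=
  fun q => projH (X q) (pd a S q).

Definition sff (a b : 'I_2) (q : E2) : E5 :=
  nabla a (pd b X) q - \sum_k christoffel k a b q *: pd k X q.

Definition mean_vec (q : E2) : E5 := 2^-1 *: trace2 (fun a b => sff a b q) q.

Definition mean_curv (q : E2) : R := Num.sqrt (mink (mean_vec q) (mean_vec q)).

Definition tension (q : E2) : E5 := 2 *: mean_vec q.

Definition rough_laplacian (S : E2 -> E5) (q : E2) : E5 :=
  - trace2 (fun a b => nabla a (nabla b S) q
                       - \sum_k christoffel k a b q *: nabla k S q) q.

Definition bitension (q : E2) : E5 :=
  - rough_laplacian tension q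
  - trace2 (fun a b => curvH (X q) (pd a X q) (tension q) (pd b X q)) q.

(* tangential and normal parts of w in T_X(q) H^4 *)
Definition tangential (q : E2) (w : E5) : E5 :=
  trace2 (fun a b => mink w (pd a X q) *: pd b X q) q.

Definition normal_part (q : E2) (w : E5) : E5 := w - tangential q w.

Definition nabla_perp (a : 'I_2) (S : E2 -> E5) (q : E2) : E5 :=
  normal_part q (nabla a S q).

Definition grad (h : E2 -> R) (q : E2) : E2 :=
  (\row_a pd a h q) *m imetric q.

(* the shape operator of the normal vector xi: <A v, w> = <B(v, w), xi> *)
Definition shape (q : E2) (xi : E5) (v : E2) : E2 :=
  v *m (\matrix_(a, b) mink (sff a b q) xi) *m imetric q.

Definition frame1 (q : E2) : E2 :=
  let G := grad mean_curv q in (Num.sqrt (gdot q G G))^-1 *: G.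

Definition frame3 (q : E2) : E5 := (mean_curv q)^-1 *: mean_vec q.

(* v2 is the vector E_2 at q *)
Definition is_frame2 (q v2 : E2) : Prop :=
  [/\ gdot q v2 v2 = 1, gdot q (frame1 q) v2 = 0 &
      0 < \det (col_mx (frame1 q) v2)].

(* w4 is the vector E_4 at q. The normal bundle has the orientation for which
   (E_1, E_2, E_3, E_4) is positive in H^4, where a frame (w_1, .., w_4) of
   T_x H^4 is positive if det (w_1, .., w_4, x) > 0. *)
Definition is_frame4 (q v2 : E2) (w4 : E5) : Prop :=
  [/\ mink w4 w4 = 1,
      mink w4 (X q) = 0 /\ (forall v, mink w4 ('D_v X q) = 0),
      mink w4 (frame3 q) = 0 &
      0 < \det (\matrix_(i < 5)
            [:: 'D_(frame1 q) X q; 'D_v2 X q; frame3 q; w4; X q]`_i)].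

Definition pnmc_biconservative_at (q : E2) : Prop :=
  [/\ tangential q (bitension q) = 0, 0 < mean_curv q,
      grad mean_curv q != 0 & forall a, nabla_perp a frame3 q = 0].

Definition ode_rhs (c C f : R) : R :=
  4 / 3 * f *
  Num.sqrt (1 + 9 * C * f `^ (3 / 2) - 9 * f ^+ 2 - c ^+ 2 * f ^+ 3).

Definition attached_constants_at (c C : R) (q : E2) : Prop :=
  [/\ forall v2 w4, is_frame2 q v2 -> is_frame4 q v2 w4 ->
        shape q w4 (frame1 q) = (c * mean_curv q `^ (3 / 2)) *: frame1 q /\
        shape q w4 v2 = - (c * mean_curv q `^ (3 / 2)) *: v2,
      'D_(frame1 q) mean_curv q = ode_rhs c C (mean_curv q) &
      0 < ode_rhs c C (mean_curv q)].

End LocalGeometry.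

Section Surfaces.
Context {R : realType} {M : surface R}.
Implicit Type phi : M -> 'rV[R]_5.

Definition on_charts phi (P : ('rV[R]_2 -> 'rV[R]_5) -> 'rV[R]_2 -> Prop) :=
  forall chi, atlas chi -> forall q, crange chi q -> P (phi \o cinv chi) q.

Definition immersion_in_H4 phi : Prop :=
  [/\ forall p, H4 (phi p),
      forall chi, atlas chi -> smooth_on (crange chi) (phi \o cinv chi) &
      on_charts phi (fun X q => forall v, 'D_v X q = 0 -> v = 0)].

Definition completely_contained phi : Prop :=
  forall (W : set M) (n : 'rV[R]_5), open W -> W !=set0 -> mink n n = 1 ->
    ~ (phi @` W `<=` H3 n).

Definition pnmc_biconservative phi : Prop :=
  [/\ immersion_in_H4 phi, on_charts phi pnmc_biconservative_at &
      completely_contained phi].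

Definition attached_constants phi (c C : R) : Prop :=
  c != 0 /\ on_charts phi (fun X q => attached_constants_at X c C q).

(* compatible with the smooth structure; the orientation may be reversed *)
Definition smooth_chart (chi : @chart R M) : Prop :=
  forall chi', atlas chi' -> compatible chi chi'.

End Surfaces.

(* Frenet theory of a curve s in the totally geodesic H^3 orthogonal to the
   unit spacelike vector n; here T_x H^3 is the orthogonal of x and n. *)
Section Curves.
Context {R : realType}.
Variables (n : 'rV[R]_5) (s : R -> 'rV[R]_5).

Definition unit_speed_curve_in_H3 (I : set R) : Prop :=
  [/\ smooth_on I s, forall u, I u -> H3 n (s u) &
      forall u, I u -> mink (derive1 s u) (derive1 s u) = 1].

Definition covH3 (S : R -> 'rV[R]_5) (u : R) : 'rV[R]_5 :=
  projH (s u) (derive1 S u) - mink (derive1 S u) n *: n.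

Definition frenet_curvature (u : R) : R :=
  Num.sqrt (mink (covH3 (derive1 s) u) (covH3 (derive1 s) u)).

Definition frenet_normal (u : R) : 'rV[R]_5 :=
  (frenet_curvature u)^-1 *: covH3 (derive1 s) u.

(* the norm of the component of nabla_T N orthogonal to T, i.e., of
   nabla_T N + kappa T *)
Definition frenet_torsion (u : R) : R :=
  let w := covH3 frenet_normal u + frenet_curvature u *: derive1 s u in
  Num.sqrt (mink w w).

End Curves.

(* Main.v *)
(* Write S = (3/4) E_1(f) / f, let e_i be the image of E_i in R^5_1 and D the
   flat connection of R^5_1. Since E_2 f = 0 and E_1 f is a function of f, the
   integral curves of E_1 are geodesics. With the given A_4 and E_3 parallel,
   the Codazzi and Ricci equations for E_4 give <A_3 E_1, E_2> = 0 and
   D_{E_2} e_1 = - S e_2; the Gauss equation, the Codazzi equation for E_3 and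
   trace A_3 = 2 f then force A_3 = diag(- f, 3 f). Hence D_{E_1} e_2 = 0, while
   V = D_{E_2} e_2 satisfies <V, V> = - k^2 for k = 3 sqrt(- C) f^(3/4),
   D_{E_1} V = S V and D_{E_2} V = k^2 e_2. As E_1 k = S k and E_2 k = 0, the
   timelike unit vector n = V / k satisfies D_{E_1} n = 0 and D_{E_2} n = k e_2,
   so e_2 and n span a fixed Lorentzian plane. Let u be a primitive of
   1 / (E_1 f), as a function of f, and let t be the logarithm of a coordinate
   of the null vector e_2 + n: then E_1 = d/du, E_2 = k d/dt, the pair (e_2, n)
   is the hyperbolic rotation by t of a constant pair (b_1, b_2), and
   Phi - n / k does not depend on t. Along t = 0 the structure equations of
   e_1, e_3, e_4 are those of a curve in the H^3 orthogonal to b_1. *)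

Require Import Defs.
From HB Require Import structures.
From mathcomp Require Import all_boot all_order all_algebra.
From mathcomp Require Import all_classical all_reals all_analysis.
From mathcomp Require Import ring lra.
Import Order.TTheory GRing.Theory Num.Theory.
Import numFieldNormedType.Exports.
Local Open Scope classical_set_scope.
Local Open Scope ring_scope.

Set Implicit Arguments.
Unset Strict Implicit.
Unset Printing Implicit Defensive.

(** Since R^5_1 is flat, the equations of Gauss, Codazzi and Ricci are components of one identity:
    the commutator of D_{E_1} and D_{E_2}, applied to e_2, e_3 and e_4, is the derivative along the
    bracket. With s = sqrt f all coefficients are polynomials in s and S, and S^2 = 1 + 9 C s^3 - 9
    s^4 - c^2 s^6 is the given equation for f. Gauss and the trace leave a quadratic for the second
    eigenvalue of A_3, with roots 3 f and - f; differentiating it along E_1 and comparing with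
    Codazzi excludes - f. The vector V has components S, 3 s^2, - c s^3, 1 on e_1, e_3, e_4, Phi, so
    <V, V> = S^2 + 9 s^4 + c^2 s^6 - 1 = 9 C s^3: the sign of C makes V timelike and the curves of
    E_2 hyperbolas. E_4 is given only pointwise, by an orientation; it is smooth because c is
    non-zero, so that it can be solved for in D_{E_1} e_1. No flow is integrated: u and t are
    explicit functions whose dual fields are E_1 and E_2 / k, and a local inverse theorem turns (u,
    t) into a chart. The inverse has differential du E_1 + dt E_2 / k, which yields its smoothness
    and all derivatives in the new coordinates. *)

Section Calculus.
Context {R : realType}.

(** The two difference quotients are the same function of the increment, so no chain rule is
    involved. This carries one-variable theorems over to directional derivatives. *)
Lemma is_derive_line (V W : normedModType R) (G : V -> W) (x v : V) (s : R) :
  derivable G (x + s *: v) v ->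
  is_derive s (1 : R) (fun r => G (x + r *: v)) ('D_v G (x + s *: v)).
Proof.
move=> dG; have E : (fun h : R => h^-1 *: (((fun r => G (x + r *: v)) \o shift s) (h *: 1)
    - G (x + s *: v))) =
    (fun h => h^-1 *: ((G \o shift (x + s *: v)) (h *: v) - G (x + s *: v))).
  apply/funext => h /=; congr (_ *: (G _ - _)).
  by rewrite [h *: (1 : R)]mulr1 scalerDl addrCA.
by apply: DeriveDef; rewrite /derivable /derive /= E.
Qed.

(** [F] has a derivative in the direction v only, so the chain rule is applied to its restriction to
    the line through x, where derivability amounts to differentiability. *)
Lemma derive_comp_diff (V W Z : normedModType R) (F : V -> W) (G : W -> Z) x v :
  derivable F x v -> differentiable G (F x) ->
  is_derive x v (G \o F) ('d G (F x) ('D_v F x)).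
Proof.
move=> dF dG; have dl : derivable F (x + 0 *: v) v by rewrite scale0r addr0.
have [d1 e1] := is_derive_line dl.
have h0 : F (x + 0 *: v) = F x by rewrite scale0r addr0.
have D : differentiable (fun r : R => F (x + r *: v)) 0 by exact/derivable1_diffP.
have dG' : differentiable G ((fun r : R => F (x + r *: v)) 0) by rewrite h0.
have DC := differentiable_comp D dG'.
have /derivable1_diffP dC := DC.
have dGF : derivable (G \o F) x v.
  apply/derivable1P; apply: near_eq_derivable dC; near=> r => /=.
  by rewrite [r *: v + x]addrC.
split=> //; have dl' : derivable (G \o F) (x + 0 *: v) v by rewrite scale0r addr0.
have [_] := is_derive_line dl'; rewrite scale0r addr0 => <-.
rewrite (deriveE _ DC) (diff_comp D dG') /= -(deriveE _ D) e1.
by rewrite !scale0r !addr0.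
Unshelve. all: by end_near. Qed.

Lemma MVT_line (V : normedModType R) (G : V -> R) (x v : V) :
  (forall s, s \in `[(0:R), 1] -> derivable G (x + s *: v) v) ->
  exists2 s, s \in `](0:R), 1[ & G (x + v) - G x = 'D_v G (x + s *: v).
Proof.
move=> dG.
have d r : r \in `[(0:R), 1] -> is_derive r (1:R) (fun r => G (x + r *: v)) ('D_v G (x + r *: v)).
  by move=> r01; apply: is_derive_line; exact: dG.
have d' r (rI : r \in `]0, 1[) := d r (subset_itv_oo_cc rI).
have c : {within `[0, 1], continuous (fun r => G (x + r *: v))}.
  by apply: derivable_within_continuous => r /d[].
have [s sI E] := MVT ltr01 d' c.
by exists s => //; move: E; rewrite /= scale1r scale0r addr0 subr0 mulr1.
Qed.

End Calculus.

(** * Functions of several variables: partial derivatives and their symmetry *)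

Section RowVectors.
Context {R : realType}.

Lemma rV_norm_le n (v : 'rV[R]_n) (e : R) :
  0 <= e -> (forall j, `|v 0 j| <= e) -> `|v| <= e.
Proof.
move=> e0 H; rewrite /Num.Def.normr/= mx_normrE (bigmax_le _ e0)// => -[i j] _ /=.
by rewrite ord1.
Qed.

Lemma rV_coord_le n (v : 'rV[R]_n) j : `|v 0 j| <= `|v|.
Proof.
rewrite [leRHS]/Num.Def.normr/= mx_normrE.
exact: (le_bigmax _ (fun ij : 'I_1 * 'I_n => `|v ij.1 ij.2|) (0, j)).
Qed.

(** Composing the restriction to the line with multiplication by a covers a = 0 as well, where a
    substitution in the difference quotient would fail. *)
Lemma is_deriveZdir (V W : normedModType R) (G : V -> W) x v (a : R) :
  derivable G x v -> is_derive x (a *: v) G (a *: 'D_v G x).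
Proof.
move=> dG; have d0 : derivable G (x + 0 *: v) v by rewrite scale0r addr0.
have [d1 e1] := is_derive_line d0.
have df : differentiable (fun r : R => G (x + r *: v)) ((fun h : R => a * h) 0).
  by rewrite mulr0; exact/derivable1_diffP.
have da : derivable (fun h : R => a * h) 0 1 by apply: derivableM.
have [dc ec] := derive_comp_diff da df.
have dGa : derivable G x (a *: v).
  apply/derivable1P; apply: near_eq_derivable dc; near=> r => /=.
  by rewrite addrC scalerA mulrC.
split=> //.
have d2 : derivable G (x + 0 *: (a *: v)) (a *: v) by rewrite scale0r addr0.
have [_] := is_derive_line d2; rewrite scale0r addr0 => <-.
have -> : (fun r : R => G (x + r *: (a *: v))) =
   ((fun r => G (x + r *: v)) \o (fun h => a * h)).
  by apply/funext => r /=; rewrite scalerA mulrC.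
have e2 : 'D_1 ( *%R a) 0 = a.
  have di : derivable (@id R) 0 1 by exact: derivable_id.
  by have := deriveZ a di; rewrite derive_id [a *: 1]mulr1.
rewrite ec e2 mulr0 -[X in 'd _ _ X]mulr1 -['d _ _ _]/('d (fun r : R => G (x + r *: v)) 0 (a *: 1)).
rewrite linearZ /= -deriveE; last exact/derivable1_diffP.
by rewrite e1 scale0r addr0.
Unshelve. all: by end_near. Qed.

Lemma derivableZdir (V W : normedModType R) (G : V -> W) x v (a : R) :
  derivable G x v -> derivable G x (a *: v).
Proof. by case/(is_deriveZdir a). Qed.

Lemma deriveZdir (V W : normedModType R) (G : V -> W) x v (a : R) :
  derivable G x v -> 'D_(a *: v) G x = a *: 'D_v G x.
Proof. by case/(is_deriveZdir a). Qed.

(** Smoothness is stated with directional derivatives, while the chain rule asks for a differential;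
    continuity of the partial derivatives provides it. The increment is split along the coordinate
    axes and each piece is handled by the mean value theorem. *)
Lemma differentiable_partials n (G : 'rV[R]_n -> R) x :
  (\forall y \near x, forall j, derivable G y (delta_mx 0 j)) ->
  (forall j, {for x, continuous ('D_(delta_mx 0 j) G)}) ->
  differentiable G x.
Proof.
move=> dG cG.
pose L (h : 'rV[R]_n) : R := \sum_j h 0 j *: 'D_(delta_mx 0 j) G x.
have Ll : linear L.
  move=> a u v; rewrite /L scaler_sumr -big_split; apply: eq_bigr => j _ /=.
  by rewrite !mxE scalerDl scalerA.
pose LM := GRing.isLinear.Build _ _ _ _ _ Ll.
pose LL : {linear _ -> _} := HB.pack L LM.
have Lc : continuous (LL : _ -> _).
  apply: (@bounded_linear_continuous _ _ _ LL); apply/linear_boundedP.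
  near=> M => y; rewrite /LL /= /L (le_trans (ler_norm_sum _ _ _))//.
  apply: (@le_trans _ _ (\sum_j `|'D_(delta_mx 0 j) G x| * `|y|)).
    by apply: ler_sum => j _; rewrite normrM mulrC ler_wpM2l// rV_coord_le.
  rewrite -mulr_suml ler_wpM2r//; near: M; exact: nbhs_pinfty_ge.
suff H : G \o shift x = cst (G x) + LL +o_ 0 id.
  have E := diff_unique Lc H; apply/diff_locallyP; rewrite E.
  by split=> //; exact: Lc.
apply/eqaddoP => e e0.
(* Each coordinate may contribute e / (n + 1); the successor keeps the divisor non-zero when n =
   0. *)
have cG' : \forall y \near x, forall j, `|'D_(delta_mx 0 j) G x - 'D_(delta_mx 0 j) G y| <= e / n.+1%:R.
  near=> y; move=> j; move: j; near: y; apply: filter_forall => j.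
  by move/cvgrPdist_le : (cG j); apply; rewrite divr_gt0.
have [d d0 Hd] := (nbhs_ballP _ _).1 (filterI dG cG').
apply/nbhs_ballP; exists d => // h; rewrite -ball_normE /= sub0r normrN => hd.
rewrite -[(_ - _) h]/(G (h + x) - (G x + L h)).
(* The first k coordinates of h: consecutive truncations differ along a single axis, and the sum
   telescopes. *)
pose hk k : 'rV[R]_n := \row_j (if (j < k)%N then h 0 j else 0).
have hkS (k : 'I_n) : hk k.+1 = hk k + h 0 k *: delta_mx 0 k.
  apply/rowP => j; rewrite !mxE eqxx /= -val_eqE /= ltnS leq_eqVlt.
  have [/eqP/val_inj ->|nk] := boolP (val j == val k); rewrite /= ?ltnn ?add0r ?mulr1//.
  by rewrite mulr0 addr0.
have hkn : hk n = h by apply/rowP => j; rewrite mxE ltn_ord.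
have hk0 : hk 0%N = 0 by apply/rowP => j; rewrite !mxE.
have hkd (k : 'I_n) s : s \in `[(0:R), 1] -> ball x d (x + hk k + s *: (h 0 k *: delta_mx 0 k)).
  rewrite in_itv /= => /andP[s0 s1].
  rewrite -ball_normE /= -addrA opprD addNKr normrN (le_lt_trans _ hd)//.
  apply: rV_norm_le => // j; rewrite !mxE eqxx /=.
  have := rV_coord_le h j; have [->|jk] := eqVneq j k.
    rewrite ltnn add0r mulr1 normrM (ger0_norm s0); apply: le_trans.
    by rewrite ler_piMl.
  by rewrite !mulr0 addr0; case: ifP; rewrite ?normr0.
have step (k : 'I_n) : `|G (x + hk k.+1) - G (x + hk k) - h 0 k * 'D_(delta_mx 0 k) G x|
   <= e / n.+1%:R * `|h|.
  have dv s : s \in `[(0:R), 1] ->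
      derivable G (x + hk k + s *: (h 0 k *: delta_mx 0 k)) (h 0 k *: delta_mx 0 k).
    by move=> s01; apply: derivableZdir; exact: (Hd _ (hkd k s s01)).1.
  have [s sI] := MVT_line dv.
  have s01 := subset_itv_oo_cc sI.
  rewrite hkS addrA => ->; have [H1 H2] := Hd _ (hkd k s s01).
  rewrite deriveZdir// -mulrBr normrM mulrC ler_pM ?rV_coord_le//.
  by rewrite distrC.
have -> : G (h + x) - (G x + L h) =
   \sum_(k < n) (G (x + hk k.+1) - G (x + hk k) - h 0 k * 'D_(delta_mx 0 k) G x).
  rewrite sumrB -(big_mkord xpredT (fun k => G (x + hk k.+1) - G (x + hk k))).
  by rewrite telescope_sumr// hkn hk0 addr0 opprD addrA [h + x]addrC.
apply: (le_trans (ler_norm_sum _ _ _)).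
apply: (@le_trans _ _ (\sum_(k < n) e / n.+1%:R * `|h|)); first exact: ler_sum.
rewrite sumr_const card_ord -[leLHS]mulr_natr mulrAC -[leRHS]/(e * `|h|) ler_wpM2r//.
rewrite -mulrA ler_piMr ?(ltW e0)// [leLHS]mulrC ler_pdivrMr// mul1r ler_nat//.
Unshelve. all: by end_near. Qed.

Lemma is_derive_shift_arg (V W : normedModType R) (G : V -> W) (c y v : V) :
  derivable G (y + c) v -> is_derive y v (fun z => G (z + c)) ('D_v G (y + c)).
Proof.
move=> dG; have E : (fun h : R => h^-1 *: (((fun z => G (z + c)) \o shift y) (h *: v)
    - G (y + c))) =
    (fun h => h^-1 *: ((G \o shift (y + c)) (h *: v) - G (y + c))).
  by apply/funext => h /=; rewrite addrA.
by apply: DeriveDef; rewrite /derivable /derive /= E.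
Qed.

(** The second difference of G over a small parallelogram with sides s v and s w is s^2 times a
    mixed derivative at some point of it, in either order; continuity at x then compares the two. *)
Lemma schwarz_symmetry (V : normedModType R) (G : V -> R) (x v w : V) :
  (\forall y \near x, [/\ derivable G y v, derivable G y w,
      derivable ('D_v G) y w & derivable ('D_w G) y v]) ->
  {for x, continuous ('D_v ('D_w G))} -> {for x, continuous ('D_w ('D_v G))} ->
  'D_v ('D_w G) x = 'D_w ('D_v G) x.
Proof.
move=> dG c1 c2; apply/eqP; rewrite -subr_eq0 -normr_le0.
apply/ler_addgt0Pl => e e0; rewrite addr0.
have e2 : 0 < e / 2 by rewrite divr_gt0.
have tri (A B p q : R) : `|A - q| <= e / 2 -> `|B - p| <= e / 2 -> p = q -> `|A - B| <= e.
  move=> H1 H2 E; rewrite [e]splitr -(subrKA q) (le_trans (ler_normD _ _))// lerD//.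
  by rewrite -E distrC.
have [d d0 Hd] := (nbhs_ballP _ _).1 (filterI dG
  (filterI ((cvgrPdist_le _ _).1 c1 _ e2) ((cvgrPdist_le _ _).1 c2 _ e2))).
pose N := `|v| + `|w| + 1.
have N0 : 0 < N by rewrite ltr_wpDl// addr_ge0.
(* A scale for which the whole parallelogram lies in the ball where all the estimates hold. *)
have [s s0 sN] : exists2 s : R, 0 < s & s * N < d.
  exists (d / 2 / N); first by rewrite !divr_gt0.
  by rewrite divfK ?gt_eqF// ltr_pdivrMr// ltr_pMr// ltr1n.
have inb a b : a \in `[(0:R), 1] -> b \in `[(0:R), 1] -> ball x d (x + a *: (s *: v) + b *: (s *: w)).
  rewrite !in_itv /= => /andP[a0 a1] /andP[b0 b1].
  rewrite -ball_normE /= -addrA opprD addNKr normrN (le_lt_trans _ sN)//.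
  rewrite (le_trans (ler_normD _ _))// !normrZ (ger0_norm a0) (ger0_norm b0) (gtr0_norm s0).
  rewrite /N !mulrDr mulr1 -[leLHS]addr0 lerD ?(ltW s0)// lerD//.
    by rewrite ler_piMl// mulr_ge0// ltW.
  by rewrite ler_piMl// mulr_ge0// ltW.
have i0 : 0 \in `[(0:R), 1] by rewrite in_itv /= lexx ler01.
have i1 : 1 \in `[(0:R), 1] by rewrite in_itv /= lexx ler01.
(* The mean value theorem in direction v' for y |-> G (y + s w') - G y, then in direction w' for the
   derivative obtained; it is used for (v, w) and for (w, v). *)
have key (v' w' : V) :
  (forall a b, a \in `[(0:R), 1] -> b \in `[(0:R), 1] ->
    [/\ derivable G (x + a *: (s *: v') + b *: (s *: w')) v' &
     derivable ('D_v' G) (x + a *: (s *: v') + b *: (s *: w')) w']) ->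
  exists a b, [/\ a \in `[(0:R), 1], b \in `[(0:R), 1] &
   G (x + s *: v' + s *: w') - G (x + s *: v') - (G (x + s *: w') - G x) =
   s * (s * 'D_w' ('D_v' G) (x + a *: (s *: v') + b *: (s *: w')))].
  move=> D.
  have DH a : a \in `[(0:R), 1] -> is_derive (x + a *: (s *: v')) (s *: v')
     (fun y => G (y + s *: w') - G y)
     (s *: ('D_v' G (x + a *: (s *: v') + s *: w') - 'D_v' G (x + a *: (s *: v')))).
    move=> ia; have [d1 _] := D a 1 ia i1; have [d2 _] := D a 0 ia i0.
    move: d1 d2; rewrite scale1r scale0r addr0 => d1 d2.
    rewrite scalerBr -(deriveZdir s d1) -(deriveZdir s d2).
    apply: is_deriveB; last by apply: derivableP; exact: derivableZdir.
    by apply: is_derive_shift_arg; exact: derivableZdir.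
  have dH a (ia : a \in `[(0:R), 1]) := @ex_derive _ _ _ _ _ _ _ (DH a ia).
  have [a /subset_itv_oo_cc ia E1] := MVT_line dH.
  have dD b : b \in `[(0:R), 1] ->
      derivable ('D_v' G) (x + a *: (s *: v') + b *: (s *: w')) (s *: w').
    by move=> ib; apply: derivableZdir; have [] := D a b ia ib.
  have [b /subset_itv_oo_cc ib E2] := MVT_line dD.
  exists a, b; split=> //; rewrite E1 (derive_val (is_derive := DH a ia)) E2.
  by have [_ d2] := D a b ia ib; rewrite (deriveZdir _ d2).
have D1 a b (ia : a \in `[(0:R), 1]) (ib : b \in `[(0:R), 1]) := Hd _ (inb a b ia ib).
have [|a [b [ia ib E1]]] := key v w.
  move=> a b ia ib; have [[d1 _ d2 _] _] := D1 a b ia ib.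
  by split; [exact: d1|exact: d2].
have [|a' [b' [ia' ib' E2]]] := key w v.
  move=> a' b' ia' ib'; have [[_ d1 _ d2] _] := D1 b' a' ib' ia'.
  by rewrite (addrAC x); split; [exact: d1|exact: d2].
have E : 'D_w ('D_v G) (x + a *: (s *: v) + b *: (s *: w)) =
    'D_v ('D_w G) (x + a' *: (s *: w) + b' *: (s *: v)).
  apply: (mulfI (lt0r_neq0 s0)); apply: (mulfI (lt0r_neq0 s0)).
  apply: (etrans (esym E1)); apply: (etrans _ E2).
  rewrite (addrAC x (s *: w)); move: (G _) (G _) (G _) (G _) => p q r t.
  by ring.
have [_ [_ H2]] := D1 a b ia ib.
have [_ []] := D1 b' a' ib' ia'; rewrite (addrAC x (b' *: _)) => H1 _.
exact: tri H1 H2 E.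
Qed.

End RowVectors.

(** * Smooth functions *)

Section Ck.
Context {R : realType}.

(** The recursion is on the derivative taken first, whereas [iter_derive] is built from the one
    taken last; in this form the product and chain rules are plain inductions on n. *)
Fixpoint Ck (n : nat) (V W : normedModType R) (U : set V) (F : V -> W) : Prop :=
  match n with
  | 0 => forall x, U x -> {for x, continuous F}
  | m.+1 => [/\ forall x, U x -> {for x, continuous F},
                forall x v, U x -> derivable F x v &
                forall v, Ck m U ('D_v F)]
  end.

Definition Cinf (V W : normedModType R) (U : set V) (F : V -> W) : Prop :=
  forall n, Ck n U F.

Section general.
Variables V W : normedModType R.
Implicit Types (U A : set V) (F G : V -> W).

Lemma CkW n U F : Ck n.+1 U F -> Ck n U F.
Proof.
elim: n F => [|n IH] F; first by case.
by move=> [cF dF DF]; split=> // v; apply: IH; exact: DF.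
Qed.

Lemma Ck_sub n U A F : A `<=` U -> Ck n U F -> Ck n A F.
Proof.
move=> AU; elim: n F => [|n IH] F /=; first by move=> H x /AU; exact: H.
move=> [cF dF DF]; split; first by move=> x /AU; exact: cF.
- by move=> x v /AU; exact: dF.
- by move=> v; exact/IH/DF.
Qed.

Lemma eq_derive_on U F G x v : open U -> (forall y, U y -> F y = G y) -> U x ->
  'D_v F x = 'D_v G x.
Proof.
move=> oU FG Ux; apply: near_eq_derive; near=> y; apply: FG; near: y.
exact: open_nbhs_nbhs.
Unshelve. all: by end_near. Qed.

Lemma eq_is_derive_on U F G x v d : open U -> (forall y, U y -> F y = G y) -> U x ->
  is_derive x v F d -> is_derive x v G d.
Proof.
move=> oU FG Ux; apply: near_eq_is_derive; near=> y; apply: FG; near: y.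
exact: open_nbhs_nbhs.
Unshelve. all: by end_near. Qed.

Lemma eq_continuous_on U F G x : open U -> (forall y, U y -> F y = G y) -> U x ->
  {for x, continuous F} -> {for x, continuous G}.
Proof.
move=> oU FG Ux cF; rewrite /prop_for /continuous_at -(FG _ Ux).
apply: cvg_trans cF; apply: near_eq_cvg; near=> y; apply: FG; near: y.
exact: open_nbhs_nbhs.
Unshelve. all: by end_near. Qed.

Lemma eq_Ck n U F G : open U -> (forall y, U y -> F y = G y) -> Ck n U F -> Ck n U G.
Proof.
move=> oU; elim: n F G => [|n IH] F G FG /=.
  by move=> H x Ux; exact: (eq_continuous_on oU FG Ux (H _ Ux)).
move=> [cF dF DF]; split.
- by move=> x Ux; exact: (eq_continuous_on oU FG Ux (cF _ Ux)).
- move=> x v Ux; have := eq_is_derive_on oU FG Ux (derivableP (dF x v Ux)).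
  by case.
- move=> v; apply: IH (DF v) => y Uy; exact: eq_derive_on oU FG Uy.
Qed.

Lemma Cinf_continuous U F x : Cinf U F -> U x -> {for x, continuous F}.
Proof. by move=> H; exact: H 0%N x. Qed.

Lemma Cinf_derivable U F x v : Cinf U F -> U x -> derivable F x v.
Proof. by move=> H Ux; have [_ + _] := H 1%N; exact. Qed.

Lemma Cinf_is_derive U F x v : Cinf U F -> U x -> is_derive x v F ('D_v F x).
Proof. by move=> H Ux; exact: derivableP (Cinf_derivable H Ux). Qed.

Lemma Cinf_derive U F v : Cinf U F -> Cinf U ('D_v F).
Proof. by move=> H n; have [_ _] := H n.+1; exact. Qed.

Lemma Cinf_sub U A F : A `<=` U -> Cinf U F -> Cinf A F.
Proof. by move=> AU H n; exact: Ck_sub AU (H n). Qed.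

Lemma eq_Cinf U F G : open U -> (forall y, U y -> F y = G y) -> Cinf U F -> Cinf U G.
Proof. by move=> oU FG H n; exact: (eq_Ck oU FG (H n)). Qed.

Lemma iter_derive_rcons vs v F :
  iter_derive (rcons vs v) F = iter_derive vs ('D_v F).
Proof. by rewrite /iter_derive foldr_rcons. Qed.

(** The head of the list in [iter_derive] acts last, while [Ck] peels off the derivative acting
    first; hence the induction at the end of the list. *)
Lemma smooth_onP U F : smooth_on U F <-> Cinf U F.
Proof.
split=> [H n|].
  elim: n F H => [|n IH] F H /=; first by move=> x Ux; exact: (H [::] x Ux).1.
  split; first by move=> x Ux; exact: (H [::] x Ux).1.
  - by move=> x v Ux; exact: (H [::] x Ux).2.
  - by move=> v; apply: IH => vs x Ux; rewrite -iter_derive_rcons; exact: H.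
move=> H vs; elim/last_ind: vs F H => [|vs v IH] F H x Ux.
  by split; [exact: Cinf_continuous H Ux|move=> v; exact: Cinf_derivable H Ux].
by rewrite iter_derive_rcons; apply: IH => //; exact: Cinf_derive.
Qed.

Lemma Ck_cst n U (a : W) : Ck n U (fun=> a).
Proof.
elim: n a => [|n IH] a /=; first by move=> x _; exact: cvg_cst.
split; first by move=> x _; exact: cvg_cst.
- by move=> x v _; exact: derivable_cst.
- move=> v; suff -> : 'D_v (fun=> a) = (fun=> 0) :> (V -> W) by exact: IH.
  by apply/funext => x; rewrite derive_cst.
Qed.

Lemma Ck_add n U F G : open U -> Ck n U F -> Ck n U G -> Ck n U (fun x => F x + G x).
Proof.
move=> oU; elim: n F G => [|n IH] F G /=.
  by move=> cF cG x Ux; apply: cvgD; [exact: cF|exact: cG].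
move=> [cF dF DF] [cG dG DG]; split.
- by move=> x Ux; apply: cvgD; [exact: cF|exact: cG].
- by move=> x v Ux; apply: derivableD; [exact: dF|exact: dG].
- move=> v; apply: eq_Ck (IH _ _ (DF v) (DG v)) => // y Uy.
  by rewrite -deriveD; [ |exact: dF|exact: dG].
Qed.

Lemma Ck_opp n U F : open U -> Ck n U F -> Ck n U (fun x => - F x).
Proof.
move=> oU; elim: n F => [|n IH] F /=.
  by move=> cF x Ux; apply: cvgN; exact: cF.
move=> [cF dF DF]; split.
- by move=> x Ux; apply: cvgN; exact: cF.
- by move=> x v Ux; apply: derivableN; exact: dF.
- move=> v; apply: eq_Ck (IH _ (DF v)) => // y Uy.
  by rewrite -deriveN; [ |exact: dF].
Qed.

Lemma Cinf_cst U (a : W) : Cinf U (fun=> a).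
Proof. by move=> n; exact: Ck_cst. Qed.

Lemma Cinf_add U F G : open U -> Cinf U F -> Cinf U G -> Cinf U (fun x => F x + G x).
Proof. by move=> oU HF HG n; exact: Ck_add. Qed.

Lemma Cinf_opp U F : open U -> Cinf U F -> Cinf U (fun x => - F x).
Proof. by move=> oU HF n; exact: Ck_opp. Qed.

Lemma Cinf_sub_fun U F G : open U -> Cinf U F -> Cinf U G -> Cinf U (fun x => F x - G x).
Proof. by move=> oU HF HG; apply: Cinf_add => //; exact: Cinf_opp. Qed.

Lemma Ck_sum n U (I : finType) (F : I -> V -> W) : open U ->
  (forall i, Ck n U (F i)) -> Ck n U (fun x => \sum_i F i x).
Proof.
move=> oU H; rewrite unlock /=; elim: (index_enum I) => [|i s IH] /=; first exact: Ck_cst.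
exact: Ck_add.
Qed.

Lemma Cinf_sum U (I : finType) (F : I -> V -> W) : open U ->
  (forall i, Cinf U (F i)) -> Cinf U (fun x => \sum_i F i x).
Proof. by move=> oU H n; apply: Ck_sum => // i; exact: H. Qed.

End general.

Lemma Ck_mul n (V : normedModType R) (U : set V) (F G : V -> R) : open U ->
  Ck n U F -> Ck n U G -> Ck n U (fun x => F x * G x).
Proof.
move=> oU; elim: n F G => [|n IH] F G.
  by move=> cF cG x Ux; apply: cvgM; [exact: cF|exact: cG].
move=> HF HG; have [cF dF DF] := HF; have [cG dG DG] := HG; split.
- by move=> x Ux; apply: cvgM; [exact: cF|exact: cG].
- by move=> x v Ux; apply: derivableM; [exact: dF|exact: dG].
- move=> v.
  apply: eq_Ck (Ck_add oU (IH _ _ (CkW HF) (DG v)) (IH _ _ (CkW HG) (DF v))) => // y Uy.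
  by rewrite -[RHS]/('D_v (F * G) y) deriveM; [ |exact: dF|exact: dG].
Qed.

Lemma Cinf_mul (V : normedModType R) (U : set V) (F G : V -> R) : open U ->
  Cinf U F -> Cinf U G -> Cinf U (fun x => F x * G x).
Proof. by move=> oU HF HG n; exact: Ck_mul. Qed.

Lemma Ck_id n (V : normedModType R) (U : set V) : Ck n U (@id V).
Proof.
case: n => [|n] /=; first by move=> x _; exact: cvg_id.
split; first by move=> x _; exact: cvg_id.
- by move=> x v _; exact: derivable_id.
- move=> v; suff -> : 'D_v (@id V) = (fun=> v) by exact: Ck_cst.
  by apply/funext => x; rewrite derive_id.
Qed.

Section coordinates.
Variables (V : normedModType R) (m : nat).
Implicit Types (U : set V) (F : V -> 'rV[R]_m).

Lemma continuous_rV F x :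
  {for x, continuous F} <-> forall j, {for x, continuous (fun y => F y 0 j)}.
Proof.
split=> [cF j|cF].
  exact: (@continuous_comp _ _ _ F (fun M : 'rV[R]_m => M 0 j) x cF (@coord_continuous _ _ _ 0 j _)).
apply/cvgrPdist_le => e e0.
have H : \forall y \near x, forall j, `|F x 0 j - F y 0 j| <= e.
  near=> y; move=> j; move: j; near: y; apply: filter_forall => j.
  by move/cvgrPdist_le : (cF j); exact.
apply: filterS H => y H; apply: rV_norm_le; first exact: ltW.
by move=> j; rewrite !mxE.
Unshelve. all: by end_near. Qed.

Lemma derivable_rV F x v :
  derivable F x v <-> forall j, derivable (fun y => F y 0 j) x v.
Proof.
split=> [/derivable_mxP H j //|H].
by apply/derivable_mxP => i j; rewrite ord1.
Qed.

Lemma derive_rV F x v j : derivable F x v ->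
  ('D_v F x) 0 j = 'D_v (fun y => F y 0 j) x.
Proof. by move=> dF; rewrite derive_mx// mxE. Qed.

Lemma Ck_rV n U F : open U ->
  (Ck n U F <-> forall j, Ck n U (fun x => F x 0 j)).
Proof.
move=> oU; elim: n F => [|n IH] F /=.
  split=> [H j x Ux|H x Ux]; first by have /continuous_rV := H x Ux; exact.
  by apply/continuous_rV => j; exact: H.
split=> [[cF dF DF] j|H].
  split.
  - by move=> x Ux; have /continuous_rV := cF x Ux; exact.
  - by move=> x v Ux; have /derivable_rV := dF x v Ux; exact.
  - move=> v; have /IH/(_ j) := DF v; apply: eq_Ck => // y Uy.
    by rewrite derive_rV//; exact: dF.
have dF x v : U x -> derivable F x v.
  by move=> Ux; apply/derivable_rV => j; have [_ + _] := H j; exact.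
split=> //.
- by move=> x Ux; apply/continuous_rV => j; have [+ _ _] := H j; exact.
- move=> v; apply/IH => j; have [_ _ /(_ v)] := H j; apply: eq_Ck => // y Uy.
  by rewrite derive_rV//; exact: dF.
Qed.

Lemma Cinf_rV U F : open U -> (forall j, Cinf U (fun x => F x 0 j)) -> Cinf U F.
Proof. by move=> oU H n; apply/Ck_rV => // j; exact: H. Qed.

Lemma Cinf_coord U F j : open U -> Cinf U F -> Cinf U (fun x => F x 0 j).
Proof. by move=> oU H n; have /Ck_rV := H n; exact. Qed.

Lemma Cinf_scale U (k : V -> R) F : open U ->
  Cinf U k -> Cinf U F -> Cinf U (fun x => k x *: F x).
Proof.
move=> oU Hk HF; apply: Cinf_rV => // j.
have := Cinf_mul oU Hk (Cinf_coord j oU HF); apply: eq_Cinf => // y _.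
by rewrite mxE.
Qed.

End coordinates.

Section composition.
Variables (V : normedModType R).
Implicit Types (U : set V).

Lemma C1_differentiable (m : nat) (A : set 'rV[R]_m) (G : 'rV[R]_m -> R) x :
  open A -> Ck 1 A G -> A x -> differentiable G x.
Proof.
move=> oA [cG dG DG] Ax; apply: differentiable_partials => [|j]; last exact: DG.
near=> y; move=> j; apply: dG; near: y; exact: open_nbhs_nbhs.
Unshelve. all: by end_near. Qed.

Lemma derive_sum_coord (m : nat) (G : 'rV[R]_m -> R) x (w : 'rV[R]_m) :
  differentiable G x -> 'D_w G x = \sum_j w 0 j * 'D_(delta_mx 0 j) G x.
Proof.
move=> dG; rewrite deriveE// [in LHS](row_sum_delta w) linear_sum /=.
by apply: eq_bigr => j _; rewrite linearZ /= deriveE.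
Qed.

Lemma derive_comp_coord (m : nat) (G : 'rV[R]_m -> R) (F : V -> 'rV[R]_m) x v :
  derivable F x v -> differentiable G (F x) ->
  is_derive x v (G \o F) (\sum_j ('D_v F x) 0 j * 'D_(delta_mx 0 j) G (F x)).
Proof.
move=> dF dG; have := derive_comp_diff dF dG.
by rewrite -deriveE// derive_sum_coord.
Qed.

(** The derivative of the composite is a sum of products of coordinates of the derivative of F with
    partial derivatives of G composed with the same F, so the induction on n keeps F and varies
    G. *)
Lemma Ck_comp n (m : nat) U (A : set 'rV[R]_m) (G : 'rV[R]_m -> R) (F : V -> 'rV[R]_m) :
  open U -> open A -> (forall x, U x -> A (F x)) ->
  Ck n U F -> Ck n A G -> Ck n U (G \o F).
Proof.
move=> oU oA FA; elim: n G => [|n IH] G HF HG.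
  move=> x Ux; apply: continuous_comp; first exact: HF.
  by apply: HG; exact: FA.
have [cF dF DF] := HF; have [cG dG DG] := HG.
have difG y : A y -> differentiable G y.
  by apply: C1_differentiable => //; split=> // v; have := DG v; case: (n) => [|k]//; case.
have dGF x v (Ux : U x) := derive_comp_coord (dF x v Ux) (difG _ (FA _ Ux)).
split.
- move=> x Ux; apply: continuous_comp; first exact: cF.
  by apply: cG; exact: FA.
- by move=> x v Ux; have [] := dGF x v Ux.
- move=> v; have H j : Ck n U (fun x => ('D_v F x) 0 j * ('D_(delta_mx 0 j) G \o F) x).
    apply: Ck_mul => //; first by have /Ck_rV := DF v; exact.
    by apply: IH; [exact: CkW|exact: DG].
  apply: eq_Ck (Ck_sum oU H) => // y Uy.
  by have [_ ->] := dGF y v Uy.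
Qed.

Lemma Cinf_comp (m : nat) U (A : set 'rV[R]_m) (G : 'rV[R]_m -> R) (F : V -> 'rV[R]_m) :
  open U -> open A -> (forall x, U x -> A (F x)) ->
  Cinf U F -> Cinf A G -> Cinf U (G \o F).
Proof. by move=> oU oA FA HF HG n; exact: (Ck_comp oU oA FA (HF n) (HG n)). Qed.

Lemma Cinf_comp_rV (m k : nat) U (A : set 'rV[R]_m) (G : 'rV[R]_m -> 'rV[R]_k)
    (F : V -> 'rV[R]_m) :
  open U -> open A -> (forall x, U x -> A (F x)) ->
  Cinf U F -> Cinf A G -> Cinf U (G \o F).
Proof.
move=> oU oA FA HF HG; apply: Cinf_rV => // j.
exact: Cinf_comp HF (Cinf_coord j oA HG).
Qed.

Lemma derive_comp_real (W : normedModType R) (G : R -> W) (F : V -> R) x v :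
  derivable F x v -> derivable G (F x) 1 ->
  is_derive x v (G \o F) ('D_v F x *: 'D_1 G (F x)).
Proof.
move=> dF /derivable1_diffP dG; have := derive_comp_diff dF dG.
by rewrite -[X in 'd _ _ X]mulr1 -['d _ _ _]/('d G (F x) ('D_v F x *: 1)) linearZ -(deriveE _ dG).
Qed.

Lemma Ck_comp_real n U (A : set R) (G : R -> R) (F : V -> R) :
  open U -> open A -> (forall x, U x -> A (F x)) ->
  Ck n U F -> Ck n A G -> Ck n U (G \o F).
Proof.
move=> oU oA FA; elim: n G => [|n IH] G HF HG.
  move=> x Ux; apply: continuous_comp; first exact: HF.
  by apply: HG; exact: FA.
have [cF dF DF] := HF; have [cG dG DG] := HG.
have dGF x v (Ux : U x) := derive_comp_real (dF x v Ux) (dG _ 1 (FA _ Ux)).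
split.
- move=> x Ux; apply: continuous_comp; first exact: cF.
  by apply: cG; exact: FA.
- by move=> x v Ux; have [] := dGF x v Ux.
- move=> v; have H : Ck n U (fun x => 'D_v F x * ('D_1 G \o F) x).
    by apply: Ck_mul oU (DF v) _; apply: IH; [exact: (CkW HF)|exact: DG].
  by apply: eq_Ck H => // y Uy; have [_ ->] := dGF y v Uy.
Qed.

Lemma Cinf_comp_real U (A : set R) (G : R -> R) (F : V -> R) :
  open U -> open A -> (forall x, U x -> A (F x)) ->
  Cinf U F -> Cinf A G -> Cinf U (fun x => G (F x)).
Proof. by move=> oU oA FA HF HG n; exact: (Ck_comp_real oU oA FA (HF n) (HG n)). Qed.

End composition.
End Ck.
Arguments Cinf_derivable {R V W U F x} v _ _.

(** * Smoothness of elementary real functions, and local primitives *)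

Section RealFunctions.
Context {R : realType}.

(** A primitive gains one order. Applied to functions whose derivative is of the same kind, such as
    powers and the exponential, this gives smoothness by induction. *)
Lemma CkS_real n (U : set R) (G g : R -> R) : open U ->
  (forall x, U x -> is_derive x (1 : R) G (g x)) -> Ck n U g -> Ck n.+1 U G.
Proof.
move=> oU dG Hg.
have d1 x : U x -> derivable G x 1 by move=> /dG[].
have dv x v : U x -> is_derive x v G (v * g x).
  move=> Ux; have := is_deriveZdir v (d1 _ Ux).
  by rewrite [v *: 1]mulr1 (derive_val (is_derive := dG _ Ux)).
split.
- by move=> x /d1 /derivable1_diffP; exact: differentiable_continuous.
- by move=> x v /(dv _ v)[].
- move=> v; apply: eq_Ck (Ck_mul oU (Ck_cst n U v) Hg) => // y Uy.
  by have [_ ->] := dv y v Uy.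
Qed.

Lemma Cinf_antiderivative (U : set R) (G g : R -> R) : open U ->
  (forall x, U x -> is_derive x (1 : R) G (g x)) -> Cinf U g -> Cinf U G.
Proof. by move=> oU dG Hg n; apply: CkW; exact: CkS_real (Hg n). Qed.

Lemma open_pos : open [set x : R | 0 < x].
Proof. exact: open_gt. Qed.

Lemma Cinf_powR (a : R) : Cinf [set x : R | 0 < x] (fun x => x `^ a).
Proof.
move=> n; elim: n a => [|n IH] a.
  move=> x x0; apply: differentiable_continuous; apply/derivable1_diffP.
  by have [] := is_derive1_powR a x0.
apply: (CkS_real open_pos (g := fun x => a * x `^ (a - 1))).
exact: (Ck_mul open_pos (Ck_cst n _ a) (IH (a - 1))).
Qed.

Lemma Cinf_ln : Cinf [set x : R | 0 < x] (@ln R).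
Proof.
apply: (Cinf_antiderivative open_pos (g := fun x => x `^ (-1))).
  by move=> x x0; rewrite powR_inv1 ?ltW//; exact: is_derive1_ln.
exact: Cinf_powR.
Qed.

Lemma Cinf_expR (U : set R) : open U -> Cinf U (@expR R).
Proof.
move=> oU n; elim: n => [|n IH]; first by move=> x _; exact: continuous_expR.
by apply: (CkS_real oU (g := expR)) => // x _; exact: is_derive_expR.
Qed.

Section on_domain.
Variables (V : normedModType R) (U : set V).
Hypothesis oU : open U.

Lemma Cinf_powR_comp (f : V -> R) a : Cinf U f -> (forall x, U x -> 0 < f x) ->
  Cinf U (fun x => f x `^ a).
Proof. by move=> Hf f0; exact: (Cinf_comp_real oU open_pos f0 Hf (Cinf_powR a)). Qed.

Lemma Cinf_ln_comp (f : V -> R) : Cinf U f -> (forall x, U x -> 0 < f x) ->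
  Cinf U (fun x => ln (f x)).
Proof. by move=> Hf f0; exact: (Cinf_comp_real oU open_pos f0 Hf Cinf_ln). Qed.

Lemma Cinf_expR_comp (f : V -> R) : Cinf U f -> Cinf U (fun x => expR (f x)).
Proof.
move=> Hf; apply: (Cinf_comp_real oU openT _ Hf (Cinf_expR openT)).
by [].
Qed.

Lemma Cinf_sqrt_comp (f : V -> R) : Cinf U f -> (forall x, U x -> 0 < f x) ->
  Cinf U (fun x => Num.sqrt (f x)).
Proof.
move=> Hf f0; apply: eq_Cinf (Cinf_powR_comp 2^-1 Hf f0) => // x /f0 /ltW fx.
by rewrite powR12_sqrt.
Qed.

Lemma Cinf_exp_comp (f : V -> R) n : Cinf U f -> Cinf U (fun x => f x ^+ n).
Proof.
move=> Hf; elim: n => [|n IH]; first exact: Cinf_cst.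
apply: eq_Cinf (Cinf_mul oU Hf IH) => // x _; by rewrite exprS.
Qed.

Lemma Cinf_inv_comp (f : V -> R) : Cinf U f -> (forall x, U x -> f x != 0) ->
  Cinf U (fun x => (f x)^-1).
Proof.
move=> Hf f0.
(* 1 / f is written as f (f^2)^-1, since smoothness of powers is available on the positive reals and
   f may be negative. *)
have H : Cinf U (fun x => (f x ^+ 2) `^ (-1)).
  apply: Cinf_powR_comp; first exact: Cinf_exp_comp.
  by move=> x /f0 ?; rewrite lt_def sqrf_eq0 sqr_ge0 andbT.
apply: eq_Cinf (Cinf_mul oU Hf H) => // x /f0 fx.
by rewrite powR_inv1 ?sqr_ge0// expr2 invfM mulVKf.
Qed.

End on_domain.

Lemma local_antiderivative (F : R -> R) (A : set R) (y0 : R) : open A -> A y0 ->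
  (forall y, A y -> {for y, continuous F}) ->
  exists2 d : R, 0 < d & exists G : R -> R,
    ball y0 d `<=` A /\ (forall y, ball y0 d y -> is_derive y (1 : R) G (F y)).
Proof.
move=> oA Ay0 cF.
have [e e0 He] := (nbhs_ballP _ _).1 (open_nbhs_nbhs (conj oA Ay0)).
(* Halving e keeps the closed segment [y0 - d, y0 + d] inside A, so that F is integrable on it; the
   primitive is the integral from its left end. *)
pose d := e / 2; have d0 : 0 < d by rewrite divr_gt0.
have inA y : y \in `[y0 - d, y0 + d] -> A y.
  rewrite in_itv /= => /andP[y1 y2]; apply: He; rewrite -ball_normE /=.
  rewrite (@le_lt_trans _ _ d)//; last by rewrite ltr_pdivrMr// ltr_pMr// ltr1n.
  by rewrite distrC ler_norml; apply/andP; split; lra.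
exists d => //; exists (fun x => \int[lebesgue_measure]_(t in [set` `[y0 - d, x]]) F t)%R.
split.
  move=> y; rewrite -ball_normE /= => yd; apply: inA; rewrite in_itv /=.
  by move: yd; rewrite distrC ltr_norml => /andP[? ?]; apply/andP; split; lra.
move=> y; rewrite -ball_normE /= distrC ltr_norml => /andP[y1 y2].
have yl : y < y0 + d by lra.
have yg : y0 - d < y by lra.
have cy : {for y, continuous F}.
  by apply: cF; apply: inA; rewrite in_itv /= !ltW.
have I : (@lebesgue_measure R).-integrable `[y0 - d, y0 + d] (EFin \o F).
  apply: continuous_compact_integrable; first exact: segment_compact.
  apply: continuous_in_subspaceT => x xI; apply: cF; apply: inA.
  by move: xI; rewrite inE.
have [D E] := continuous_FTC1_closed yl I yg cy.
by split; [exact: D|rewrite -derive1E; exact: E].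
Qed.

End RealFunctions.

(** * A local inverse function theorem *)

Section Schwarz.
Context {R : realType}.

Lemma Cinf_derive_comm (V : normedModType R) (m : nat) (U : set V) (F : V -> 'rV[R]_m)
    (x v w : V) : open U -> Cinf U F -> U x -> 'D_v ('D_w F) x = 'D_w ('D_v F) x.
Proof.
move=> oU HF Ux; apply/rowP => j.
have HG := Cinf_coord j oU HF.
have E a b : ('D_a ('D_b F) x) 0 j = 'D_a ('D_b (fun y => F y 0 j)) x.
  rewrite derive_rV; last exact: (Cinf_derivable a (Cinf_derive b HF) Ux).
  apply: (eq_derive_on _ oU) => // y Uy.
  by rewrite derive_rV//; exact: (Cinf_derivable b HF Uy).
apply: (etrans (E v w)); apply: (etrans _ (esym (E w v))); apply: schwarz_symmetry.
- near=> y; have Uy : U y by near: y; exact: open_nbhs_nbhs.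
  split; [exact: (Cinf_derivable v HG)|exact: (Cinf_derivable w HG)|
   exact: (Cinf_derivable w (Cinf_derive v HG))|exact: (Cinf_derivable v (Cinf_derive w HG))].
- exact: (Cinf_continuous (Cinf_derive v (Cinf_derive w HG)) Ux).
- exact: (Cinf_continuous (Cinf_derive w (Cinf_derive v HG)) Ux).
Unshelve. all: by end_near. Qed.

End Schwarz.

Section InverseFunction.
Context {R : realType} {n : nat}.
Local Notation E := 'rV[R]_n.

(** By compactness |T z - z| attains its minimum on the closed ball; replacing a minimizer z by T z
    at least halves the value, so the minimum is 0. *)
Lemma contraction_fixed_point (r : R) (T : E -> E) : 0 <= r ->
  (forall z, `|z| <= r -> {for z, continuous T}) ->
  (forall z, `|z| <= r -> `|T z| <= r) ->
  (forall z z', `|z| <= r -> `|z'| <= r -> `|T z - T z'| <= 2^-1 * `|z - z'|) ->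
  exists2 z, `|z| <= r & T z = z.
Proof.
move=> r0 cT Tr TL; pose K : set E := [set z | `|z| <= r].
have K0 : K !=set0 by exists 0; rewrite /K /= normr0.
have cK : compact K.
  apply: bounded_closed_compact.
    by exists r; split; [exact: num_real|move=> M rM z /= /le_trans; apply; exact: ltW].
  by apply: (@closed_comp _ _ (fun z : E => `|z|) [set x | x <= r]) => [z _|];
    [exact: norm_continuous|exact: closed_le].
have cT' : {within K, continuous (fun z => `|T z - z|)}.
  apply: continuous_in_subspaceT => z; rewrite inE => Kz.
  apply: (@continuous_comp _ _ _ (fun z => T z - z) (fun z : E => `|z|)).
    exact: (cvgB (cT z Kz) (@cvg_id _ _)).
  exact: norm_continuous.
have [z Kz zmin] := EVT_min_rV K0 cK cT'.
move: Kz; rewrite inE => Kz.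
exists z => //; apply/eqP; rewrite -subr_eq0 -normr_eq0; apply/eqP.
have TK : T z \in K by rewrite inE; exact: Tr.
move: (zmin _ TK) (TL _ _ (Tr _ Kz) Kz) (normr_ge0 (T z - z)).
by move: `|T z - z| `|T (T z) - T z| => a b ? ? ?; lra.
Qed.

(** In the sup norm the mean value theorem along the segment bounds each coordinate of the increment
    by n terms, each at most |z - z'| / (2 n). *)
Lemma near_identity_bound (h : E -> E) (r : R) :
  (forall z, `|z| < r -> forall j, differentiable (fun y => h y 0 j) z) ->
  (forall z i j, `|z| < r -> `|'D_(delta_mx 0 i) (fun y => h y 0 j) z| <= (2 * n%:R)^-1) ->
  forall z z', `|z| < r -> `|z'| < r -> `|h z - h z'| <= 2^-1 * `|z - z'|.
Proof.
move=> dh bh z z' zr z'r.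
apply: rV_norm_le => [|j]; first by rewrite mulr_ge0.
rewrite !mxE.
have inb s : s \in `[(0:R), 1] -> `|z' + s *: (z - z')| < r.
  rewrite in_itv /= => /andP[s0 s1].
  have -> : z' + s *: (z - z') = (1 - s) *: z' + s *: z.
    by rewrite scalerBr scalerBl scale1r addrCA -addrA addrC addrA addrAC.
  rewrite (le_lt_trans (ler_normD _ _))// !normrZ (ger0_norm s0) ger0_norm ?subr_ge0//.
  have [s00|sn] := eqVneq s 0; first by rewrite s00 mul0r addr0 subr0 mul1r.
  have : s * `|z| < s * r by rewrite ltr_pM2l// lt_def sn.
  have : (1 - s) * `|z'| <= (1 - s) * r by rewrite ler_wpM2l ?subr_ge0// ltW.
  by move: (s * `|z|) (_ * `|z'|) => a b ? ?; nra.
have dl s : s \in `[(0:R), 1] -> derivable (fun y => h y 0 j) (z' + s *: (z - z')) (z - z').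
  by move=> /inb sI; apply: diff_derivable; exact: dh.
have [s /subset_itv_oo_cc/inb sI] := MVT_line dl.
rewrite subrKC => ->; rewrite derive_sum_coord; last exact: dh.
apply: (le_trans (ler_norm_sum _ _ _)).
apply: (@le_trans _ _ (\sum_(i < n) `|z - z'| * (2 * n%:R)^-1)).
  apply: ler_sum => i _; rewrite normrM ler_pM//; last exact: bh.
  exact: rV_coord_le.
rewrite sumr_const card_ord -[leLHS]mulr_natr -mulrA [leLHS]mulrC ler_wpM2r//.
have [->|n0] := eqVneq (n%:R : R) 0; first by rewrite mulr0 invr_ge0.
by rewrite invfM -mulrA mulVf// mulr1.
Qed.

End InverseFunction.

Section DirectionalExpansion.
Context {R : realType} {n : nat}.
Implicit Types (U : set 'rV[R]_n).

Lemma Cinf_differentiable U (f : 'rV[R]_n -> R) x :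
  open U -> Cinf U f -> U x -> differentiable f x.
Proof. by move=> oU Hf; exact: (C1_differentiable oU (Hf 1%N)). Qed.

Lemma derive_dir U (f : 'rV[R]_n -> R) x (w : 'rV[R]_n) : open U -> Cinf U f -> U x ->
  'D_w f x = \sum_j w 0 j * 'D_(delta_mx 0 j) f x.
Proof. by move=> oU Hf Ux; exact/derive_sum_coord/(Cinf_differentiable oU Hf Ux). Qed.

Lemma derive_dir_rV m U (F : 'rV[R]_n -> 'rV[R]_m) x (w : 'rV[R]_n) :
  open U -> Cinf U F -> U x ->
  'D_w F x = \sum_j w 0 j *: 'D_(delta_mx 0 j) F x.
Proof.
move=> oU HF Ux; apply/rowP => k; rewrite summxE.
rewrite derive_rV; last exact: (Cinf_derivable w HF Ux).
rewrite (derive_dir w oU (Cinf_coord k oU HF) Ux); apply: eq_bigr => j _.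
by rewrite mxE derive_rV//; exact: (Cinf_derivable _ HF Ux).
Qed.

Lemma is_derive_affine (V W : normedModType R) (F : V -> W) x v d :
  (forall h : R, F (h *: v + x) = F x + h *: d) -> is_derive x v F d.
Proof.
move=> H.
have c : h^-1 *: ((F \o shift x) (h *: v) - F x) @[h --> (0:R)^'] --> d.
  apply: cvg_near_cst; near=> h; rewrite /= H addrAC subrr add0r scalerA mulVf ?scale1r//.
  by near: h; exact: nbhs_dnbhs_neq.
by split; [apply/cvg_ex; exists d|exact: cvg_lim c].
Unshelve. all: by end_near. Qed.

Lemma mulmx_rV_bound (A : 'M[R]_n) : exists2 K, 0 < K & forall w : 'rV_n, `|w *m A| <= K * `|w|.
Proof.
exists (\sum_i \sum_j `|A i j| + 1).
  by rewrite ltr_wpDl//; do 2!apply: sumr_ge0 => ? _.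
move=> w; have S0 : 0 <= \sum_i \sum_j `|A i j| by do 2!apply: sumr_ge0 => ? _.
apply: rV_norm_le => [|j]; first by rewrite mulr_ge0// addr_ge0.
rewrite mxE (le_trans (ler_norm_sum _ _ _))//.
rewrite mulrDl mul1r ler_wpDr// mulr_suml; apply: ler_sum => i _.
rewrite normrM mulrC ler_pM//; last exact: rV_coord_le.
by rewrite (bigD1 j)//= ler_wpDr//; apply: sumr_ge0.
Qed.

End DirectionalExpansion.

Section LocalInverse.
Context {R : realType} {n : nat}.
Local Notation E := 'rV[R]_n.
Variables (U : set E) (Psi : E -> E) (F : 'I_n -> E -> E).
Hypotheses (oU : open U) (HPsi : Cinf U Psi) (HF : forall j, Cinf U (F j)).
(** The fields [F j] are dual to the coordinates of Psi. Being given in advance, they make the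
    inverse of the Jacobian matrix explicit and smooth. *)
Hypothesis DPsi : forall j q, U q -> 'D_(F j q) Psi q = delta_mx 0 j.

Let A q : 'M[R]_n := \matrix_j F j q.
Let J q : 'M[R]_n := \matrix_j 'D_(delta_mx 0 j) Psi q.

Let mulA w q : w *m A q = \sum_j w 0 j *: F j q.
Proof. by rewrite mulmx_sum_row; apply: eq_bigr => j _; rewrite rowK. Qed.

Let mulJ w q : U q -> w *m J q = 'D_w Psi q.
Proof.
move=> Uq; rewrite mulmx_sum_row (derive_dir_rV w oU HPsi Uq).
by apply: eq_bigr => j _; rewrite rowK.
Qed.

Let JA q : U q -> J q *m A q = 1%:M.
Proof.
move=> Uq; apply: mulmx1C; apply/row_matrixP => j.
by rewrite row_mul rowK mulJ// DPsi// rowE mulmx1.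
Qed.

(** A Lipschitz right inverse is enough: the first-order expansion of Psi at [Th y], multiplied by
    the inverse Jacobian, yields the derivative of Th. This derivative is a combination of the [F j]
    composed with Th, hence as regular as Th, and the order of smoothness grows by induction. *)
Lemma inverse_smooth (B : set E) (Th : E -> E) (K : R) : open B ->
  (forall y, B y -> U (Th y) /\ Psi (Th y) = y) ->
  (forall y y', B y -> B y' -> `|Th y - Th y'| <= K * `|y - y'|) ->
  (forall y v, B y -> is_derive y v Th (\sum_j v 0 j *: F j (Th y))) /\ Cinf B Th.
Proof.
move=> oB PTh ThK.
have dTh y v : B y -> is_derive y v Th (\sum_j v 0 j *: F j (Th y)).
  move=> By; have [Uq Pq] := PTh _ By; set q := Th y in Uq Pq *; rewrite -mulA.
  suff c : h^-1 *: ((Th \o shift y) (h *: v) - Th y) @[h --> (0:R)^'] --> v *m A q.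
    by split; [apply/cvg_ex; exists (v *m A q)|exact: cvg_lim c].
  apply/cvgrPdist_le => e e0.
  have [KA KA0 bA] := mulmx_rV_bound (A q).
  (* Chosen so that an error e / N in the expansion of Psi stays below e after the Lipschitz bound
     |k| <= |K| |v| |h| and multiplication by A; the summand 1 keeps N positive. *)
  pose N := KA * (`|K| * `|v| + 1); have N0 : 0 < N.
    by rewrite mulr_gt0// ltr_wpDl// mulr_ge0.
  have taylor : \forall k \near (0 : E), forall j,
     `|Psi (k + q) 0 j - (Psi q 0 j + ('D_k Psi q) 0 j)| <= e / N * `|k|.
    near=> k; move=> j; move: j; near: k; apply: filter_forall => j.
    have df := Cinf_differentiable oU (Cinf_coord j oU HPsi) Uq.
    have /eqaddoP/(_ (e / N)) := diff_locally df.
    move=> /(_ (divr_gt0 e0 N0)); apply: filterS => k.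
    rewrite -[(_ - _) k]/(Psi (k + q) 0 j - (Psi q 0 j + 'd (fun y => Psi y 0 j) q k)) -deriveE//.
    by rewrite derive_rV//; exact: (Cinf_derivable k HPsi Uq).
  have [d d0 Hd] := (nbhs_ballP _ _).1 taylor.
  have nB : \forall h \near (0:R), B (h *: v + y).
    have c : h *: v + y @[h --> (0:R)] --> y.
      rewrite -[X in _ --> X]add0r -[X in _ --> X + _](scale0r v).
      by apply: cvgD; [apply: cvgZr_tmp; exact: cvg_id|exact: cvg_cst].
    exact: (c _ (open_nbhs_nbhs (conj oB By))).
  have small : \forall h \near (0:R)^', `|K| * `|v| * `|h| < d.
    have [v0|v0] := eqVneq (`|K| * `|v|) 0.
      by near=> h; rewrite v0 mul0r; exact: d0.
    have v1 : 0 < `|K| * `|v| by rewrite lt_def v0 mulr_ge0.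
    near=> h; rewrite mulrC -ltr_pdivlMr//; near: h; apply: dnbhs0_lt.
    exact: divr_gt0 d0 v1.
  near=> h.
  have h0 : h != 0 by near: h; exact: nbhs_dnbhs_neq.
  have Bh : B (h *: v + y) by near: h; exact: cvg_within nB.
  have [Uh Ph] := PTh _ Bh; pose k := Th (h *: v + y) - q.
  have kb : `|k| <= `|K| * `|v| * `|h|.
    rewrite (le_trans (ThK _ _ Bh By))// addrK normrZ mulrCA mulrC ler_wpM2r// ler_wpM2r//.
    exact: ler_norm.
  have kd : ball (0:E) d k.
    by rewrite -ball_normE /= sub0r normrN (le_lt_trans kb)//; near: h.
  have b1 : `|h *: v - k *m J q| <= e / N * `|k|.
    apply: rV_norm_le => [|j]; first by rewrite mulr_ge0// divr_ge0 ?ltW.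
    have := Hd _ kd j; rewrite subrK Ph Pq mulJ// !mxE; congr (`|_| <= _).
    by rewrite opprD addrA addrK.
  have b2 : `|h *: (v *m A q) - k| <= e * `|h|.
    have -> : h *: (v *m A q) - k = (h *: v - k *m J q) *m A q.
      by rewrite mulmxBl -mulmxA JA// mulmx1 scalemxAl.
    rewrite (le_trans (bA _))//.
    have b3 : KA * `|h *: v - k *m J q| <= KA * (e / N * (`|K| * `|v| * `|h|)).
      rewrite ler_pM2l// (le_trans b1)// ler_wpM2l//.
      by rewrite divr_ge0 ?ltW.
    rewrite (le_trans b3)//.
    have -> : KA * (e / N * (`|K| * `|v| * `|h|)) = (KA * (`|K| * `|v|)) / N * (e * `|h|).
      by move: `|K| `|v| `|h| (N^-1) => a b c' d'; ring.
    rewrite ler_piMl ?mulr_ge0 ?(ltW e0)// ler_pdivrMr// mul1r /N ler_pM2l//.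
    by rewrite lerDl.
  have -> : v *m A q - h^-1 *: ((Th \o shift y) (h *: v) - q) =
     h^-1 *: (h *: (v *m A q) - k).
    by rewrite [RHS]scalerBr scalerA mulVf// scale1r.
  by rewrite normrZ normfV mulrC ler_pdivrMr// normr_gt0.
split=> //.
have cTh y : B y -> {for y, continuous Th}.
  move=> By; apply/(@cvgrPdist_le _ _ _ (nbhs y)) => e e0.
  have K0 : 0 < `|K| + 1 by rewrite ltr_wpDl.
  near=> z.
  have Bz : B z by near: z; exact: open_nbhs_nbhs.
  rewrite (le_trans (ThK _ _ By Bz))// (@le_trans _ _ ((`|K| + 1) * `|y - z|))//.
    by rewrite ler_wpM2r// ler_wpDr// ler_norm.
  rewrite mulrC -ler_pdivlMr//; near: z; apply: cvgr_dist_le; first exact: cvg_id.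
  exact: divr_gt0.
elim=> [|k IH]; first exact: cTh.
split=> //; first by move=> y v /(dTh _ v)[].
move=> v.
have Hs j : Ck k B (fun y => v 0 j *: F j (Th y)).
  apply/Ck_rV => // i.
  have Hc : Ck k B ((fun q => F j q 0 i) \o Th).
    apply: (Ck_comp oB oU _ IH); first by move=> y /PTh[].
    exact: (Cinf_coord i oU (HF j)).
  apply: eq_Ck (Ck_mul oB (Ck_cst k B (v 0 j)) Hc) => // y _.
  by rewrite mxE.
by apply: eq_Ck (Ck_sum oB Hs) => // y By; have [_ ->] := dTh y v By.
Unshelve. all: by end_near. Qed.

Let mulL v (q0 : E) : v *m A q0 = \sum_j v 0 j *: F j q0.
Proof. exact: mulA. Qed.

Lemma Cinf_affine (q0 : E) (B : 'M[R]_n) : Cinf setT (fun z : E => q0 + z *m B).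
Proof.
apply: Cinf_rV openT _ => k.
have H i : Cinf setT (fun z : E => z 0 i * B i k).
  apply: Cinf_mul openT _ (Cinf_cst _ _).
  by apply: (@Cinf_coord _ _ _ _ id) openT _ => m; exact: Ck_id.
apply: eq_Cinf openT _ (Cinf_add openT (Cinf_cst _ (q0 0 k)) (Cinf_sum openT H)) => z _.
by rewrite !mxE.
Qed.

(** After the affine change L by the inverse Jacobian, z |-> Psi (L z) has identity derivative at 0,
    so h has zero derivative there and is 1/2-Lipschitz near 0. Solving Psi (L z) = y means finding
    a fixed point of z |-> h z + (y - Psi q0). *)
Lemma local_inverse (q0 : E) : U q0 ->
  exists (r : R) (Th : E -> E) (W : set E),
  [/\ 0 < r, open W, W q0 & W `<=` U] /\
  [/\ forall q, W q -> ball (Psi q0) r (Psi q) /\ Th (Psi q) = q,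
      forall y, ball (Psi q0) r y -> W (Th y) /\ Psi (Th y) = y,
      forall y v, ball (Psi q0) r y -> is_derive y v Th (\sum_j v 0 j *: F j (Th y)) &
      Cinf (ball (Psi q0) r) Th].
Proof.
move=> Uq0; pose L z : E := q0 + z *m A q0.
have HL : Cinf setT L by exact: Cinf_affine.
have L0 : L 0 = q0 by rewrite /L mul0mx addr0.
have cL : continuous L by move=> z; exact: (Cinf_continuous HL).
pose U0 := L @^-1` U.
have oU0 : open U0 by apply: open_comp => // z _; exact: cL.
have U00 : U0 0 by rewrite /U0 /= L0.
pose h z : E := z - (Psi (L z) - Psi q0).
have HPL : Cinf U0 (fun z => Psi (L z)).
  apply: (@Cinf_comp_rV _ _ _ _ U0 U Psi L) => //.
  exact: Cinf_sub HL.
have Hh : Cinf U0 h.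
  apply: (Cinf_sub_fun oU0); first by move=> k; exact: Ck_id.
  exact: (Cinf_sub_fun oU0 HPL (Cinf_cst _ _)).
have h00 : h 0 = 0 by rewrite /h L0 subrr subr0.
have Dh0 i : 'D_(delta_mx 0 i) h 0 = 0.
  have dL : is_derive (0 : E) (delta_mx 0 i : E) L (F i q0).
    apply: is_derive_affine => s.
    rewrite /L addr0 mul0mx addr0 -scalemxAl mulL; congr (_ + _ *: _).
    rewrite (bigD1 i)//= mxE !eqxx scale1r big1 ?addr0// => j ji.
    by rewrite mxE (negbTE ji) scale0r.
  have dPL : is_derive (0 : E) (delta_mx 0 i : E) (fun z => Psi (L z)) (delta_mx 0 i).
    apply: DeriveDef; first exact: (Cinf_derivable _ HPL U00).
    apply/rowP => k; rewrite derive_rV; last exact: (Cinf_derivable _ HPL U00).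
    have HPk := Cinf_coord k oU HPsi.
    have dk : differentiable (fun q => Psi q 0 k) (L 0).
      by rewrite L0; exact: (Cinf_differentiable oU HPk Uq0).
    have [_ ->] := derive_comp_coord (@ex_derive _ _ _ _ _ _ _ dL) dk.
    rewrite (derive_val (is_derive := dL)) L0 -(derive_dir _ oU HPk Uq0).
    by rewrite -derive_rV ?DPsi//; exact: (Cinf_derivable _ HPsi Uq0).
  have [_ ->] : is_derive (0 : E) (delta_mx 0 i : E) h (delta_mx 0 i - (delta_mx 0 i - 0)).
    exact: is_deriveB.
  by rewrite subr0 subrr.
have small : \forall z \near (0:E), U0 z /\ forall i j,
    `|'D_(delta_mx 0 i) (fun y => h y 0 j) z| <= (2 * n%:R)^-1.
  apply: filterI; first exact: open_nbhs_nbhs.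
  near=> z; move=> i; move: i; near: z; apply: filter_forall => i.
  near=> z; move=> j; move: j; near: z; apply: filter_forall => j.
  have n0 : 0 < (2 * n%:R)^-1 :> R.
    by rewrite invr_gt0 mulr_gt0// ltr0n (leq_ltn_trans _ (ltn_ord i)).
  have H := Cinf_derive (delta_mx 0 i) (Cinf_coord j oU0 Hh).
  have /(@cvgrPdist_le _ _ _ (nbhs (0:E))) /(_ _ n0) := Cinf_continuous H U00.
  apply: filterS => z.
  rewrite -[X in `|X - _|](derive_rV j (Cinf_derivable _ Hh U00)) Dh0 mxE sub0r.
  by rewrite normrN.
have [rho rho0 Hrho] := (nbhs_ballP _ _).1 small.
have inr (z : E) : `|z| < rho -> U0 z /\ forall i j,
    `|'D_(delta_mx 0 i) (fun y => h y 0 j) z| <= (2 * n%:R)^-1.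
  by move=> zr; apply: Hrho; rewrite -ball_normE /= sub0r normrN.
have hL z z' : `|z| < rho -> `|z'| < rho -> `|h z - h z'| <= 2^-1 * `|z - z'|.
  apply: near_identity_bound => {z z'} [z zr j|z i j zr].
    by apply: (Cinf_differentiable oU0 (Cinf_coord j oU0 Hh)); exact: (inr _ zr).1.
  exact: (inr _ zr).2.
(* z - z' is the sum of the increments of Psi (L z) and of h, and the latter accounts for at most
   half of its norm. This gives injectivity and the Lipschitz bound of the inverse at once. *)
have inj z z' : `|z| < rho -> `|z'| < rho -> `|z - z'| <= 2 * `|Psi (L z) - Psi (L z')|.
  move=> zr zr'; have H1 := hL _ _ zr zr'.
  have H2 : `|z - z'| <= `|Psi (L z) - Psi (L z')| + `|h z - h z'|.
    rewrite -[z - z'](_ : (Psi (L z) - Psi (L z')) + (h z - h z') = _) ?ler_normD//.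
    rewrite /h; apply/rowP => k; rewrite !mxE.
    by move: (z 0 k) (z' 0 k) (Psi _ _ _) (Psi _ _ _) (Psi _ _ _) => a b c d e; ring.
  move: H1 H2; move: `|z - z'| `|h z - h z'| `|Psi _ - _| => a b c ? ?; lra.
(* For |z| <= rho / 2 one has |h z| <= rho / 4, so adding y - Psi q0 of norm below rho / 4 leaves
   the ball of radius rho / 2 invariant. *)
pose r := rho / 4; have r0 : 0 < r by exact: divr_gt0.
have rho0' : 0 < rho by [].
have ex y : ball (Psi q0) r y -> exists2 z, `|z| < rho & Psi (L z) = y.
  rewrite -ball_normE /= distrC => yr.
  pose T z := h z + (y - Psi q0).
  have lt2 (z : E) : `|z| <= rho / 2 -> `|z| < rho.
    by move=> zr; rewrite (le_lt_trans zr)// ltr_pdivrMr// ltr_pMr// ltr1n.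
  have [|z zr|z zr|z z' zr zr'|z zr Tz] := @contraction_fixed_point _ _ (rho / 2) T.
  - by rewrite divr_ge0 ?ltW.
  - have c := Cinf_continuous Hh (inr _ (lt2 _ zr)).1.
    exact: (cvgD c (@cvg_cst _ _ _ _ _)).
  - have n0 : `|0 : E| < rho by rewrite normr0.
    have := hL _ _ (lt2 _ zr) n0; rewrite h00 !subr0 => H1.
    rewrite /T (le_trans (ler_normD _ _))//.
    move: H1 zr yr; rewrite /r; move: `|h z| `|z| `|y - _| => a b c ? ? ?; lra.
  - by rewrite /T opprD addrACA subrr addr0; exact: hL (lt2 _ zr) (lt2 _ zr').
  - exists z; first exact: lt2.
    apply/rowP => k; move/rowP: Tz => /(_ k); rewrite /T /h !mxE.
    by move: (z 0 k) (Psi _ _ _) (Psi _ _ _) (y 0 k) => a b c d ?; lra.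
have [z_ Hz] : {z_ : E -> E | forall y, ball (Psi q0) r y -> `|z_ y| < rho /\ Psi (L (z_ y)) = y}.
  pose P y z := ball (Psi q0) r y -> `|z| < rho /\ Psi (L z) = y.
  have exP y : exists z, P y z.
    have [yr|nyr] := pselect (ball (Psi q0) r y); last by exists 0 => /nyr.
    by have [z ? ?] := ex y yr; exists z.
  by exists (fun y => projT1 (cid (exP y))) => y; exact: (projT2 (cid (exP y))).
(* q |-> (q - q0) J(q0) is the inverse of L, so W is the part of the image of the rho-ball that Psi
   sends into the target ball. *)
pose W := [set q : E | `|(q - q0) *m J q0| < rho /\ ball (Psi q0) r (Psi q)].
have LJ q : L ((q - q0) *m J q0) = q by rewrite /L -mulmxA JA// mulmx1 subrKC.
have JL z : (L z - q0) *m J q0 = z.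
  by rewrite /L addrAC subrr add0r -mulmxA mulmx1C ?JA// mulmx1.
have WU q : W q -> U q by move=> [/inr[+ _] _]; rewrite /U0 /= LJ.
have WTh q : W q -> L (z_ (Psi q)) = q.
  move=> [q1 q2]; have [z1 z2] := Hz _ q2.
  have := inj _ _ z1 q1; rewrite z2 LJ subrr normr0 mulr0 normr_le0 subr_eq0.
  by move=> /eqP ->; rewrite LJ.
have oW : open W.
  rewrite openE => q Wq; have Uq := WU _ Wq; case: Wq => q1 q2.
  apply: filterI.
    pose g (q : E) : E := (q - q0) *m J q0.
    have Eg : g = (fun q : E => - (q0 *m J q0) + q *m J q0).
      by apply/funext => w; rewrite /g mulmxBl addrC.
    have cg : {for q, continuous g}.
      by rewrite Eg; exact: (Cinf_continuous (Cinf_affine (- (q0 *m J q0)) (J q0)) I).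
    have c : {for q, continuous (Num.norm \o g)}.
      by apply: continuous_comp; [exact: cg|exact: norm_continuous].
    have nr : nbhs `|g q| [set x | x < rho].
      by apply: open_nbhs_nbhs; split; [exact: open_lt|exact: q1].
    exact: (c _ nr).
  have c := Cinf_continuous HPsi Uq.
  have nr : nbhs (Psi q) (ball (Psi q0) r).
    by apply: open_nbhs_nbhs; split; [exact: ball_open|exact: q2].
  exact: (c _ nr).
have [KA KA0 bA] := mulmx_rV_bound (A q0).
have PTh y : ball (Psi q0) r y -> W (L (z_ y)) /\ Psi (L (z_ y)) = y.
  by move=> yr; have [z1 z2] := Hz _ yr; split=> //; split; rewrite ?JL ?z2.
have oB : open (ball (Psi q0) r) by exact: ball_open.
have [] := @inverse_smooth (ball (Psi q0) r) (L \o z_) (KA * 2) oB.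
- by move=> y /PTh[/WU].
- move=> y y' yr yr'; have [z1 z2] := Hz _ yr; have [z1' z2'] := Hz _ yr'.
  have := inj _ _ z1 z1'; rewrite z2 z2' => H.
  rewrite /= /L opprD addrACA subrr add0r -mulmxBl (le_trans (bA _))// -mulrA.
  by rewrite ler_pM2l.
- move=> dTh HTh; exists r, (L \o z_), W; split; first split=> //.
    by split; [rewrite subrr mul0mx normr0|exact: ballxx].
  by split=> // q Wq; split; [exact: Wq.2|exact: WTh].
Unshelve. all: by end_near. Qed.

End LocalInverse.

(** * The Minkowski form *)

Section Minkowski.
Context {R : realType}.
Local Notation E5 := 'rV[R]_5.
Implicit Types x y z w : E5.

Lemma minkC x y : mink x y = mink y x.
Proof. by rewrite /mink [y 0 _ * _]mulrC; congr (_ - _); apply: eq_bigr => i _; rewrite mulrC. Qed.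

Lemma minkDl x y z : mink (x + y) z = mink x z + mink y z.
Proof.
rewrite /mink; under eq_bigr do rewrite mxE mulrDl.
by rewrite big_split mxE mulrDl /= opprD addrACA.
Qed.

Lemma minkZl k x y : mink (k *: x) y = k * mink x y.
Proof.
rewrite /mink mulrBr mulr_sumr; under eq_bigr do rewrite mxE -mulrA.
by rewrite mxE mulrA.
Qed.

Lemma minkDr x y z : mink x (y + z) = mink x y + mink x z.
Proof. by rewrite minkC minkDl !(minkC _ x). Qed.

Lemma minkZr k x y : mink x (k *: y) = k * mink x y.
Proof. by rewrite minkC minkZl (minkC _ x). Qed.

Lemma minkNl x y : mink (- x) y = - mink x y.
Proof. by rewrite -scaleN1r minkZl mulN1r. Qed.

Lemma minkNr x y : mink x (- y) = - mink x y.
Proof. by rewrite minkC minkNl minkC. Qed.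

Lemma minkBl x y z : mink (x - y) z = mink x z - mink y z.
Proof. by rewrite minkDl minkNl. Qed.

Lemma minkBr x y z : mink x (y - z) = mink x y - mink x z.
Proof. by rewrite minkDr minkNr. Qed.

Lemma mink0l y : mink 0 y = 0.
Proof. by rewrite -(scale0r (0:E5)) minkZl mul0r. Qed.

Lemma mink0r y : mink y 0 = 0.
Proof. by rewrite minkC mink0l. Qed.

Lemma mink_suml (I : finType) (F : I -> E5) y :
  mink (\sum_i F i) y = \sum_i mink (F i) y.
Proof.
rewrite unlock /=; elim: (index_enum I) => [|i s IH] /=; first exact: mink0l.
by rewrite minkDl IH.
Qed.

Lemma mink_sumr (I : finType) (F : I -> E5) y :
  mink y (\sum_i F i) = \sum_i mink y (F i).
Proof. by rewrite minkC mink_suml; apply: eq_bigr => i _; rewrite minkC. Qed.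

Definition minkE := (minkDl, minkDr, minkBl, minkBr, minkNl, minkNr, minkZl, minkZr,
  mink0l, mink0r).

(* If <x, x> < 0 and <w, x> = 0, completing squares gives
   x_5^2 <w, w> = sum_i (x_5 w_i - w_5 x_i)^2 - <x, x> w_5^2. *)
Lemma mink_orthogonal_timelike x w : mink x x = -1 -> mink w x = 0 -> w != 0 ->
  0 < mink w w.
Proof.
move=> xx wx w0; pose a := x 0 ord_max; pose b := w 0 ord_max.
pose S2 := \sum_(i < 5 | i != ord_max) (a * w 0 i - b * x 0 i) ^+ 2.
have E : a ^+ 2 * mink w w = S2 + b ^+ 2.
  have S2E : S2 = a ^+ 2 * (mink w w + b * b) - a * b *+ 2 * (mink w x + b * a)
     + b ^+ 2 * (mink x x + a * a).
    rewrite /mink !subrK !mulr_sumr -sumrB -big_split /=; apply: eq_bigr => i _.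
    by move: (w 0 i) (x 0 i) => c d; ring.
  by rewrite S2E wx xx; move: (mink w w) => c; ring.
have S20 : 0 <= S2 by apply: sumr_ge0 => i _; exact: sqr_ge0.
have a2 : 1 <= a ^+ 2.
  have : \sum_(i < 5 | i != ord_max) x 0 i * x 0 i >= 0.
    by apply: sumr_ge0 => i _; rewrite -expr2 sqr_ge0.
  by move: xx; rewrite /mink -/a -expr2; move: (\sum_(i < 5 | _) _) (a ^+ 2) => c d ? ?; lra.
have a20 : 0 < a ^+ 2 by rewrite (lt_le_trans ltr01).
rewrite -(pmulr_rgt0 _ a20) E lt_def addr_ge0 ?sqr_ge0// andbT.
apply: contra w0 => /eqP E0.
have b20 : b ^+ 2 = 0.
  by have := sqr_ge0 b; lra.
have b0 : b = 0 by apply/eqP; rewrite -sqrf_eq0 b20.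
move: E0; rewrite b20 addr0 => /eqP; rewrite psumr_eq0; last by move=> i _; exact: sqr_ge0.
move=> /allP H; apply/eqP/rowP => i; rewrite mxE.
have [->//|im] := eqVneq i ord_max.
have := H i (mem_index_enum i); rewrite im /= b0 mul0r subr0 sqrf_eq0 mulf_eq0.
by case/orP => /eqP// a0; move: a20; rewrite a0 expr0n ltxx.
Qed.

Definition eta : 'M[R]_5 := diag_mx (\row_i (if i == ord_max then -1 else 1)).

Lemma mink_eta x y : mink x y = (x *m eta *m y^T) 0 0.
Proof.
rewrite /mink [RHS]mxE [RHS](bigD1 ord_max)//= [RHS]addrC; congr (_ + _); last first.
  by rewrite mul_mx_diag !mxE eqxx mulrN1 mulNr.
by apply: eq_bigr => i im; rewrite mul_mx_diag !mxE (negbTE im) mulr1.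
Qed.

Section frame.
Variables e1 e2 e3 e4 x : E5.

Definition frame_mx : 'M[R]_5 := \matrix_(i < 5) [:: e1; e2; e3; e4; x]`_i.

Definition orthoframe : Prop :=
  [/\ [/\ mink e1 e1 = 1, mink e2 e2 = 1, mink e3 e3 = 1, mink e4 e4 = 1 & mink x x = -1],
      [/\ mink e1 e2 = 0, mink e1 e3 = 0, mink e1 e4 = 0 & mink e1 x = 0],
      [/\ mink e2 e3 = 0, mink e2 e4 = 0 & mink e2 x = 0] &
      [/\ mink e3 e4 = 0, mink e3 x = 0 & mink e4 x = 0]].

(** The Gram matrix of the frame is [eta], i.e. the frame is a Lorentz matrix. Its determinant is
    therefore non-zero, and a vector is determined by its products with the frame. *)
Lemma frame_mx_gram : orthoframe -> frame_mx *m eta *m frame_mx^T = eta.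
Proof.
move=> [[h11 h22 h33 h44 h00] [h12 h13 h14 h10] [h23 h24 h20] [h34 h30 h40]].
apply/matrixP => i j.
have -> : (frame_mx *m eta *m frame_mx^T) i j = mink (row i frame_mx) (row j frame_mx).
  by rewrite mink_eta tr_row -!row_mul mxE [RHS]mxE !mxE; apply: eq_bigr => k _; rewrite !mxE.
rewrite !rowK.
by case: i => -[|[|[|[|[|//]]]]] ?; case: j => -[|[|[|[|[|//]]]]] ?;
  rewrite !mxE /= ?h11 ?h22 ?h33 ?h44 ?h00 ?h12 ?h13 ?h14 ?h10 ?h23 ?h24 ?h20 ?h34 ?h30 ?h40
    1?minkC ?h12 ?h13 ?h14 ?h10 ?h23 ?h24 ?h20 ?h34 ?h30 ?h40.
Qed.

Lemma det_eta : \det eta = -1.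
Proof. by rewrite det_diag !big_ord_recl big_ord0 !mxE /= !mul1r mulr1. Qed.

Lemma frame_mx_det : orthoframe -> \det frame_mx != 0.
Proof.
move=> /frame_mx_gram /(congr1 determinant); rewrite !det_mulmx det_eta.
by move=> E; apply/eqP => d0; move: E; rewrite d0 !mul0r => /eqP; rewrite eq_sym oppr_eq0 oner_eq0.
Qed.

Lemma orthoframe_eq0 w : orthoframe ->
  mink w e1 = 0 -> mink w e2 = 0 -> mink w e3 = 0 -> mink w e4 = 0 -> mink w x = 0 -> w = 0.
Proof.
move=> H h1 h2 h3 h4 h0.
have uF : frame_mx^T \in unitmx by rewrite unitmx_tr unitmxE unitfE frame_mx_det.
have ue : eta \in unitmx by rewrite unitmxE det_eta unitfE oppr_eq0 oner_eq0.
have E : w *m eta *m frame_mx^T = 0.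
  apply/rowP => j.
  have -> : (w *m eta *m frame_mx^T) 0 j = mink w (row j frame_mx).
    by rewrite mink_eta tr_row !mxE; apply: eq_bigr => k _; rewrite !mxE.
  by rewrite rowK mxE; case: j => -[|[|[|[|[|//]]]]] ?.
have E2 : w *m eta = 0 by rewrite -[LHS](mulmxK uF) E mul0mx.
by rewrite -[LHS](mulmxK ue) E2 mul0mx.
Qed.

Lemma orthoframe_expand w : orthoframe ->
  w = mink w e1 *: e1 + mink w e2 *: e2 + mink w e3 *: e3 + mink w e4 *: e4 - mink w x *: x.
Proof.
move=> H; apply/eqP; rewrite -subr_eq0; apply/eqP.
have [[h11 h22 h33 h44 h00] [h12 h13 h14 h10] [h23 h24 h20] [h34 h30 h40]] := H.
apply: orthoframe_eq0 => //; rewrite !minkE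
  ?h11 ?h22 ?h33 ?h44 ?h00 ?h12 ?h13 ?h14 ?h10 ?h23 ?h24 ?h20 ?h34 ?h30 ?h40
  ?(minkC x) ?(minkC e4 e3) ?(minkC e4 e2) ?(minkC e4 e1) ?(minkC e3 e2) ?(minkC e3 e1) ?(minkC e2 e1)
  ?h12 ?h13 ?h14 ?h10 ?h23 ?h24 ?h20 ?h34 ?h30 ?h40;
  move: (mink w e1) (mink w e2) (mink w e3) (mink w e4) (mink w x) => a b c d e; ring.
Qed.

End frame.

(* The orientation condition fixes the sign of the normal. *)
Lemma exists_fourth_vector e1 e2 e3 x :
  mink e1 e1 = 1 -> mink e2 e2 = 1 -> mink e3 e3 = 1 -> mink x x = -1 ->
  mink e1 e2 = 0 -> mink e1 e3 = 0 -> mink e1 x = 0 -> mink e2 e3 = 0 ->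
  mink e2 x = 0 -> mink e3 x = 0 ->
  exists2 w, orthoframe e1 e2 e3 w x & 0 < \det (frame_mx e1 e2 e3 w x).
Proof.
move=> h11 h22 h33 h00 h12 h13 h10 h23 h20 h30.
(* The columns express orthogonality to four vectors of R^5, so the left kernel is not zero. *)
pose B : 'M[R]_(5, 4) := \matrix_(i, j) (eta *m ([:: e1; e2; e3; x]`_j)^T) i 0.
have [w w0 wB] : exists2 w : E5, w != 0 & w *m B = 0.
  have : kermx B != 0.
    rewrite -mxrank_eq0 mxrank_ker -lt0n subn_gt0.
    exact: leq_ltn_trans (rank_leq_col B) _.
  move=> /rowV0Pn[w wk w0]; exists w => //; exact/sub_kermxP.
have wm (j : 'I_4) : mink w [:: e1; e2; e3; x]`_j = 0.
  move/rowP: wB => /(_ j); rewrite [in RHS]mxE => <-; rewrite mink_eta -mulmxA !mxE.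
  by apply: eq_bigr => i _; rewrite /B !mxE.
have w1 : mink w e1 = 0 := wm (@Ordinal 4 0 isT).
have w2 : mink w e2 = 0 := wm (@Ordinal 4 1 isT).
have w3 : mink w e3 = 0 := wm (@Ordinal 4 2 isT).
have wx : mink w x = 0 := wm (@Ordinal 4 3 isT).
have ww := mink_orthogonal_timelike h00 wx w0.
pose n := (Num.sqrt (mink w w))^-1.
have nn : n * (n * mink w w) = 1.
  by rewrite mulrA -expr2 exprVn sqr_sqrtr ?ltW// mulVf// gt_eqF.
have FW (k : R) : k * (k * mink w w) = 1 -> orthoframe e1 e2 e3 (k *: w) x.
  move=> kk; split; split; rewrite ?minkE ?(minkC _ w) ?w1 ?w2 ?w3 ?wx ?mulr0//.
(* The determinant is linear in the fourth row, so passing from w to - w reverses the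
   orientation. *)
have D (k : R) : \det (frame_mx e1 e2 e3 (k *: w) x) = k * \det (frame_mx e1 e2 e3 w x).
  rewrite (@determinant_multilinear _ _ _ (frame_mx e1 e2 e3 w x) (frame_mx e1 e2 e3 w x)
     (@Ordinal 5 3 isT) k 0); first by rewrite mul0r addr0.
  - by rewrite scale0r addr0 !rowK.
  - by apply/row_matrixP => i; rewrite !row_rowsub !rowK; case: i => -[|[|[|[|//]]]] ?.
  - by apply/row_matrixP => i; rewrite !row_rowsub !rowK; case: i => -[|[|[|[|//]]]] ?.
have d0 := frame_mx_det (FW n nn).
have [dp|dn] := ltP 0 (\det (frame_mx e1 e2 e3 (n *: w) x)).
  by exists (n *: w) => //; exact: FW.
exists ((- n) *: w); first by apply: FW; rewrite mulNr mulNr mulrN opprK.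
by rewrite D mulNr -D oppr_gt0 lt_def eq_sym d0.
Qed.

Lemma Cinf_mink (V : normedModType R) (U : set V) (F G : V -> E5) : open U ->
  Cinf U F -> Cinf U G -> Cinf U (fun q => mink (F q) (G q)).
Proof.
move=> oU HF HG.
have E q : \sum_i eta i i * (F q 0 i * G q 0 i) = mink (F q) (G q).
  rewrite mink_eta mxE; apply: eq_bigr => i _.
  by rewrite mul_mx_diag !mxE eqxx mulr1n; ring.
apply: (eq_Cinf oU (fun q _ => E q)); apply: (Cinf_sum oU) => i.
apply: (Cinf_mul oU (Cinf_cst _ _)).
exact: (Cinf_mul oU (Cinf_coord i oU HF) (Cinf_coord i oU HG)).
Qed.

Lemma is_derive_mink (V : normedModType R) (F G : V -> E5) q v dF dG :
  is_derive q v F dF -> is_derive q v G dG ->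
  is_derive q v (fun q => mink (F q) (G q)) (mink dF (G q) + mink (F q) dG).
Proof.
move=> [HF <-] [HG <-].
have E : (fun q => mink (F q) (G q)) = (fun q => \sum_i (eta i i * (F q 0 i * G q 0 i))).
  apply/funext => p; rewrite mink_eta mxE; apply: eq_bigr => i _.
  by rewrite mul_mx_diag !mxE eqxx mulr1n; ring.
have E2 : mink ('D_v F q) (G q) + mink (F q) ('D_v G q) =
   \sum_i (eta i i * (F q 0 i * 'D_v (fun p => G p 0 i) q + G q 0 i * 'D_v (fun p => F p 0 i) q)).
  rewrite !mink_eta ![(_ *m _^T) _ _]mxE -big_split; apply: eq_bigr => i _ /=.
  rewrite !mul_mx_diag !mxE eqxx mulr1n !derive_rV//.
  by move: (F q 0 i) (G q 0 i) ('D_v _ _) ('D_v _ _) (if _ then _ else _) => a b c d e; ring.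
rewrite E E2.
have -> : (fun q => \sum_i (eta i i * (F q 0 i * G q 0 i))) =
   \sum_i ((eta i i) *: ((fun q => F q 0 i) * (fun q => G q 0 i))).
  by apply/funext => p; rewrite fct_sumE.
apply: is_derive_sum => i; apply: is_deriveZ; apply: is_deriveM.
  by apply: derivableP; have /derivable_rV := HF; exact.
by apply: derivableP; have /derivable_rV := HG; exact.
Qed.

End Minkowski.

(** * Differentiation along vector fields *)

Section DirectionalRules.
Context {R : realType} {V : normedModType R}.

Lemma is_derive_scale m (k : V -> R) (F : V -> 'rV[R]_m) q v dk dF :
  is_derive q v k dk -> is_derive q v F dF ->
  is_derive q v (fun p => k p *: F p) (dk *: F q + k q *: dF).
Proof.
move=> [Hk <-] [HF <-].
have H j : is_derive q v (fun p => (k p *: F p) 0 j)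
    (('D_v k q *: F q + k q *: 'D_v F q) 0 j).
  have -> : (fun p => (k p *: F p) 0 j) = (k * (fun p => F p 0 j)).
    by apply/funext => p; rewrite mxE.
  have dFj := (derivable_rV F q v).1 HF j.
  have := is_deriveM (derivableP Hk) (derivableP dFj).
  rewrite !mxE (derive_rV j HF) addrC; congr (is_derive _ _ _ (_ + _)).
  by rewrite mulrC.
have D : derivable (fun p => k p *: F p) q v.
  by apply/derivable_rV => j; have [] := H j.
by split; [exact: D|apply/rowP => j; rewrite (derive_rV j D); have [_ ->] := H j].
Qed.

End DirectionalRules.

Section Along.
Context {R : realType} {n : nat}.
Local Notation E := 'rV[R]_n.

(** The direction varies with the point, so iterating the operator also differentiates the field,
    and brackets appear in commutators. *)
Definition along (W : normedModType R) (T : E -> E) (F : E -> W) : E -> W :=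
  fun q => 'D_(T q) F q.

Lemma alongE (W : normedModType R) T (F : E -> W) q : along T F q = 'D_(T q) F q.
Proof. by []. Qed.

Variables (U : set E) (oU : open U).

Section fields.
Variable T : E -> E.

Lemma eq_along (W : normedModType R) (F G : E -> W) q :
  (forall p, U p -> F p = G p) -> U q -> along T F q = along T G q.
Proof. by move=> FG Uq; apply: (eq_derive_on _ oU). Qed.

Lemma along_cst (W : normedModType R) (a : W) q : along T (fun=> a) q = 0.
Proof. exact: derive_cst. Qed.

Lemma alongD (W : normedModType R) (F G : E -> W) q : Cinf U F -> Cinf U G -> U q ->
  along T (fun p => F p + G p) q = along T F q + along T G q.
Proof.
by move=> HF HG Uq; exact: (deriveD (Cinf_derivable _ HF Uq) (Cinf_derivable _ HG Uq)).
Qed.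

Lemma alongN (W : normedModType R) (F : E -> W) q : Cinf U F -> U q ->
  along T (fun p => - F p) q = - along T F q.
Proof. by move=> HF Uq; exact: (deriveN (Cinf_derivable _ HF Uq)). Qed.

Lemma alongB (W : normedModType R) (F G : E -> W) q : Cinf U F -> Cinf U G -> U q ->
  along T (fun p => F p - G p) q = along T F q - along T G q.
Proof.
by move=> HF HG Uq; exact: (deriveB (Cinf_derivable _ HF Uq) (Cinf_derivable _ HG Uq)).
Qed.

Lemma alongM (F G : E -> R) q : Cinf U F -> Cinf U G -> U q ->
  along T (fun p => F p * G p) q = F q * along T G q + G q * along T F q.
Proof.
by move=> HF HG Uq; exact: (deriveM (Cinf_derivable _ HF Uq) (Cinf_derivable _ HG Uq)).
Qed.

Lemma alongMl (a : R) (G : E -> R) q : Cinf U G -> U q ->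
  along T (fun p => a * G p) q = a * along T G q.
Proof. by move=> HG Uq; rewrite alongM ?along_cst ?mulr0 ?addr0//; exact: Cinf_cst. Qed.

Lemma alongX (F : E -> R) k q : Cinf U F -> U q ->
  along T (fun p => F p ^+ k.+1) q = k.+1%:R * F q ^+ k * along T F q.
Proof.
move=> HF Uq; elim: k => [|k IH].
  by rewrite expr0 !mul1r; apply: eq_along => // p _; rewrite expr1.
have -> : (fun p => F p ^+ k.+2) = (fun p => F p * F p ^+ k.+1).
  by apply/funext => p; rewrite exprS.
rewrite alongM ?IH//; last exact: (Cinf_exp_comp oU _ HF).
by rewrite exprS -[k.+2]addn1 natrD; move: (F q) (_ ^+ k) (along _ _ _) (k.+1%:R) => a b c d; ring.
Qed.

Lemma along_scale m (k : E -> R) (F : E -> 'rV[R]_m) q : Cinf U k -> Cinf U F -> U q ->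
  along T (fun p => k p *: F p) q = along T k q *: F q + k q *: along T F q.
Proof.
move=> Hk HF Uq.
exact: (@derive_val _ _ _ _ _ _ _ (is_derive_scale (Cinf_is_derive (T q) Hk Uq) (Cinf_is_derive (T q) HF Uq))).
Qed.

Lemma along_mink (F G : E -> 'rV[R]_5) q : Cinf U F -> Cinf U G -> U q ->
  along T (fun p => mink (F p) (G p)) q = mink (along T F q) (G q) + mink (F q) (along T G q).
Proof.
move=> HF HG Uq.
exact: (@derive_val _ _ _ _ _ _ _ (is_derive_mink (Cinf_is_derive (T q) HF Uq) (Cinf_is_derive (T q) HG Uq))).
Qed.

(** Differentiating a constant product: for the vectors of a frame this is the skew-symmetry of the
    connection matrix. *)
Lemma along_skew (F G : E -> 'rV[R]_5) a q : Cinf U F -> Cinf U G -> U q ->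
  (forall p, U p -> mink (F p) (G p) = a) ->
  mink (along T G q) (F q) = - mink (along T F q) (G q).
Proof.
move=> HF HG Uq FG; have := along_mink HF HG Uq.
rewrite (eq_along FG Uq) along_cst (minkC (F q)) => /eqP.
by rewrite eq_sym addrC addr_eq0 => /eqP.
Qed.

Hypothesis HT : Cinf U T.

Lemma Cinf_along m (F : E -> 'rV[R]_m) : Cinf U F -> Cinf U (along T F).
Proof.
move=> HF.
have H j : Cinf U (fun q => T q 0 j *: 'D_(delta_mx 0 j) F q).
  exact: (Cinf_scale oU (Cinf_coord j oU HT) (Cinf_derive _ HF)).
apply: (eq_Cinf oU _ (Cinf_sum oU H)) => q Uq.
by rewrite /along (derive_dir_rV _ oU HF Uq).
Qed.

Lemma Cinf_along_real (f : E -> R) : Cinf U f -> Cinf U (along T f).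
Proof.
move=> Hf.
have H j : Cinf U (fun q => T q 0 j * 'D_(delta_mx 0 j) f q).
  exact: (Cinf_mul oU (Cinf_coord j oU HT) (Cinf_derive _ Hf)).
apply: (eq_Cinf oU _ (Cinf_sum oU H)) => q Uq.
by rewrite /along (derive_dir _ oU Hf Uq).
Qed.

Lemma derive_along m (F : E -> 'rV[R]_m) v q : Cinf U F -> U q ->
  'D_v (along T F) q = 'D_('D_v T q) F q + 'D_(T q) ('D_v F) q.
Proof.
move=> HF Uq.
pose G p := \sum_j T p 0 j *: 'D_(delta_mx 0 j) F p.
have FG p : U p -> along T F p = G p by move=> Up; exact: (derive_dir_rV _ oU HF Up).
have -> : 'D_v (along T F) q = 'D_v G q by exact: (eq_derive_on _ oU FG Uq).
have dG j : is_derive q v (fun p => T p 0 j *: 'D_(delta_mx 0 j) F p)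
    (('D_v T q) 0 j *: 'D_(delta_mx 0 j) F q + T q 0 j *: 'D_(delta_mx 0 j) ('D_v F) q).
  have -> : 'D_(delta_mx 0 j) ('D_v F) q = 'D_v ('D_(delta_mx 0 j) F) q.
    exact: (Cinf_derive_comm _ _ oU HF Uq).
  rewrite derive_rV; last exact: (Cinf_derivable v HT Uq).
  exact: (is_derive_scale (Cinf_is_derive v (Cinf_coord j oU HT) Uq)
    (Cinf_is_derive v (Cinf_derive _ HF) Uq)).
have -> : G = \sum_j (fun p => T p 0 j *: 'D_(delta_mx 0 j) F p).
  by apply/funext => p; rewrite /G fct_sumE.
have [_ ->] := is_derive_sum dG.
rewrite big_split (derive_dir_rV ('D_v T q) oU HF Uq).
by rewrite (derive_dir_rV (T q) oU (Cinf_derive v HF) Uq).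
Qed.

End fields.

Lemma dir_linear m (F : E -> 'rV[R]_m) q (a b : R) v w : Cinf U F -> U q ->
  'D_(a *: v + b *: w) F q = a *: 'D_v F q + b *: 'D_w F q.
Proof.
move=> HF Uq; rewrite !(derive_dir_rV _ oU HF Uq) !scaler_sumr -big_split.
by apply: eq_bigr => j _ /=; rewrite !mxE scalerDl !scalerA.
Qed.

Lemma dirB m (F : E -> 'rV[R]_m) q v w : Cinf U F -> U q ->
  'D_(v - w) F q = 'D_v F q - 'D_w F q.
Proof.
by move=> HF Uq; have := dir_linear 1 (-1) v w HF Uq; rewrite !scale1r !scaleN1r.
Qed.

(** Flatness of the target: second derivatives of F commute, and only the derivative along the
    bracket of the fields is left. The integrability conditions of the surface all come from this
    identity. *)
Lemma along_commutator T1 T2 m (F : E -> 'rV[R]_m) q :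
  Cinf U T1 -> Cinf U T2 -> Cinf U F -> U q ->
  along T1 (along T2 F) q - along T2 (along T1 F) q =
  'D_(along T1 T2 q - along T2 T1 q) F q.
Proof.
move=> H1 H2 HF Uq.
have A1 : along T1 (along T2 F) q = _ := derive_along H2 (T1 q) HF Uq.
have A2 : along T2 (along T1 F) q = _ := derive_along H1 (T2 q) HF Uq.
have key (a b c d : 'rV[R]_m) : c = d -> a + c - (b + d) = a - b.
  by move=> ->; rewrite opprD addrACA subrr addr0.
apply: (etrans (congr2 (fun x y => x - y) A1 A2)).
apply: (etrans (key _ _ _ _ (Cinf_derive_comm (T2 q) (T1 q) oU HF Uq))).
exact: (esym (dirB (along T1 T2 q) (along T2 T1 q) HF Uq)).
Qed.

End Along.

(** * Frenet theory of the base curve *)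

Section Frenet.
Context {R : realType}.
Local Notation E5 := 'rV[R]_5.

Variables (J : set R) (x e1 e3 e4 : R -> E5) (s S : R -> R) (b1 : E5) (c : R).
Hypothesis oJ : open J.
Hypothesis dx : forall u, J u -> is_derive u (1:R) x (e1 u).
Hypothesis de1 : forall u, J u -> is_derive u (1:R) e1
  (- s u ^+ 2 *: e3 u + (c * s u ^+ 3) *: e4 u + x u).
Hypothesis de3 : forall u, J u -> is_derive u (1:R) e3 (s u ^+ 2 *: e1 u).
Hypothesis de4 : forall u, J u -> is_derive u (1:R) e4 (- (c * s u ^+ 3) *: e1 u).
Hypothesis ds : forall u, J u -> is_derive u (1:R) s (2 / 3 * s u * S u).
Hypotheses (s_gt0 : forall u, J u -> 0 < s u) (S_gt0 : forall u, J u -> 0 < S u).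
Hypothesis fr : forall u, J u ->
  [/\ mink (e1 u) (e1 u) = 1, mink (e3 u) (e3 u) = 1, mink (e4 u) (e4 u) = 1 & mink (x u) (x u) = -1]
  /\ [/\ mink (e1 u) (x u) = 0, mink (e3 u) (x u) = 0, mink (e4 u) (x u) = 0 & mink (e3 u) (e4 u) = 0].
Hypothesis frb : forall u, J u ->
  [/\ mink (x u) b1 = 0, mink (e1 u) b1 = 0, mink (e3 u) b1 = 0 & mink (e4 u) b1 = 0].

Let rho u := 1 + c ^+ 2 * s u ^+ 2.
Let rho_gt0 u : 0 < rho u.
Proof. by rewrite ltr_pwDl// mulr_ge0// sqr_ge0. Qed.

Lemma derive1_tangent u : J u -> derive1 x u = e1 u.
Proof. by move=> Ju; rewrite derive1E; have [_ ->] := dx Ju. Qed.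

(** Projection to the tangent space of H^4 removes the component x of the acceleration; its
    component along b1 is already zero. *)
Lemma covH3_tangent u : J u ->
  covH3 b1 x (derive1 x) u = - s u ^+ 2 *: e3 u + (c * s u ^+ 3) *: e4 u.
Proof.
move=> Ju; have [[h11 h33 h44 hxx] [h1x h3x h4x h34]] := fr Ju.
have [bx be1 be3 be4] := frb Ju.
have E : derive1 (derive1 x) u = - s u ^+ 2 *: e3 u + (c * s u ^+ 3) *: e4 u + x u.
  rewrite derive1E (eq_derive_on (1:R) (G := e1) oJ derive1_tangent Ju).
  by have [_ ->] := de1 Ju.
rewrite /covH3 E /projH !minkE h3x h4x hxx bx be3 be4 !mulr0 !add0r.
by rewrite scale0r subr0 scaleN1r addrK.
Qed.

Lemma frenet_curvatureE u : J u ->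
  frenet_curvature b1 x u = s u ^+ 2 * Num.sqrt (rho u).
Proof.
move=> Ju; have [[h11 h33 h44 hxx] [h1x h3x h4x h34]] := fr Ju.
rewrite /frenet_curvature covH3_tangent//.
have -> (v := - s u ^+ 2 *: e3 u + (c * s u ^+ 3) *: e4 u) : mink v v = (s u ^+ 2) ^+ 2 * rho u.
  by rewrite /v !minkE (minkC (e4 u)) h33 h44 h34 /rho; move: (s u) => y; ring.
by rewrite sqrtrM ?sqr_ge0// sqrtr_sqr ger0_norm ?sqr_ge0.
Qed.

(** m = rho^(-1/2), with rho = 1 + c^2 f, normalizes - e3 + c s e4. It enters through sqrt rho = rho
    m and m^2 rho = 1, which keeps the computations rational. *)
Let m u := rho u `^ (- 2^-1).

Let m_gt0 u : 0 < m u. Proof. exact: powR_gt0. Qed.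

Let mE u : Num.sqrt (rho u) = rho u * m u.
Proof.
rewrite /m -[X in _ = X * _]powRr1 ?ltW// -powRD; last by apply/implyP => _; exact: lt0r_neq0.
by rewrite -powR12_sqrt ?ltW//; congr (_ `^ _); field.
Qed.

Let m2 u : m u ^+ 2 * rho u = 1.
Proof.
have := mE u => E; have r0 := rho_gt0 u; apply: (mulfI (lt0r_neq0 r0)).
have : Num.sqrt (rho u) ^+ 2 = rho u by rewrite sqr_sqrtr ?ltW.
by rewrite E => H; rewrite mulr1 -[RHS]H; ring.
Qed.

Lemma frenet_normalE u : J u ->
  frenet_normal b1 x u = m u *: (- e3 u + (c * s u) *: e4 u).
Proof.
move=> Ju; rewrite /frenet_normal covH3_tangent// frenet_curvatureE// mE.
have s0 := lt0r_neq0 (s_gt0 Ju); have r0 := lt0r_neq0 (rho_gt0 u); have m0 := lt0r_neq0 (m_gt0 u).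
have -> : - s u ^+ 2 *: e3 u + (c * s u ^+ 3) *: e4 u = s u ^+ 2 *: (- e3 u + (c * s u) *: e4 u).
  rewrite scalerDr scalerN scaleNr scalerA; congr (_ + _ *: _).
  by move: (s u) => y; ring.
rewrite scalerA; congr (_ *: _).
have := m2 u; move: (s u) (rho u) (m u) s0 r0 m0 => y r z y0 r0' z0 E.
apply: (mulfI r0'); rewrite [RHS]mulrC.
have -> : r * ((y ^+ 2 * (r * z))^-1 * y ^+ 2) = z^-1 by field; rewrite ?y0 ?r0' ?z0.
by apply: (mulfI z0); rewrite divff// -E; ring.
Qed.

Lemma frenet_torsionE u : J u ->
  frenet_torsion b1 x u = 2 * `|c| * s u / (3 * rho u) * S u.
Proof.
move=> Ju; have [[h11 h33 h44 hxx] [h1x h3x h4x h34]] := fr Ju.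
have [bx be1 be3 be4] := frb Ju.
have dsu := ds Ju; pose s' := 2 / 3 * s u * S u.
have drho : is_derive u (1:R) rho (c ^+ 2 * (2 * s u * s')).
  have H := is_deriveD (is_derive_cst (1:R) u (1:R)) (is_deriveZ (c ^+ 2) (is_deriveM dsu dsu)).
  have rhoE : rho = cst 1 + (c ^+ 2) *: (s * s).
    by apply/funext => v; rewrite /rho expr2.
  have dE : c ^+ 2 * (2 * s u * s') = 0 + c ^+ 2 *: (s u *: (2 / 3 * s u * S u) + s u *: (2 / 3 * s u * S u)).
    by rewrite /GRing.scale /= -/s'; move: s' (s u) => y z; ring.
  by rewrite rhoE dE.
have [dm Em] : derivable m u 1 /\ rho u * 'D_1 m u = - m u * (c ^+ 2 * s u * s').
  have [d1 _] := drho.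
  have [d2 _] := is_derive1_powR (- 2^-1) (rho_gt0 u).
  have [d3 _] := derive_comp_real d1 d2.
  split; first exact: d3.
  have H := is_deriveM (is_deriveM (derivableP d3) (derivableP d3)) drho.
  have C1 : m * m * rho = cst 1.
    by apply/funext => v; rewrite -[LHS]/(m v * m v * rho v) -expr2 m2.
  move: H; rewrite -[X in X * X * _]/m C1 => -[_]; rewrite derive_cst.
  have m0 := lt0r_neq0 (m_gt0 u).
  rewrite /GRing.scale /= -[(m * m) u]/(m u * m u) -['D_1 _ u]/('D_1 m u) => E.
  apply: (mulfI (_ : 2 * m u != 0)); first by rewrite mulf_neq0 ?pnatr_eq0.
  move: E; rewrite -/(m u); move: ('D_1 m u) (m u) (rho u) (s u) (s') => a b d e f E.
  by lra.
have dcs : is_derive u (1:R) (fun u => c * s u) (c * s').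
  have := is_deriveM (is_derive_cst c u (1:R)) dsu.
  rewrite scaler0 addr0 -/s'; exact.
have dN : is_derive u (1:R) (fun u => m u *: (- e3 u + (c * s u) *: e4 u))
   ('D_1 m u *: (- e3 u + (c * s u) *: e4 u) +
    m u *: (- (s u ^+ 2 *: e1 u) + ((c * s') *: e4 u + (c * s u) *: (- (c * s u ^+ 3) *: e1 u)))).
  apply: is_derive_scale; first exact: derivableP.
  apply: is_deriveD; first by apply: is_deriveN; exact: de3.
  exact: (is_derive_scale dcs (de4 Ju)).
(* The e1-components cancel: that of the derivative of N is - m s^2 rho, which is minus the
   curvature. *)
have cN : covH3 b1 x (frenet_normal b1 x) u + frenet_curvature b1 x u *: derive1 x u =
   'D_1 m u *: (- e3 u + (c * s u) *: e4 u) + (m u * (c * s')) *: e4 u.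
  rewrite /covH3 derive1E (eq_derive_on (1:R) (G := fun u => m u *: (- e3 u + (c * s u) *: e4 u)) oJ frenet_normalE Ju).
  have [_ ->] := dN; rewrite /projH !minkE h3x h4x h1x be1 be3 be4 !(mulr0,add0r,addr0,oppr0).
  rewrite !scale0r subr0 addr0 frenet_curvatureE// derive1_tangent// mE -addrA; congr (_ + _).
  apply/rowP => j; rewrite !mxE /rho.
  by move: (m u) (e1 u 0 j) (s u) (s') (e4 u 0 j) => z y t v w; ring.
rewrite /frenet_torsion cN.
have r0 := rho_gt0 u; have s0 := s_gt0 Ju; have S0 := S_gt0 Ju.
have key z : z = (2 * `|c| * s u / (3 * rho u) * S u) ^+ 2 ->
    Num.sqrt z = 2 * `|c| * s u / (3 * rho u) * S u.
  move=> ->; rewrite sqrtr_sqr ger0_norm// mulr_ge0 ?(ltW S0)// divr_ge0//.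
    by rewrite !mulr_ge0 ?(ltW s0).
  by rewrite mulr_ge0 ?(ltW r0).
apply: key; rewrite !minkE (minkC (e4 u)) h33 h44 h34.
have c2 : `|c| ^+ 2 = c ^+ 2 by rewrite real_normK ?num_real.
have -> : (2 * `|c| * s u / (3 * rho u) * S u) ^+ 2 = c ^+ 2 * s' ^+ 2 / rho u ^+ 2.
  rewrite -c2 /s'; move: (s u) (S u) (rho u) (`|c|) (lt0r_neq0 r0) => y z t w t0.
  by field; rewrite t0.
have rE : rho u = 1 + c ^+ 2 * s u ^+ 2 by [].
have := m2 u; move: Em rE (lt0r_neq0 r0).
clear drho dcs dN cN.
move: ('D_1 m u) (m u) (rho u) (s u) s' => a z t y w Ea rE t0 zt.
apply: (mulfI (expf_neq0 2 t0)); rewrite [RHS]mulrC divfK ?expf_neq0//.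
(* After multiplication by rho^2, rho m' is replaced by - m c^2 s s' and then m^2 rho by 1. *)
transitivity ((t * a) ^+ 2 * (1 + c ^+ 2 * y ^+ 2) + 2 * (t * a) * t * z * c ^+ 2 * y * w + t ^+ 2 * z ^+ 2 * c ^+ 2 * w ^+ 2).
  by ring.
rewrite -rE Ea; transitivity ((z ^+ 2 * t) * (c ^+ 2 * w ^+ 2) * (t - c ^+ 2 * y ^+ 2)); first by ring.
by rewrite zt rE; ring.
Qed.

End Frenet.

(** * Reparametrization of charts *)

Section Reparametrization.
Context {R : realType}.
Local Notation E2 := 'rV[R]_2.

Lemma open_preimage_in (S T : topologicalType) (F : S -> T) (A : set S) (B : set T) :
  open A -> open B -> (forall x, A x -> {for x, continuous F}) -> open (A `&` F @^-1` B).
Proof.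
move=> oA oB cF; rewrite openE => x [Ax Bx]; apply: filterI; first exact: open_nbhs_nbhs.
have nb : nbhs (F x) B by apply: open_nbhs_nbhs; split; [exact: oB|exact: Bx].
exact: (cF _ Ax _ nb).
Qed.

Lemma crange_cinv (M : topologicalType) (chi : @chart R M) q :
  crange chi q -> cdom chi (cinv chi q) /\ cmap chi (cinv chi q) = q.
Proof. by move=> [p dp <-]; rewrite cmapK. Qed.

Lemma open_overlap (M : topologicalType) (chi chi' : @chart R M) : open (overlap chi chi').
Proof.
apply: open_preimage_in; [exact: crange_open|exact: cdom_open|].
by move=> q; exact: cinv_cont.
Qed.

Arguments open_overlap {M} chi chi' t _ : rename.

Variables (M : surface R) (chi0 : @chart R M) (W Q : set E2) (Psi Th : E2 -> E2).
Hypotheses (chi0M : atlas chi0) (oW : open W) (oQ : open Q) (Wchi0 : W `<=` crange chi0).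
Hypotheses (HPsi : Cinf W Psi) (HTh : Cinf Q Th).
Hypothesis PsiK : forall q, W q -> Q (Psi q) /\ Th (Psi q) = q.
Hypothesis ThK : forall y, Q y -> W (Th y) /\ Psi (Th y) = y.

Let D := cdom chi0 `&` cmap chi0 @^-1` W.
Let m p := Psi (cmap chi0 p).
Let i y := cinv chi0 (Th y).

Let D_open : open D.
Proof.
apply: open_preimage_in; [exact: cdom_open|exact: oW|exact: cmap_cont].
Qed.

Let range : m @` D = Q.
Proof.
apply/seteqP; split=> [_ [p [_ Wp] <-]|y Qy]; first by have [] := PsiK Wp.
have [Wy E] := ThK Qy; have [d c] := crange_cinv (Wchi0 Wy).
by exists (i y); rewrite /m /i /D /= ?c.
Qed.

Let range_open : open (m @` D). Proof. by rewrite range. Qed.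

Let mK p : D p -> i (m p) = p.
Proof. by move=> [dp Wp]; rewrite /i /m (PsiK Wp).2 cmapK. Qed.

Let m_cont p : D p -> {for p, continuous m}.
Proof.
move=> [dp Wp]; apply: (@continuous_comp _ _ _ (cmap chi0) Psi); first exact: cmap_cont.
exact: (Cinf_continuous HPsi Wp).
Qed.

Let i_cont y : (m @` D) y -> {for y, continuous i}.
Proof.
rewrite range => Qy; apply: (@continuous_comp _ _ _ Th (cinv chi0)).
  exact: (Cinf_continuous HTh Qy).
by apply: cinv_cont; apply: Wchi0; have [] := ThK Qy.
Qed.

(** Every transition between the new chart and a chart of the atlas is a transition of chi0 composed
    with Th or Psi, hence smooth. *)
Lemma reparametrized_chart : exists chi : @chart R M,
  [/\ smooth_chart chi, cdom chi = D, crange chi = Q & cinv chi = i].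
Proof.
pose chi := Chart D_open range_open mK m_cont i_cont.
exists chi; split; [|by []|exact: range|by []].
move=> chi' chi'M; have [[S1 S2] _] := atlas_compatible chi0M chi'M.
have rchi : crange chi = Q by exact: range.
move: S1 S2; rewrite !smooth_onP => S1 S2; split.
  apply/(smooth_onP).
  have sQ : overlap chi chi' `<=` Q by move=> y []; rewrite rchi.
  have inO y : overlap chi chi' y -> overlap chi0 chi' (Th y).
    move=> [+ dy]; rewrite rchi => Qy; split; last exact: dy.
    by apply: Wchi0; have [] := ThK Qy.
  have H := Cinf_comp_rV (open_overlap chi chi') (open_overlap _ _) inO (Cinf_sub sQ HTh) S1.
  exact: H.
apply/smooth_onP.
have sO : overlap chi' chi `<=` overlap chi' chi0 by move=> y [? []].
have inW y : overlap chi' chi y -> W (transition chi' chi0 y) by move=> [_ []].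
have H := Cinf_comp_rV (open_overlap chi' chi) oW inW (Cinf_sub sO S2) HPsi.
exact: H.
Qed.

End Reparametrization.

(** * Coordinates adapted to a frame *)

Section ChainRule.
Context {R : realType}.

Lemma is_derive_compC (V : normedModType R) n (A : set 'rV[R]_n) (G : 'rV[R]_n -> R)
    (F : V -> 'rV[R]_n) x v dF : open A -> Cinf A G -> A (F x) ->
  is_derive x v F dF -> is_derive x v (fun y => G (F y)) ('D_dF G (F x)).
Proof.
move=> oA HG AF [HF <-].
rewrite (derive_dir ('D_v F x) oA HG AF).
exact: (derive_comp_coord HF (Cinf_differentiable oA HG AF)).
Qed.

Lemma is_derive_compC_rV (V : normedModType R) n m (A : set 'rV[R]_n)
    (G : 'rV[R]_n -> 'rV[R]_m) (F : V -> 'rV[R]_n) x v dF : open A -> Cinf A G -> A (F x) ->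
  is_derive x v F dF -> is_derive x v (fun y => G (F y)) ('D_dF G (F x)).
Proof.
move=> oA HG AF HF.
have H j := is_derive_compC oA (Cinf_coord j oA HG) AF HF.
have D : derivable (fun y => G (F y)) x v.
  by apply/derivable_rV => j; have [] := H j.
split; first exact: D.
apply/rowP => j; rewrite (derive_rV j D) (derive_rV j (Cinf_derivable dF HG AF)).
by have [_ ->] := H j.
Qed.

Lemma eq_of_derive0 n m (A : set 'rV[R]_n) (F : 'rV[R]_n -> 'rV[R]_m) x v :
  Cinf A F ->
  (forall s, s \in `[(0:R), 1] -> A (x + s *: v) /\ 'D_v F (x + s *: v) = 0) ->
  F (x + v) = F x.
Proof.
move=> HF H; apply/rowP => j.
have dF s : s \in `[(0:R), 1] -> derivable (fun y => F y 0 j) (x + s *: v) v.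
  move=> /H[As _]; have D := Cinf_derivable v HF As.
  exact: ((derivable_rV F _ v).1 D j).
have [s /subset_itv_oo_cc sI] := MVT_line dF.
have [As Ds] := H _ sI.
rewrite -(derive_rV j (Cinf_derivable v HF As)) Ds mxE => /eqP.
by rewrite subr_eq0 => /eqP.
Qed.

Lemma ball_segment n (c : 'rV[R]_n) r x v s : s \in `[(0:R), 1] ->
  ball c r x -> ball c r (x + v) -> ball c r (x + s *: v).
Proof.
rewrite in_itv /= -!ball_normE /= => /andP[s0 s1] xr yr.
have -> : c - (x + s *: v) = (1 - s) *: (c - x) + s *: (c - (x + v)).
  by apply/rowP => j; rewrite !mxE; move: (c 0 j) (x 0 j) (v 0 j) => a b d; ring.
rewrite (le_lt_trans (ler_normD _ _))// !normrZ (ger0_norm s0) ger0_norm ?subr_ge0//.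
have [s00|sn] := eqVneq s 0; first by rewrite s00 mul0r addr0 subr0 mul1r.
have : s * `|c - (x + v)| < s * r by rewrite ltr_pM2l// lt_def sn.
have : (1 - s) * `|c - x| <= (1 - s) * r by rewrite ler_wpM2l ?subr_ge0// ltW.
by move: (s * `|_|) (_ * `|_|) => a b ? ?; lra.
Qed.

Definition pt2 (u t : R) : 'rV[R]_2 := \row_i [:: u; t]`_i.

Lemma pt2_eq (y : 'rV[R]_2) : pt2 (y 0 0) (y 0 1) = y.
Proof. by apply/rowP => -[[|[|//]] i]; rewrite mxE /=; congr (y 0 _); exact: val_inj. Qed.

Lemma pt2_0 u t : pt2 u t 0 0 = u. Proof. by rewrite mxE. Qed.
Lemma pt2_1 u t : pt2 u t 0 1 = t. Proof. by rewrite mxE. Qed.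

Lemma ball_pt2 (c y : 'rV[R]_2) r : 0 < r ->
  ball c r y <-> `|c 0 0 - y 0 0| < r /\ `|c 0 1 - y 0 1| < r.
Proof.
move=> r0; rewrite -ball_normE /=; split=> [H|[H0 H1]].
  by split; rewrite (le_lt_trans _ H)//; have := rV_coord_le (c - y) (_ : 'I_2);
    [move/(_ 0)|move/(_ 1)]; rewrite !mxE.
have : `|c - y| <= Num.max `|c 0 0 - y 0 0| `|c 0 1 - y 0 1|.
  apply: rV_norm_le; first by rewrite le_max normr_ge0.
  move=> j; have [->|->] : j = 0 \/ j = 1.
    by case: j => -[|[|//]] i; [left|right]; exact: val_inj.
  by rewrite !mxE le_max lexx.
  by rewrite !mxE le_max lexx orbT.
by move=> /le_lt_trans; apply; rewrite gt_max H0.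
Qed.

Lemma Cinf_pt2 (V : normedModType R) (U : set V) (f g : V -> R) : open U ->
  Cinf U f -> Cinf U g -> Cinf U (fun q => pt2 (f q) (g q)).
Proof.
move=> oU Hf Hg; apply: (Cinf_rV oU) => -[[|[|//]] i].
  by apply: (eq_Cinf oU _ Hf) => q _; rewrite mxE.
by apply: (eq_Cinf oU _ Hg) => q _; rewrite mxE.
Qed.

End ChainRule.

Section Hyperbolic.
Context {R : realType}.

Lemma cosh0 : cosh (0:R) = 1.
Proof. by rewrite /cosh oppr0 expR0; field. Qed.

Lemma sinh0 : sinh (0:R) = 0.
Proof. by rewrite /sinh oppr0 subrr mul0r. Qed.

End Hyperbolic.

Opaque mink derive along.

Section AdaptedCoordinates.
Context {R : realType}.
Local Notation E2 := 'rV[R]_2.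
Local Notation E5 := 'rV[R]_5.

Variables (U : set E2) (T1 T2 : E2 -> E2) (X e2 n : E2 -> E5) (s S k : E2 -> R) (c C : R).
Hypotheses (oU : open U) (HT1 : Cinf U T1) (HT2 : Cinf U T2) (HX : Cinf U X).
Hypotheses (He2 : Cinf U e2) (Hn : Cinf U n) (Hs : Cinf U s) (Hk : Cinf U k).
Hypothesis D2X : forall q, U q -> along T2 X q = e2 q.
Hypothesis D1e2 : forall q, U q -> along T1 e2 q = 0.
Hypothesis D1n : forall q, U q -> along T1 n q = 0.
Hypothesis D2e2 : forall q, U q -> along T2 e2 q = k q *: n q.
Hypothesis D2n : forall q, U q -> along T2 n q = k q *: e2 q.
Hypothesis D2k : forall q, U q -> along T2 k q = 0.
Hypothesis D1s : forall q, U q -> along T1 s q = 2 / 3 * s q * S q.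
Hypothesis D2s : forall q, U q -> along T2 s q = 0.
Hypotheses (s_gt0 : forall q, U q -> 0 < s q) (S_gt0 : forall q, U q -> 0 < S q).
Hypothesis S_sqr : forall q, U q ->
  S q ^+ 2 = 1 + 9 * C * s q ^+ 3 - 9 * s q ^+ 4 - c ^+ 2 * s q ^+ 6.
Hypothesis k_gt0 : forall q, U q -> 0 < k q.
Hypotheses (mee : forall q, U q -> mink (e2 q) (e2 q) = 1)
  (mnn : forall q, U q -> mink (n q) (n q) = -1)
  (mne : forall q, U q -> mink (n q) (e2 q) = 0).

(* u is a primitive of (2 x sqrt(P x) / 3)^-1 evaluated at s, so that du(T1) = 1 *)
Lemma arclength_function q0 : U q0 -> exists (B : set E2) (u : E2 -> R),
  [/\ open B, B q0, B `<=` U, Cinf B u &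
      forall q, B q -> along T1 u q = 1 /\ along T2 u q = 0].
Proof.
move=> Uq0.
pose P x : R := 1 + 9 * C * x ^+ 3 - 9 * x ^+ 4 - c ^+ 2 * x ^+ 6.
pose A0 := [set x : R | 0 < x] : set R.
have HP : Cinf setT P.
  have Hx m : Cinf setT (fun x : R => x ^+ m).
    by apply: (Cinf_exp_comp openT) => m'; exact: Ck_id.
  have Hm (a : R) m := Cinf_mul openT (Cinf_cst setT a) (Hx m).
  exact: (Cinf_sub_fun openT (Cinf_sub_fun openT (Cinf_add openT (Cinf_cst _ _) (Hm _ _)) (Hm _ _)) (Hm _ _)).
pose A := A0 `&` (P @^-1` [set x : R | 0 < x]).
have oA : open A.
  apply: openI; first exact: open_gt.
  by apply: open_comp => [x _|]; [exact: (Cinf_continuous HP)|exact: open_gt].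
pose F x : R := (2 / 3 * x * Num.sqrt (P x))^-1.
have HF : Cinf A F.
  have HPA : Cinf A P by exact: (Cinf_sub (@subsetT _ A) HP).
  have Hsq : Cinf A (fun x => Num.sqrt (P x)).
    by apply: (Cinf_sqrt_comp oA HPA) => x [].
  have Hid : Cinf A (fun x : R => x) by move=> m; exact: Ck_id.
  apply: (Cinf_inv_comp oA).
    exact: (Cinf_mul oA (Cinf_mul oA (Cinf_cst _ _) Hid) Hsq).
  move=> x [x0 Px]; rewrite !mulf_neq0 ?invr_eq0 ?pnatr_eq0//; first exact: lt0r_neq0.
  by rewrite lt0r_neq0// sqrtr_gt0.
(* S is positive, so it is the root sqrt (P s), and the values of s lie where the integrand F is
   smooth. *)
have AS q : U q -> A (s q) /\ Num.sqrt (P (s q)) = S q.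
  move=> Uq; split; last by rewrite /P -S_sqr// sqrtr_sqr gtr0_norm ?S_gt0.
  split; first exact: s_gt0.
  by rewrite /= /P -S_sqr// exprn_gt0// S_gt0.
have [d d0 [G [dA dG]]] := local_antiderivative oA (AS _ Uq0).1
  (fun y Ay => Cinf_continuous HF Ay).
have ob : open (ball (s q0) d) by exact: ball_open.
have HG : Cinf (ball (s q0) d) G.
  exact: (Cinf_antiderivative (g := F) ob dG (Cinf_sub dA HF)).
pose B := U `&` (s @^-1` ball (s q0) d).
have oB : open B.
  rewrite openE => q [Uq sq]; apply: filterI; first exact: open_nbhs_nbhs.
  have nr : nbhs (s q) (ball (s q0) d).
    by apply: open_nbhs_nbhs; split; [exact: ball_open|exact: sq].
  by have cs := Cinf_continuous Hs Uq; exact: (cs _ nr).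
have BU : B `<=` U by move=> q [].
have HsB := Cinf_sub BU Hs.
have Hu : Cinf B (fun q => G (s q)).
  by apply: (Cinf_comp_real oB ob _ HsB HG) => q [].
exists B, (fun q => G (s q)); split=> //; first by split=> //; exact: ballxx.
move=> q [Uq sq]; have [As SE] := AS _ Uq; have := dG _ sq; rewrite /F SE => -[dGq EG].
have D T : along T (fun q => G (s q)) q = along T s q * (2 / 3 * s q * S q)^-1.
  rewrite !alongE; have [_ E] := derive_comp_real (Cinf_derivable (T q) Hs Uq) dGq.
  by apply: (etrans E); rewrite EG.
rewrite !D D1s// D2s// mul0r; split=> //.
by rewrite divff// !mulf_neq0 ?invr_eq0 ?pnatr_eq0// lt0r_neq0 ?s_gt0 ?S_gt0.
Qed.

(* e2 + n and e2 - n are null vectors scaled by e^t and e^-t along T2 *)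
Lemma hyperbolic_angle q0 : U q0 -> exists (B : set E2) (t : E2 -> R),
  [/\ open B, B q0, B `<=` U, Cinf B t & t q0 = 0 /\
      forall q, B q -> along T1 t q = 0 /\ along T2 t q = k q].
Proof.
(* h is half the product of the null vector e2 + n with the fixed null vector e2 - n at q0; the
   factor 1/2 makes h equal to 1, hence the angle equal to 0, at q0. *)
move=> Uq0; pose p q := e2 q + n q; pose v := e2 q0 - n q0.
have Hp : Cinf U p by exact: (Cinf_add oU He2 Hn).
pose h q := 2^-1 * mink (p q) v.
have Hm : Cinf U (fun q => mink (p q) v) by exact: (Cinf_mink oU Hp (Cinf_cst _ _)).
have Hh : Cinf U h by exact: (Cinf_mul oU (Cinf_cst _ _) Hm).
have h0 : h q0 = 1.
  rewrite /h /p /v !minkE mee// mnn// (minkC (e2 q0) (n q0)) mne//.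
  by field.
pose B := U `&` (h @^-1` [set x | 0 < x]).
have oB : open B.
  rewrite openE => q [Uq hq]; apply: filterI; first exact: open_nbhs_nbhs.
  have nr : nbhs (h q) [set x | 0 < x].
    by apply: open_nbhs_nbhs; split; [exact: open_gt|exact: hq].
  by have ch := Cinf_continuous Hh Uq; exact: (ch _ nr).
have BU : B `<=` U by move=> q [].
have HhB := Cinf_sub BU Hh.
exists B, (fun q => ln (h q)); split=> //.
- by split=> //=; rewrite h0.
- by apply: (Cinf_ln_comp oB HhB) => q [].
split; first by rewrite h0 ln1.
move=> q [Uq hq].
have D T : along T (fun q => ln (h q)) q = along T h q * (h q)^-1.
  have [dl El] := is_derive1_ln hq.
  rewrite !alongE; have [_ E] := derive_comp_real (Cinf_derivable (T q) Hh Uq) dl.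
  by apply: (etrans E); rewrite El.
have Dh T : along T h q = 2^-1 * mink (along T p q) v.
  rewrite (alongMl T _ Hm Uq) (along_mink T Hp (Cinf_cst _ _) Uq) along_cst.
  by rewrite mink0r addr0.
rewrite !D !Dh (alongD T1 He2 Hn Uq) (alongD T2 He2 Hn Uq) D1e2// D1n// D2e2// D2n//.
rewrite addr0 mink0l mulr0 mul0r; split=> //.
rewrite -scalerDr [n q + e2 q]addrC minkZl mulrCA -/(p q) -/(h q) mulfK//.
exact: lt0r_neq0.
Qed.

(** The derivatives of (u, t) along T1 and T2 are (1, 0) and (0, k), so T1 and T2 / k are the dual
    fields that the local inverse theorem asks for. *)
Lemma adapted_chart q0 : U q0 ->
  exists (r uc : R) (Psi Th : E2 -> E2) (W : set E2),
  [/\ 0 < r, open W, W q0, W `<=` U & Cinf W Psi] /\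
  [/\ forall q, W q -> ball (pt2 uc 0) r (Psi q) /\ Th (Psi q) = q,
      forall y, ball (pt2 uc 0) r y -> W (Th y) /\ Psi (Th y) = y,
      Cinf (ball (pt2 uc 0) r) Th, Psi q0 = pt2 uc 0 &
      forall y, ball (pt2 uc 0) r y ->
        is_derive y (delta_mx 0 0 : E2) Th (T1 (Th y)) /\
        is_derive y (delta_mx 0 1 : E2) Th ((k (Th y))^-1 *: T2 (Th y))].
Proof.
move=> Uq0.
have [B1 [u [oB1 Bq1 BU1 Hu Du]]] := arclength_function Uq0.
have [B2 [t [oB2 Bq2 BU2 Ht [t0 Dt]]]] := hyperbolic_angle Uq0.
pose B := B1 `&` B2; have oB : open B by exact: openI.
have BU : B `<=` U by move=> q [/BU1].
have HuB : Cinf B u by apply: Cinf_sub Hu => q [].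
have HtB : Cinf B t by apply: Cinf_sub Ht => q [].
pose Psi q := pt2 (u q) (t q).
have HPsi : Cinf B Psi by exact: (Cinf_pt2 oB HuB HtB).
pose F (j : 'I_2) : E2 -> E2 := if j == 0 then T1 else fun q => (k q)^-1 *: T2 q.
have HF j : Cinf B (F j).
  rewrite /F; case: ifP => _; apply: (Cinf_sub BU) => //.
  apply: (Cinf_scale oU _ HT2); apply: (Cinf_inv_comp oU Hk) => q /k_gt0.
  exact: lt0r_neq0.
have DPc v q : B q -> 'D_v Psi q = pt2 ('D_v u q) ('D_v t q).
  move=> Bq; have D := Cinf_derivable v HPsi Bq.
  apply/rowP => j; rewrite (derive_rV j D) [RHS]mxE.
  case: j => -[|[|//]] i /=.
    by congr ('D_v _ q); apply/funext => p; rewrite mxE.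
  by congr ('D_v _ q); apply/funext => p; rewrite mxE.
have DPsi j q : B q -> 'D_(F j q) Psi q = delta_mx 0 j.
  move=> Bq; rewrite DPc//; have [u1 u2] := Du q Bq.1; have [t1 t2] := Dt q Bq.2.
  move: u1 u2 t1 t2; rewrite !alongE => u1 u2 t1 t2.
  rewrite /F; case: eqP => [->|j0].
    by rewrite u1 t1; apply/rowP => -[[|[|//]] i]; rewrite !mxE.
  have -> : j = 1.
    by move: j0; case: j => -[|[|//]] i H; [case: H|]; exact: val_inj.
  rewrite (deriveZdir _ (Cinf_derivable (T2 q) HuB Bq)) (deriveZdir _ (Cinf_derivable (T2 q) HtB Bq)).
  rewrite u2 t2 scaler0 [_ *: k q]mulVf; last by rewrite lt0r_neq0// k_gt0//; exact: BU.
  by apply/rowP => -[[|[|//]] i]; rewrite !mxE.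
have [r [Th [W [[r0 oW Wq0 WB] [WP PTh DTh HTh]]]]] :=
  local_inverse oB HPsi HF DPsi (conj Bq1 Bq2 : B q0).
have P0 : Psi q0 = pt2 (u q0) 0 by rewrite /Psi t0.
rewrite P0 in WP PTh DTh HTh.
exists r, (u q0), Psi, Th, W; split.
  split=> //; first exact: subset_trans BU.
  exact: Cinf_sub HPsi.
split=> // y Qy.
have Fj j : is_derive y (delta_mx 0 j : E2) Th (F j (Th y)).
  have := DTh y (delta_mx 0 j) Qy; congr (is_derive _ _ _ _).
  rewrite (bigD1 j)//= mxE !eqxx scale1r big1 ?addr0// => i ij.
  by rewrite mxE (negbTE ij) scale0r.
by split; [exact: (Fj 0)|exact: (Fj 1)].
Qed.

(** * The surface in the coordinates (u, t) *)

Section consequences.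
Variables (q0 : E2) (r uc : R) (Th : E2 -> E2).
Let Q := ball (pt2 uc 0) r.
Hypotheses (r0 : 0 < r) (QU : forall y, Q y -> U (Th y)) (HTh : Cinf Q Th).
Hypotheses (Th0 : Th (pt2 uc 0) = q0).
Hypothesis dTh : forall y, Q y ->
  is_derive y (delta_mx 0 0 : E2) Th (T1 (Th y)) /\
  is_derive y (delta_mx 0 1 : E2) Th ((k (Th y))^-1 *: T2 (Th y)).

Lemma pullback_rV m (F : E2 -> 'rV[R]_m) y : Cinf U F -> Q y ->
  is_derive y (delta_mx 0 0 : E2) (fun y => F (Th y)) (along T1 F (Th y)) /\
  is_derive y (delta_mx 0 1 : E2) (fun y => F (Th y)) ((k (Th y))^-1 *: along T2 F (Th y)).
Proof.
move=> HF Qy; have [d0 d1] := dTh Qy; have Uy := QU Qy.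
have := is_derive_compC_rV oU HF Uy d0; have := is_derive_compC_rV oU HF Uy d1.
by rewrite !alongE (deriveZdir _ (Cinf_derivable (T2 (Th y)) HF Uy)).
Qed.

Lemma pullback (F : E2 -> R) y : Cinf U F -> Q y ->
  is_derive y (delta_mx 0 0 : E2) (fun y => F (Th y)) (along T1 F (Th y)) /\
  is_derive y (delta_mx 0 1 : E2) (fun y => F (Th y)) ((k (Th y))^-1 * along T2 F (Th y)).
Proof.
move=> HF Qy; have [d0 d1] := dTh Qy; have Uy := QU Qy.
have := is_derive_compC oU HF Uy d0; have := is_derive_compC oU HF Uy d1.
by rewrite !alongE (deriveZdir _ (Cinf_derivable (T2 (Th y)) HF Uy)).
Qed.

Let oQ : open Q. Proof. exact: ball_open. Qed.

Lemma Cinf_pullback_rV m (F : E2 -> 'rV[R]_m) : Cinf U F -> Cinf Q (fun y => F (Th y)).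
Proof. by move=> HF; exact: (Cinf_comp_rV oQ oU QU HTh HF). Qed.

Lemma Cinf_pullback (F : E2 -> R) : Cinf U F -> Cinf Q (fun y => F (Th y)).
Proof. by move=> HF; exact: (Cinf_comp oQ oU QU HTh HF). Qed.

(** Balls of the sup norm are squares, so projection to the axis t = 0 stays inside. *)
Lemma Q_base u t : Q (pt2 u t) -> Q (pt2 u 0).
Proof.
move=> /(ball_pt2 _ _ r0); rewrite !pt2_0 !pt2_1 => -[H _].
by apply/(ball_pt2 _ _ r0); rewrite !pt2_0 !pt2_1 subrr normr0.
Qed.

Lemma constant_in_t m (F : E2 -> 'rV[R]_m) u t : Cinf Q F ->
  (forall y, Q y -> 'D_(delta_mx 0 1) F y = 0) -> Q (pt2 u t) -> F (pt2 u t) = F (pt2 u 0).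
Proof.
move=> HF DF Qy; have Q0 := Q_base Qy.
have E : pt2 u t = pt2 u 0 + t *: delta_mx 0 1.
  by apply/rowP => -[[|[|//]] i]; rewrite !mxE /= ?mulr0 ?addr0 ?mulr1 ?add0r.
rewrite E; apply: (eq_of_derive0 HF) => x xI.
have Qx : Q (pt2 u 0 + x *: (t *: delta_mx 0 1)).
  by apply: (ball_segment xI Q0); rewrite -E.
split=> //; rewrite (deriveZdir _ (Cinf_derivable _ HF Qx)).
by rewrite DF// scaler0.
Qed.

Lemma constant_on_Q m (F : E2 -> 'rV[R]_m) y : Cinf Q F ->
  (forall y, Q y -> 'D_(delta_mx 0 0) F y = 0) ->
  (forall y, Q y -> 'D_(delta_mx 0 1) F y = 0) -> Q y -> F y = F (pt2 uc 0).
Proof.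
move=> HF DF0 DF1 Qy; have Qc : Q (pt2 uc 0) by exact: ballxx.
rewrite -[y](subrKC (pt2 uc 0)); apply: (eq_of_derive0 HF) => x xI.
have Qx : Q (pt2 uc 0 + x *: (y - pt2 uc 0)).
  by apply: ball_segment; rewrite ?subrKC.
split=> //; rewrite (derive_dir_rV _ oQ HF Qx) big_ord_recl big_ord1.
rewrite [delta_mx 0 ord0](_ : _ = delta_mx 0 0)// DF0// scaler0 add0r.
by rewrite [lift _ _](_ : _ = 1) ?DF1 ?scaler0//; exact: val_inj.
Qed.

(* e^(-+t) (e2 +- n) is constant *)
Lemma null_frame (eps : R) y : (eps = 1) \/ (eps = -1) -> Q y ->
  e2 (Th y) + eps *: n (Th y) = expR (eps * y 0 1) *: (e2 q0 + eps *: n q0).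
Proof.
move=> eE Qy; have eps2 : eps * eps = 1 by case: eE => ->; rewrite ?mulrNN mulr1.
pose p (y : E2) := e2 (Th y) + eps *: n (Th y).
have Hen : Cinf U (fun q => e2 q + eps *: n q).
  exact: (Cinf_add oU He2 (Cinf_scale oU (Cinf_cst _ _) Hn)).
have Hp : Cinf Q p by exact: (Cinf_pullback_rV Hen).
have Hc : Cinf Q (fun y : E2 => - (eps * y 0 1)).
  apply: (Cinf_opp oQ); apply: (Cinf_mul oQ (Cinf_cst _ _)).
  by apply: (@Cinf_coord _ _ _ _ id 1 oQ) => m; exact: Ck_id.
have HE := Cinf_expR_comp oQ Hc.
have dc j y' : is_derive y' (delta_mx 0 j : E2) (fun y : E2 => - (eps * y 0 1)) (- (eps * (j == 1)%:R)).
  apply: is_derive_affine => h; rewrite !mxE.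
  by rewrite eqxx /= eq_sym; move: (y' 0 1) => a; rewrite [h *: - _]mulrN mulrDr opprD addrC mulrCA.
have dE j y' : is_derive y' (delta_mx 0 j : E2) (fun y : E2 => expR (- (eps * y 0 1)))
    (- (eps * (j == 1)%:R) * expR (- (eps * y' 0 1))).
  have [d1 e1] := dc j y'; have [d2 e2'] := @is_derive_expR R (- (eps * y' 0 1)).
  by have := derive_comp_real d1 d2; rewrite e1 e2'.
have dp y' : Q y' -> is_derive y' (delta_mx 0 0 : E2) p 0 /\ is_derive y' (delta_mx 0 1 : E2) p (eps *: p y').
  move=> Qy'; have Uy := QU Qy'; have := pullback_rV Hen Qy'.
  have k0 : k (Th y') != 0 by rewrite lt0r_neq0// k_gt0.
  have A T : along T (fun q => e2 q + eps *: n q) (Th y') = along T e2 (Th y') + eps *: along T n (Th y').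
    rewrite (alongD T He2 (Cinf_scale oU (Cinf_cst _ _) Hn) Uy) (along_scale T (Cinf_cst _ _) Hn Uy).
    by rewrite along_cst scale0r add0r.
  rewrite !A D1e2// D1n// D2e2// D2n// scaler0 addr0 scalerA mulrC -scalerA -scalerDr scalerA mulVf//.
  have -> : 1 *: (n (Th y') + eps *: e2 (Th y')) = eps *: p y'.
    by rewrite scale1r /p scalerDr scalerA eps2 scale1r addrC.
  by [].
pose M (y : E2) := expR (- (eps * y 0 1)) *: p y.
have HM : Cinf Q M by exact: (Cinf_scale oQ HE Hp).
have My : M y = M (pt2 uc 0).
  apply: (constant_on_Q HM) => // y' Qy'; have [p0 p1] := dp y' Qy'.
    have [_ ->] := is_derive_scale (dE 0 y') p0.
    by rewrite /= mulr0 oppr0 mul0r scale0r scaler0 addr0.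
  have [_ ->] := is_derive_scale (dE 1 y') p1.
  by rewrite /= mulr1 scalerA mulNr scaleNr [_ * eps]mulrC addNr.
move: My; rewrite /M /p pt2_1 mulr0 oppr0 expR0 scale1r Th0 => <-.
by rewrite scalerA -expRD subrr expR0 scale1r.
Qed.

(** Half the sum and half the difference of the two null cases. *)
Lemma hyperbolic_frame y : Q y ->
  e2 (Th y) = cosh (y 0 1) *: e2 q0 + sinh (y 0 1) *: n q0 /\
  n (Th y) = sinh (y 0 1) *: e2 q0 + cosh (y 0 1) *: n q0.
Proof.
move=> Qy; have := null_frame (or_introl erefl) Qy; have := null_frame (or_intror erefl) Qy.
rewrite mul1r mulN1r !scale1r !scaleN1r /cosh /sinh.
move: (expR _) (expR _) (e2 _) (n _) (e2 _) (n _) => x z a b a' b' /rowP H1 /rowP H2.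
by split; apply/rowP => j; move: (H1 j) (H2 j); rewrite !mxE;
  move: (a 0 j) (b 0 j) (a' 0 j) (b' 0 j) => a1 b1 a2 b2 ? ?; lra.
Qed.

Lemma k_constant_in_t u t : Q (pt2 u t) -> k (Th (pt2 u t)) = k (Th (pt2 u 0)).
Proof.
move=> Qy; pose F (y : E2) : 'rV[R]_1 := k (Th y) *: const_mx 1.
have HF : Cinf Q F by exact: (Cinf_scale oQ (Cinf_pullback Hk) (Cinf_cst _ _)).
have : F (pt2 u t) = F (pt2 u 0).
  apply: constant_in_t => // y' Qy'; have [_ d1] := pullback Hk Qy'.
  have [_ ->] := is_derive_scale d1 (is_derive_cst (const_mx 1 : 'rV[R]_1) y' (delta_mx 0 1)).
  by rewrite D2k ?mulr0 ?scale0r ?scaler0 ?addr0//; exact: QU.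
by move/rowP/(_ 0); rewrite !mxE !mulr1.
Qed.

Lemma s_constant_in_t u t : Q (pt2 u t) -> s (Th (pt2 u t)) = s (Th (pt2 u 0)).
Proof.
move=> Qy; pose F (y : E2) : 'rV[R]_1 := s (Th y) *: const_mx 1.
have HF : Cinf Q F by exact: (Cinf_scale oQ (Cinf_pullback Hs) (Cinf_cst _ _)).
have : F (pt2 u t) = F (pt2 u 0).
  apply: constant_in_t => // y' Qy'; have [_ d1] := pullback Hs Qy'.
  have [_ ->] := is_derive_scale d1 (is_derive_cst (const_mx 1 : 'rV[R]_1) y' (delta_mx 0 1)).
  by rewrite D2s ?mulr0 ?scale0r ?scaler0 ?addr0//; exact: QU.
by move/rowP/(_ 0); rewrite !mxE !mulr1.
Qed.

(* X - n / k is constant along T2 *)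
Lemma parametrization u t : Q (pt2 u t) ->
  X (Th (pt2 u t)) = X (Th (pt2 u 0)) +
    (k (Th (pt2 u 0)))^-1 *: (sinh t *: e2 q0 + (cosh t - 1) *: n q0).
Proof.
move=> Qy; have Q0 := Q_base Qy.
have Hki : Cinf U (fun q => (k q)^-1).
  by apply: (Cinf_inv_comp oU Hk) => q /k_gt0; exact: lt0r_neq0.
have Hkn := Cinf_scale oU Hki Hn.
have HZ : Cinf U (fun q => X q - (k q)^-1 *: n q) by exact: (Cinf_sub_fun oU HX Hkn).
have E : X (Th (pt2 u t)) - (k (Th (pt2 u t)))^-1 *: n (Th (pt2 u t)) =
   X (Th (pt2 u 0)) - (k (Th (pt2 u 0)))^-1 *: n (Th (pt2 u 0)).
  apply: (@constant_in_t _ (fun y => X (Th y) - (k (Th y))^-1 *: n (Th y))) => //.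
    exact: (Cinf_pullback_rV HZ).
  move=> y Qy'; have Uy := QU Qy'; have [_ [_ ->]] := pullback_rV HZ Qy'.
  have k0 : k (Th y) != 0 by rewrite lt0r_neq0// k_gt0.
  (* Obtained by differentiating k k^-1 = 1, as k is constant along T2. *)
  have ki0 : along T2 (fun q => (k q)^-1) (Th y) = 0.
    have kk q : U q -> k q * (k q)^-1 = 1 by move=> Uq; rewrite divff// lt0r_neq0// k_gt0.
    have := eq_along oU T2 kk Uy; rewrite along_cst (alongM T2 Hk Hki Uy) D2k// mulr0 addr0.
    by move/eqP; rewrite mulf_eq0 (negbTE k0) => /eqP.
  rewrite (alongB T2 HX Hkn Uy) (along_scale T2 Hki Hn Uy) ki0 scale0r add0r D2X// D2n//.
  by rewrite scalerA mulVf// scale1r subrr scaler0.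
have [_ nt] := hyperbolic_frame Qy; have [_ n0] := hyperbolic_frame Q0.
(* What remains is 1 / k times the difference of n at the parameters t and 0, which is the hyperbola
   of the formula. *)
move: E; rewrite k_constant_in_t// nt n0 !pt2_1 cosh0 sinh0 scale0r scale1r add0r.
move/(canRL (subrK _)) ->; rewrite -addrA; congr (_ + _).
by rewrite addrC -scalerBr scalerBl scale1r addrA.
Qed.

End consequences.

End AdaptedCoordinates.

(** * Structure equations of the adapted frame *)

(* For the surface, s = sqrt f, S = (3/4) E_1(f) / f and k is the function kappa-hat. *)
Record adapted_frame (R : realType) (U : set 'rV[R]_2) (T1 T2 : 'rV[R]_2 -> 'rV[R]_2)
    (X e1 e2 e3 e4 n : 'rV[R]_2 -> 'rV[R]_5) (s S k : 'rV[R]_2 -> R) (c : R) : Prop :=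
  AdaptedFrame {
    af_smooth : [/\ Cinf U T1, Cinf U T2, Cinf U X, Cinf U e1 & Cinf U e2] /\
      [/\ Cinf U e3, Cinf U e4, Cinf U n, Cinf U s & Cinf U S] /\ Cinf U k;
    af_gt0 : forall q, U q -> [/\ 0 < s q, 0 < S q & 0 < k q];
    af_frame : forall q, U q -> orthoframe (e1 q) (e2 q) (e3 q) (e4 q) (X q);
    af_n : forall q, U q ->
      [/\ mink (n q) (n q) = -1, mink (n q) (e2 q) = 0 & mink (X q) (n q) = - (k q)^-1];
    af_X : forall q, U q -> along T1 X q = e1 q /\ along T2 X q = e2 q;
    af_scalars : forall q, U q -> [/\ along T1 s q = 2 / 3 * s q * S q, along T2 s q = 0,
      along T1 k q = S q * k q & along T2 k q = 0];
    af_e1 : forall q, U q ->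
      along T1 e1 q = - s q ^+ 2 *: e3 q + (c * s q ^+ 3) *: e4 q + X q;
    af_e2 : forall q, U q -> along T1 e2 q = 0 /\
      along T2 e2 q = S q *: e1 q + (3 * s q ^+ 2) *: e3 q - (c * s q ^+ 3) *: e4 q + X q;
    af_e34 : forall q, U q -> along T1 e3 q = s q ^+ 2 *: e1 q /\
      along T1 e4 q = - (c * s q ^+ 3) *: e1 q;
    af_e2n : forall q, U q -> along T2 e2 q = k q *: n q;
    af_dn : forall q, U q -> along T1 n q = 0 /\ along T2 n q = k q *: e2 q }.

Section Structure.
Context {R : realType}.
Local Notation E2 := 'rV[R]_2.
Local Notation E5 := 'rV[R]_5.

Variables (U : set E2) (T1 T2 : E2 -> E2) (X e1 e2 e3 e4 : E2 -> E5) (s S : E2 -> R) (c C : R).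
Hypotheses (D1X : along T1 X = e1) (D2X : along T2 X = e2).
Hypotheses (oU : open U) (HT1 : Cinf U T1) (HT2 : Cinf U T2).
Hypotheses (HX : Cinf U X) (He3 : Cinf U e3) (He4 : Cinf U e4) (Hs : Cinf U s) (HS : Cinf U S).
Hypothesis fr : forall q, U q -> orthoframe (e1 q) (e2 q) (e3 q) (e4 q) (X q).
Hypothesis immX : forall q v, U q -> 'D_v X q = 0 -> v = 0.
Hypothesis tangent3 : forall q v, U q -> mink ('D_v X q) (e3 q) = 0.
Hypothesis tangent4 : forall q v, U q -> mink ('D_v X q) (e4 q) = 0.
Hypothesis parallel3 : forall q, U q ->
  mink (along T1 e3 q) (e4 q) = 0 /\ mink (along T2 e3 q) (e4 q) = 0.
Hypothesis shape4 : forall q, U q ->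
  [/\ mink (along T1 e1 q) (e4 q) = c * s q ^+ 3, mink (along T2 e1 q) (e4 q) = 0,
      mink (along T1 e2 q) (e4 q) = 0 & mink (along T2 e2 q) (e4 q) = - (c * s q ^+ 3)].
Hypothesis trace3 : forall q, U q ->
  mink (along T1 e1 q) (e3 q) + mink (along T2 e2 q) (e3 q) = 2 * s q ^+ 2.
Hypothesis s_gt0 : forall q, U q -> 0 < s q.
Hypothesis S_gt0 : forall q, U q -> 0 < S q.
Hypothesis S_sqr : forall q, U q ->
  S q ^+ 2 = 1 + 9 * C * s q ^+ 3 - 9 * s q ^+ 4 - c ^+ 2 * s q ^+ 6.
Hypothesis s_along1 : forall q, U q -> along T1 s q = 2 / 3 * s q * S q.
Hypothesis s_along2 : forall q, U q -> along T2 s q = 0.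
Hypothesis c0 : c != 0.

Let He1 : Cinf U e1. Proof. by rewrite -D1X; exact: (Cinf_along oU). Qed.
Let He2 : Cinf U e2. Proof. by rewrite -D2X; exact: (Cinf_along oU). Qed.

(** w1 and w2 are the products of the derivatives of E_1 along E_1 and E_2 with E_2; A_3 has the
    entries a, b, b, d and A_4 = diag(g, - g). They are variables with defining equations, so they
    remain atoms in the algebra. *)
Variables (w1 w2 a b d g : E2 -> R).
Hypotheses (w1E : forall q, w1 q = mink (along T1 e1 q) (e2 q))
  (w2E : forall q, w2 q = mink (along T2 e1 q) (e2 q))
  (aE : forall q, a q = mink (along T1 e1 q) (e3 q))
  (bE : forall q, b q = mink (along T1 e2 q) (e3 q))
  (dE : forall q, d q = mink (along T2 e2 q) (e3 q))
  (gE : forall q, g q = c * s q ^+ 3).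

Let Hg : Cinf U g.
Proof.
apply: (eq_Cinf oU _ (Cinf_mul oU (Cinf_cst _ c) (Cinf_exp_comp oU 3 Hs))).
by move=> q _; rewrite gE.
Qed.
Let Ha : Cinf U a.
Proof.
by apply: (eq_Cinf oU _ (Cinf_mink oU (Cinf_along oU HT1 He1) He3)) => q _; rewrite aE.
Qed.
Let Hd : Cinf U d.
Proof.
by apply: (eq_Cinf oU _ (Cinf_mink oU (Cinf_along oU HT2 He2) He3)) => q _; rewrite dE.
Qed.

Lemma derive_tangent q v : U q ->
  'D_v X q = mink ('D_v X q) (e1 q) *: e1 q + mink ('D_v X q) (e2 q) *: e2 q.
Proof.
move=> Uq; have F := fr Uq.
have XX p : U p -> mink (X p) (X p) = -1 by move=> /fr[[_ _ _ _ ->]].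
have vX : mink ('D_v X q) (X q) = 0.
  have := along_skew oU (fun=> v) HX HX Uq XX; rewrite alongE.
  by move: (mink _ _) => z zE; lra.
rewrite [LHS](orthoframe_expand _ F) tangent3// tangent4// vX.
by rewrite !scale0r subr0 !addr0.
Qed.

(* The Levi-Civita connection is torsion free. *)
Lemma bracket_frame q : U q ->
  along T1 T2 q - along T2 T1 q =
    mink (along T1 e2 q) (e1 q) *: T1 q - mink (along T2 e1 q) (e2 q) *: T2 q.
Proof.
move=> Uq; set w := _ - _; have [_ [h12 _ _ _] _ _] := fr Uq.
have [[h11 h22 _ _ _] _ _ _] := fr Uq.
have Dw : 'D_w X q = along T1 e2 q - along T2 e1 q.
  by rewrite -D1X -D2X; exact: (esym (along_commutator oU HT1 HT2 HX Uq)).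
have E11 p : U p -> mink (e1 p) (e1 p) = 1 by move=> /fr[[->]].
have E22 p : U p -> mink (e2 p) (e2 p) = 1 by move=> /fr[[_ ->]].
have s1 := along_skew oU T2 He1 He1 Uq E11.
have s2 := along_skew oU T1 He2 He2 Uq E22.
have tw := derive_tangent w Uq.
rewrite Dw !minkBl in tw.
have z1 : mink (along T2 e1 q) (e1 q) = 0 by move: s1; move: (mink _ _) => z ?; lra.
have z2 : mink (along T1 e2 q) (e2 q) = 0 by move: s2; move: (mink _ _) => z ?; lra.
rewrite z1 z2 subr0 sub0r scaleNr in tw.
apply/eqP; rewrite -subr_eq0; apply/eqP; apply: (immX Uq).
have lin := dir_linear oU (mink (along T1 e2 q) (e1 q)) (- mink (along T2 e1 q) (e2 q))
  (T1 q) (T2 q) HX Uq.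
rewrite !scaleNr -(alongE T1) -(alongE T2) D1X D2X in lin.
rewrite (dirB oU _ _ HX Uq) Dw tw; apply/eqP; rewrite subr_eq0; apply/eqP.
by rewrite lin.
Qed.

(** Flatness and the torsion-free bracket in one formula. Applied to s, e4, e3 and e2 it gives in
    turn w1 = 0, the equations of A_4, the Codazzi equation of A_3 and the Gauss equation. *)
Lemma frame_commutator m (F : E2 -> 'rV[R]_m) q : Cinf U F -> U q ->
  along T1 (along T2 F) q - along T2 (along T1 F) q =
    - w1 q *: along T1 F q - w2 q *: along T2 F q.
Proof.
move=> HF Uq; have [_ [h12 _ _ _] _ _] := fr Uq.
have E21 p : U p -> mink (e1 p) (e2 p) = 0 by move=> /fr[_ [->]].
have s1 := along_skew oU T1 He1 He2 Uq E21.
apply: (etrans (along_commutator oU HT1 HT2 HF Uq)).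
rewrite (bracket_frame Uq) s1 -w1E -w2E.
have := dir_linear oU (- w1 q) (- w2 q) (T1 q) (T2 q) HF Uq.
by rewrite (scaleNr (w2 q) (T2 q)) (scaleNr (w2 q) (along _ _ _)).
Qed.

(** The bracket of T1 and T2 is mapped to a tangent vector, orthogonal to e3; hence A_3 is
    symmetric. *)
Lemma second_form_sym3 q : U q -> mink (along T2 e1 q) (e3 q) = b q.
Proof.
move=> Uq; have E := along_commutator oU HT1 HT2 HX Uq; rewrite bE.
have := tangent3 (along T1 T2 q - along T2 T1 q) Uq.
rewrite -E D1X D2X minkBl => /eqP; rewrite subr_eq0 => /eqP ->.
by [].
Qed.

Lemma along_monomial T (k : R) n q : U q ->
  along T (fun p => k * s p ^+ n.+1) q = k * (n.+1%:R * s q ^+ n * along T s q).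
Proof.
move=> Uq; rewrite (alongMl T k (Cinf_exp_comp oU n.+1 Hs) Uq).
by rewrite (alongX oU T n Hs Uq).
Qed.

(** Differentiating the squared equation keeps the computation polynomial; S > 0 permits the
    division by 2 S afterwards. *)
Lemma S_sqr_along T q : U q ->
  2 * S q * along T S q =
    (27 * C * s q ^+ 2 - 36 * s q ^+ 3 - 6 * c ^+ 2 * s q ^+ 5) * along T s q.
Proof.
move=> Uq.
have Hk k m : Cinf U (fun p => k * s p ^+ m).
  exact: (Cinf_mul oU (Cinf_cst _ k) (Cinf_exp_comp oU m Hs)).
have := eq_along oU T S_sqr Uq; rewrite (alongX oU T 1 HS Uq).
have H1 := Cinf_add oU (Cinf_cst U (1:R)) (Hk (9 * C) 3%N).
have H2 := Cinf_sub_fun oU H1 (Hk 9 4%N).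
rewrite (alongB T H2 (Hk _ _) Uq) (alongB T H1 (Hk _ _) Uq).
rewrite (alongD T (Cinf_cst U (1:R)) (Hk _ _) Uq) along_cst !along_monomial//.
rewrite expr1 => ->; move: (s q) (along T s q) => x y; ring.
Qed.

Lemma S_along2 q : U q -> along T2 S q = 0.
Proof.
move=> Uq; have := S_sqr_along T2 Uq; rewrite s_along2// mulr0.
by move/eqP; rewrite !mulf_eq0 pnatr_eq0 /= gt_eqF ?S_gt0// => /eqP.
Qed.

Lemma S_along1 q : U q ->
  along T1 S q = 9 * C * s q ^+ 3 - 12 * s q ^+ 4 - 2 * c ^+ 2 * s q ^+ 6.
Proof.
move=> Uq; have := S_sqr_along T1 Uq; rewrite s_along1// => E.
have S0 : 2 * S q != 0 by rewrite mulf_neq0 ?pnatr_eq0// gt_eqF ?S_gt0.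
apply: (mulfI S0); rewrite E; move: (s q) (S q) => x y; by field.
Qed.

Lemma g_along T q : U q -> along T g q = 3 * c * s q ^+ 2 * along T s q.
Proof.
move=> Uq; rewrite (eq_along oU T (G := fun p => c * s p ^+ 3) _ Uq); last by move=> p _.
by rewrite along_monomial//; move: (s q) (along _ _ _) => x y; ring.
Qed.

Lemma g_along1 q : U q -> along T1 g q = 2 * S q * g q.
Proof.
by move=> Uq; rewrite g_along// s_along1// gE; move: (s q) (S q) => x y; by field.
Qed.

Lemma g_along2 q : U q -> along T2 g q = 0.
Proof. by move=> Uq; rewrite g_along// s_along2// mulr0. Qed.

(** In the commutator on s both mixed derivatives vanish, because E_2 kills s and S; what is left is
    w1 times E_1 s, which is positive. A constant vector of length 1 turns s into a vector-valued
    function. *)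
Lemma w1_eq0 q : U q -> w1 q = 0.
Proof.
move=> Uq; pose v : 'rV[R]_1 := const_mx 1.
have HF : Cinf U (fun p => s p *: v) by exact: (Cinf_scale oU Hs (Cinf_cst _ _)).
have aF T p : U p -> along T (fun p => s p *: v) p = along T s p *: v.
  by move=> Up; rewrite (along_scale T Hs (Cinf_cst _ _) Up) along_cst scaler0 addr0.
have := frame_commutator HF Uq.
have -> : along T1 (along T2 (fun p => s p *: v)) q = 0.
  rewrite (eq_along oU T1 (G := fun=> 0) _ Uq) ?along_cst// => p Up.
  by rewrite aF// s_along2// scale0r.
have -> : along T2 (along T1 (fun p => s p *: v)) q = 0.
  have H := Cinf_mul oU Hs HS.
  rewrite (eq_along oU T2 (G := fun p => (2 / 3 * (s p * S p)) *: v) _ Uq).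
    rewrite (along_scale T2 (Cinf_mul oU (Cinf_cst _ _) H) (Cinf_cst _ _) Uq) along_cst scaler0 addr0.
    rewrite (alongMl T2 _ H Uq) (alongM T2 Hs HS Uq) S_along2// s_along2//.
    by rewrite !mulr0 addr0 mulr0 scale0r.
  by move=> p Up; rewrite aF// s_along1// mulrA.
rewrite !aF// s_along1// s_along2// scale0r scaler0 !subr0 => /rowP/(_ 0).
rewrite !mxE mulr1 => /eqP; rewrite eq_sym mulf_eq0 oppr_eq0 => /orP[/eqP//|].
by rewrite !mulf_eq0 !gt_eqF ?S_gt0 ?s_gt0// ?divr_gt0.
Qed.

Lemma frame_skew T q : U q ->
  [/\ [/\ mink (along T e1 q) (e1 q) = 0, mink (along T e2 q) (e2 q) = 0,
          mink (along T e3 q) (e3 q) = 0, mink (along T e4 q) (e4 q) = 0 &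
          mink (along T X q) (X q) = 0],
      [/\ mink (along T e2 q) (e1 q) = - mink (along T e1 q) (e2 q),
          mink (along T e3 q) (e1 q) = - mink (along T e1 q) (e3 q),
          mink (along T e4 q) (e1 q) = - mink (along T e1 q) (e4 q) &
          mink (along T e1 q) (X q) = - mink (along T X q) (e1 q)],
      [/\ mink (along T e3 q) (e2 q) = - mink (along T e2 q) (e3 q),
          mink (along T e4 q) (e2 q) = - mink (along T e2 q) (e4 q) &
          mink (along T e2 q) (X q) = - mink (along T X q) (e2 q)] &
      [/\ mink (along T e4 q) (e3 q) = - mink (along T e3 q) (e4 q),
          mink (along T e3 q) (X q) = 0 & mink (along T e4 q) (X q) = 0]].
Proof.
move=> Uq.
have t3 := tangent3 (T q) Uq; have t4 := tangent4 (T q) Uq.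
rewrite -alongE in t3; rewrite -alongE in t4.
have self F k : Cinf U F -> (forall p, U p -> mink (F p) (F p) = k) ->
    mink (along T F q) (F q) = 0.
  move=> HF Fk; have := along_skew oU T HF HF Uq Fk.
  by move: (mink _ _) => z ?; lra.
have frp p (Up : U p) := fr Up.
split; split.
- by apply: (self _ 1) => // p /frp[[]].
- by apply: (self _ 1) => // p /frp[[]].
- by apply: (self _ 1) => // p /frp[[]].
- by apply: (self _ 1) => // p /frp[[]].
- by apply: (self _ (-1)) => // p /frp[[]].
- by apply: (along_skew oU T He1 He2 Uq (a := 0)) => p /frp[_ []].
- by apply: (along_skew oU T He1 He3 Uq (a := 0)) => p /frp[_ []].
- by apply: (along_skew oU T He1 He4 Uq (a := 0)) => p /frp[_ []].
- by apply: (along_skew oU T HX He1 Uq (a := 0)) => p /frp[_ [_ _ _]]; rewrite minkC.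
- by apply: (along_skew oU T He2 He3 Uq (a := 0)) => p /frp[_ _ []].
- by apply: (along_skew oU T He2 He4 Uq (a := 0)) => p /frp[_ _ []].
- by apply: (along_skew oU T HX He2 Uq (a := 0)) => p /frp[_ _ [_ _]]; rewrite minkC.
- by apply: (along_skew oU T He3 He4 Uq (a := 0)) => p /frp[_ _ _ []].
- rewrite (along_skew oU T HX He3 Uq (a := 0)) ?t3 ?oppr0// => p /frp[_ _ _ [_ + _]].
  by rewrite minkC.
- rewrite (along_skew oU T HX He4 Uq (a := 0)) ?t4 ?oppr0// => p /frp[_ _ _ [_ _]].
  by rewrite minkC.
Qed.

(** Expansion in the frame, with w1 = 0. The term X comes from <D_{E_1} e_1, X> = - <e_1, e_1>, i.e.
    from the second fundamental form of the hyperboloid. *)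
Lemma structure1 q : U q ->
  [/\ along T1 e1 q = a q *: e3 q + g q *: e4 q + X q,
      along T1 e2 q = b q *: e3 q,
      along T1 e3 q = - a q *: e1 q - b q *: e2 q &
      along T1 e4 q = - g q *: e1 q].
Proof.
move=> Uq; have F := fr Uq.
have [[h11 h22 _ _ _] [h12 _ _ _] _ _] := F.
have [[k11 k22 k33 k44 kXX] [k21 k31 k41 k1X] [k32 k42 k2X] [k43 k3X k4X]] := frame_skew T1 Uq.
rewrite D1X h11 h12 in k1X k2X.
have [g1 _ g2 _] := shape4 Uq; have [p1 _] := parallel3 Uq.
rewrite -w1E w1_eq0// oppr0 in k21; rewrite -aE in k31; rewrite -bE in k32.
rewrite g1 -gE in k41; rewrite g2 oppr0 in k42; rewrite p1 oppr0 in k43.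
split; rewrite [LHS](orthoframe_expand _ F).
- by rewrite k11 -w1E w1_eq0// -aE g1 -gE k1X !scale0r !add0r scaleN1r opprK.
- by rewrite k21 k22 -bE g2 k2X oppr0 !scale0r !add0r addr0 subr0.
- by rewrite k31 k32 k33 p1 k3X !scale0r !addr0 subr0 !scaleNr.
- by rewrite k41 k42 k43 k44 k4X !scale0r !addr0 subr0.
Qed.

Lemma structure2 q : U q ->
  [/\ along T2 e1 q = w2 q *: e2 q + b q *: e3 q,
      along T2 e2 q = - w2 q *: e1 q + d q *: e3 q - g q *: e4 q + X q,
      along T2 e3 q = - b q *: e1 q - d q *: e2 q &
      along T2 e4 q = g q *: e2 q].
Proof.
move=> Uq; have F := fr Uq.
have [[h11 h22 _ _ _] [h12 _ _ _] _ _] := F.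
have [[k11 k22 k33 k44 kXX] [k21 k31 k41 k1X] [k32 k42 k2X] [k43 k3X k4X]] := frame_skew T2 Uq.
rewrite D2X (minkC (e2 q)) h12 oppr0 in k1X; rewrite D2X h22 in k2X.
have [_ g1 _ g2] := shape4 Uq; have [_ p1] := parallel3 Uq.
have s3 := second_form_sym3 Uq.
rewrite -w2E in k21; rewrite s3 in k31; rewrite -dE in k32.
rewrite g1 oppr0 in k41; rewrite g2 opprK -gE in k42; rewrite p1 oppr0 in k43.
split; rewrite [LHS](orthoframe_expand _ F).
- by rewrite k11 -w2E s3 g1 k1X !scale0r add0r addr0 subr0.
- by rewrite k21 k22 -dE g2 -gE k2X !scale0r addr0 scaleN1r opprK !scaleNr.
- by rewrite k31 k32 k33 p1 k3X !scale0r !addr0 subr0 !scaleNr.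
- by rewrite k41 k42 k43 k44 k4X !scale0r add0r !addr0 subr0.
Qed.

Lemma g_neq0 q : U q -> g q != 0.
Proof. by move=> Uq; rewrite gE mulf_neq0// expf_neq0// gt_eqF ?s_gt0. Qed.

(* The commutator applied to e4 is the Ricci and Codazzi equations of A_4. *)
Lemma ricci_codazzi4 q : U q -> b q = 0 /\ w2 q = - S q.
Proof.
move=> Uq; have g0 := g_neq0 Uq.
have E1 : along T1 (along T2 e4) q = along T1 g q *: e2 q + g q *: along T1 e2 q.
  rewrite -(along_scale T1 Hg He2 Uq); apply: (eq_along oU _ _ Uq) => p Up.
  by have [] := structure2 Up.
have E2 : along T2 (along T1 e4) q = - along T2 g q *: e1 q - g q *: along T2 e1 q.
  have Hng := Cinf_opp oU Hg.
  have -> : along T2 (along T1 e4) q = along T2 (fun p => - g p *: e1 p) q.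
    by apply: (eq_along oU _ _ Uq) => p Up; have [] := structure1 Up.
  by rewrite (along_scale T2 Hng He1 Uq) (alongN T2 Hg Uq) !scaleNr.
have E := frame_commutator He4 Uq.
rewrite E1 E2 g_along1// g_along2// w1_eq0// oppr0 !scale0r !sub0r opprK in E.
have [_ T1e2 _ _] := structure1 Uq; have [T2e1 _ _ T2e4] := structure2 Uq.
rewrite T1e2 T2e1 T2e4 in E.
have [[h11 h22 h33 _ _] [h12 h13 _ _] [h23 _ _] _] := fr Uq.
(* The e3-component reads 2 g b = 0 and the e2-component 2 g (S + w2) = 0, where g is non-zero. *)
have F3 := congr1 (fun v => mink v (e3 q)) E.
rewrite /= !minkE h23 h33 in F3.
have F2 := congr1 (fun v => mink v (e2 q)) E.
rewrite /= !minkE (minkC (e3 q)) h23 h22 in F2.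
have b0 : b q = 0.
  by apply: (mulfI g0); move: F3; move: (g q) (b q) (w2 q) (S q) => x y z t ?; lra.
split=> //; apply: (mulfI g0).
by move: F2; move: (g q) (w2 q) (S q) => x z t ?; lra.
Qed.

Lemma along1_e2 q : U q -> along T1 e2 q = 0.
Proof.
by move=> Uq; have [_ -> _ _] := structure1 Uq; have [-> _] := ricci_codazzi4 Uq; rewrite scale0r.
Qed.

Lemma along2_e1 q : U q -> along T2 e1 q = - S q *: e2 q.
Proof.
move=> Uq; have [-> _ _ _] := structure2 Uq; have [-> ->] := ricci_codazzi4 Uq.
by rewrite scale0r addr0.
Qed.

(** The e2-component of the commutator on e3, with b = 0 and w2 = - S. *)
Lemma codazzi3 q : U q -> along T1 d q = - S q * (a q - d q).
Proof.
move=> Uq; have [b0 w2S] := ricci_codazzi4 Uq.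
have E1 : along T1 (along T2 e3) q = - along T1 d q *: e2 q.
  have Hnd := Cinf_opp oU Hd.
  have -> : along T1 (along T2 e3) q = along T1 (fun p => - d p *: e2 p) q.
    apply: (eq_along oU _ _ Uq) => p Up; have [_ _ -> _] := structure2 Up.
    by have [-> _] := ricci_codazzi4 Up; rewrite oppr0 scale0r sub0r scaleNr.
  by rewrite (along_scale T1 Hnd He2 Uq) (alongN T1 Hd Uq) along1_e2// scaler0 addr0.
have E2 : along T2 (along T1 e3) q = - along T2 a q *: e1 q + (a q * S q) *: e2 q.
  have Hna := Cinf_opp oU Ha.
  have -> : along T2 (along T1 e3) q = along T2 (fun p => - a p *: e1 p) q.
    apply: (eq_along oU _ _ Uq) => p Up; have [_ _ -> _] := structure1 Up.
    by have [-> _] := ricci_codazzi4 Up; rewrite scale0r subr0.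
  rewrite (along_scale T2 Hna He1 Uq) (alongN T2 Ha Uq) along2_e1//.
  by rewrite scalerA mulrNN.
have E := frame_commutator He3 Uq.
have [_ _ T2e3 _] := structure2 Uq.
rewrite E1 E2 T2e3 b0 w1_eq0// w2S !oppr0 !scale0r !sub0r in E.
have [[h11 h22 _ _ _] [h12 _ _ _] _ _] := fr Uq.
have := congr1 (fun v => mink v (e2 q)) E.
rewrite /= !minkE h22 h12.
by move: (along T1 d q) (along T2 a q) (a q) (d q) (S q) => x y z t u ?; lra.
Qed.

(** The e1-component of the commutator on e2 reads a d = E_1 S - S^2 + g^2 + 1, and the first-order
    equation for s cancels everything except - 3 s^4. *)
Lemma gauss q : U q -> a q * d q = - 3 * s q ^+ 4.
Proof.
move=> Uq; have [b0 w2S] := ricci_codazzi4 Uq.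
have T2e2 p : U p -> along T2 e2 p = S p *: e1 p + d p *: e3 p - g p *: e4 p + X p.
  by move=> Up; have [_ -> _ _] := structure2 Up; have [_ ->] := ricci_codazzi4 Up; rewrite opprK.
have [T1e1 _ T1e3 T1e4] := structure1 Uq.
have E1 : along T1 (along T2 e2) q =
    (along T1 S q *: e1 q + S q *: along T1 e1 q) +
    (along T1 d q *: e3 q + d q *: along T1 e3 q) -
    (along T1 g q *: e4 q + g q *: along T1 e4 q) + e1 q.
  rewrite (eq_along oU T1 T2e2 Uq).
  have K1 := Cinf_scale oU HS He1; have K3 := Cinf_scale oU Hd He3.
  have K4 := Cinf_scale oU Hg He4; have K13 := Cinf_add oU K1 K3.
  rewrite (alongD T1 (Cinf_sub_fun oU K13 K4) HX Uq) (alongB T1 K13 K4 Uq) (alongD T1 K1 K3 Uq).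
  rewrite (along_scale T1 HS He1 Uq) (along_scale T1 Hd He3 Uq) (along_scale T1 Hg He4 Uq).
  by rewrite D1X.
have E2 : along T2 (along T1 e2) q = 0.
  by rewrite (eq_along oU T2 along1_e2 Uq) along_cst.
have E := frame_commutator He2 Uq.
rewrite E1 E2 T2e2// T1e1 T1e3 T1e4 b0 w1_eq0// w2S in E.
have [[h11 h22 _ _ _] [h12 h13 h14 h1X] _ _] := fr Uq.
have := congr1 (fun v => mink v (e1 q)) E.
rewrite /= !minkE h11 (minkC (e2 q)) h12 (minkC (e3 q)) h13 (minkC (e4 q)) h14 (minkC (X q)) h1X.
rewrite S_along1// => {}E.
have := S_sqr Uq; have gs := gE q; rewrite gs in E.
move: E; move: (along T1 d q) (along T1 g q) (a q) (d q) (s q) (S q) => x y z t u v E Sv.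
by move: E; rewrite -!expr2 ?Sv => E; nra.
Qed.

(** The Gauss equation and the trace give a quadratic in d with roots 3 s^2 and - s^2. The second
    root is impossible even at a single point, because the relation can be differentiated along E_1
    and compared there with the Codazzi equation. *)
Lemma principal_curvatures q : U q -> a q = - s q ^+ 2 /\ d q = 3 * s q ^+ 2.
Proof.
move=> Uq; have ad p (Up : U p) : a p = 2 * s p ^+ 2 - d p.
  by have := trace3 Up; rewrite -aE -dE => <-; rewrite addrK.
have P p : U p -> (2 * s p ^+ 2 - d p) * d p = - 3 * s p ^+ 4.
  by move=> Up; rewrite -ad// gauss.
suff dq : d q = 3 * s q ^+ 2.
  by split=> //; rewrite ad// dq; move: (s q ^+ 2) => x; ring.
have : (d q - 3 * s q ^+ 2) * (d q + s q ^+ 2) = 0.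
  by move: (P _ Uq); move: (d q) (s q) => x y ?; lra.
move=> /eqP; rewrite mulf_eq0 subr_eq0 => /orP[/eqP //|].
rewrite addr_eq0 => /eqP dq; exfalso.
(* With d = - s^2 and a = 3 s^2 the derivative of a d would be - (56 / 3) s^4 S, whereas that of - 3
   s^4 is - 8 s^4 S. *)
have H2 : Cinf U (fun p => 2 * s p ^+ 2).
  exact: (Cinf_mul oU (Cinf_cst _ _) (Cinf_exp_comp oU 2 Hs)).
have := eq_along oU T1 P Uq.
rewrite (alongM T1 (Cinf_sub_fun oU H2 Hd) Hd Uq) (alongB T1 H2 Hd Uq) !along_monomial//.
rewrite codazzi3// ad// dq s_along1//.
have := s_gt0 Uq; have := S_gt0 Uq; move: (s q) (S q) => x y y0 x0 E.
have : 0 < x ^+ 4 * y by rewrite mulr_gt0// exprn_gt0.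
by move: E; rewrite expr1 => ? ?; lra.
Qed.

(** * The timelike unit field n = V / k *)

Variables (k : E2 -> R) (n : E2 -> E5).
Hypotheses (Hk : Cinf U k) (k_gt0 : forall q, U q -> 0 < k q).
Hypothesis k_sqr : forall q, U q -> k q ^+ 2 = - 9 * C * s q ^+ 3.
Hypothesis nE : n = fun q => (k q)^-1 *: along T2 e2 q.

Let HV : Cinf U (along T2 e2). Proof. exact: (Cinf_along oU). Qed.
Let Hk' : Cinf U (fun q => (k q)^-1).
Proof. by apply: (Cinf_inv_comp oU Hk) => q /k_gt0; exact: lt0r_neq0. Qed.

Lemma Cinf_n : Cinf U n.
Proof. by rewrite nE; exact: (Cinf_scale oU Hk' HV). Qed.

Lemma along2_e2E q : U q -> along T2 e2 q =
  S q *: e1 q + (3 * s q ^+ 2) *: e3 q - g q *: e4 q + X q.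
Proof.
move=> Uq; have [_ -> _ _] := structure2 Uq; have [_ ->] := ricci_codazzi4 Uq.
by have [_ ->] := principal_curvatures Uq; rewrite opprK.
Qed.

Lemma along2_e2 q : U q -> along T2 e2 q = k q *: n q.
Proof. by move=> Uq; rewrite nE scalerA divff ?scale1r// gt_eqF ?k_gt0. Qed.

Lemma k_along T q : U q -> 2 * k q * along T k q = - 27 * C * s q ^+ 2 * along T s q.
Proof.
move=> Uq; have := eq_along oU T k_sqr Uq.
rewrite (alongX oU T 1 Hk Uq) expr1 => ->.
by rewrite along_monomial//; move: (s q) (along _ _ _) => x y; ring.
Qed.

Lemma k_along1 q : U q -> along T1 k q = S q * k q.
Proof.
move=> Uq; have k0 : 2 * k q != 0 by rewrite mulf_neq0 ?pnatr_eq0// gt_eqF ?k_gt0.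
apply: (mulfI k0); rewrite k_along// s_along1//.
have -> : 2 * k q * (S q * k q) = 2 * S q * k q ^+ 2.
  by move: (k q) (S q) => x y; ring.
by rewrite k_sqr//; move: (s q) (S q) => x y; field.
Qed.

Lemma k_along2 q : U q -> along T2 k q = 0.
Proof.
move=> Uq; have := k_along T2 Uq; rewrite s_along2// mulr0.
by move/eqP; rewrite !mulf_eq0 pnatr_eq0 /= gt_eqF ?k_gt0// => /eqP.
Qed.

(** In the commutator on e2 the terms with D_{E_1} e_2 vanish, and only the bracket term - w2 V = S
    V remains. *)
Lemma along1_V q : U q -> along T1 (along T2 e2) q = S q *: along T2 e2 q.
Proof.
move=> Uq; have := frame_commutator He2 Uq.
have [_ ->] := ricci_codazzi4 Uq.
by rewrite (eq_along oU T2 along1_e2 Uq) along_cst along1_e2// scaler0 subr0 sub0r scaleNr opprK.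
Qed.

(** The coefficients of V are constant along E_2, so only the frame is differentiated. Every term is
    a multiple of e2, and the coefficients add up to 1 - S^2 - 9 s^4 - g^2 = - 9 C s^3 = k^2. *)
Lemma along2_V q : U q -> along T2 (along T2 e2) q = k q ^+ 2 *: e2 q.
Proof.
move=> Uq; have [b0 w2S] := ricci_codazzi4 Uq; have [_ dq] := principal_curvatures Uq.
have [_ _ T2e3 T2e4] := structure2 Uq.
rewrite (eq_along oU T2 along2_e2E Uq).
have H2 : Cinf U (fun p => 3 * s p ^+ 2).
  exact: (Cinf_mul oU (Cinf_cst _ _) (Cinf_exp_comp oU 2 Hs)).
have K1 := Cinf_scale oU HS He1; have K3 := Cinf_scale oU H2 He3.
have K4 := Cinf_scale oU Hg He4; have K13 := Cinf_add oU K1 K3.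
rewrite (alongD T2 (Cinf_sub_fun oU K13 K4) HX Uq) (alongB T2 K13 K4 Uq) (alongD T2 K1 K3 Uq).
rewrite (along_scale T2 HS He1 Uq) (along_scale T2 H2 He3 Uq) (along_scale T2 Hg He4 Uq).
rewrite D2X along_monomial// s_along2// S_along2// g_along2// !mulr0 !scale0r !add0r.
rewrite along2_e1// T2e3 T2e4 b0 dq oppr0 scale0r sub0r !scalerA.
rewrite -scaleNr scalerA -scalerDl -scalerBl -[X in _ + X]scale1r -scalerDl.
congr (_ *: _); rewrite k_sqr//; have := S_sqr Uq; rewrite gE.
by move: (s q) (S q) => x y E; rewrite mulrN -expr2 E; ring.
Qed.

Lemma along1_n q : U q -> along T1 n q = 0.
Proof.
move=> Uq; have k0 : k q != 0 by rewrite gt_eqF ?k_gt0.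
have : along T1 (fun p => k p *: n p) q = S q *: along T2 e2 q.
  by rewrite -along1_V//; apply: (eq_along oU _ _ Uq) => p Up; rewrite along2_e2.
rewrite (along_scale T1 Hk Cinf_n Uq) k_along1// along2_e2// scalerA.
by rewrite addrC => /eqP; rewrite -subr_eq0 addrK scaler_eq0 (negbTE k0) => /eqP.
Qed.

Lemma along2_n q : U q -> along T2 n q = k q *: e2 q.
Proof.
move=> Uq; have k0 : k q != 0 by rewrite gt_eqF ?k_gt0.
have : along T2 (fun p => k p *: n p) q = k q ^+ 2 *: e2 q.
  by rewrite -along2_V//; apply: (eq_along oU _ _ Uq) => p Up; rewrite along2_e2.
rewrite (along_scale T2 Hk Cinf_n Uq) k_along2// scale0r add0r expr2 -scalerA.
by move/(scalerI k0).
Qed.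

(** The same relation as for the second derivative of e2: S^2 + 9 s^4 + g^2 - 1 = - k^2. *)
Lemma mink_nn q : U q -> mink (n q) (n q) = -1.
Proof.
move=> Uq; have k0 : k q != 0 by rewrite gt_eqF ?k_gt0.
have [[h11 h22 h33 h44 hXX] [h12 h13 h14 h1X] [h23 h24 h2X] [h34 h3X h4X]] := fr Uq.
have : mink (k q *: n q) (k q *: n q) = - k q ^+ 2.
  rewrite -along2_e2// along2_e2E// !minkE h11 h13 h14 h1X.
  rewrite (minkC (e3 q) (e1 q)) h13 h33 h34 h3X.
  rewrite (minkC (e4 q) (e1 q)) (minkC (e4 q) (e3 q)) h14 h34 h44 h4X.
  rewrite (minkC (X q) (e1 q)) (minkC (X q) (e3 q)) (minkC (X q) (e4 q)) h1X h3X h4X hXX.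
  rewrite k_sqr// gE; have := S_sqr Uq; move: (s q) (S q) => x y E.
  by transitivity (y ^+ 2 + 9 * x ^+ 4 + (c * x ^+ 3) ^+ 2 - 1); [ring|rewrite E; ring].
rewrite !minkE mulrA -expr2 => E.
by apply: (mulfI (expf_neq0 2 k0)); rewrite E mulrN1.
Qed.

(** V has component 1 on X, so <X, V> = - 1; this is the source of the condition on the product of
    the base curve with b2. *)
Lemma mink_n_frame q : U q ->
  [/\ mink (n q) (e2 q) = 0, mink (X q) (n q) = - (k q)^-1 & mink (e1 q) (n q) = S q / k q].
Proof.
move=> Uq; have k0 : k q != 0 by rewrite gt_eqF ?k_gt0.
have [[h11 h22 h33 h44 hXX] [h12 h13 h14 h1X] [h23 h24 h2X] [h34 h3X h4X]] := fr Uq.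
rewrite nE !minkE along2_e2E//; split.
- by rewrite !minkE h12 (minkC (e3 q)) h23 (minkC (e4 q)) h24 (minkC (X q)) h2X !mulr0 subr0 !addr0 mulr0.
- rewrite !minkE (minkC (X q) (e1 q)) (minkC (X q) (e3 q)) (minkC (X q) (e4 q)) h1X h3X h4X hXX.
  by rewrite !mulr0 subr0 !add0r mulrN1.
- by rewrite !minkE h11 h13 h14 h1X !mulr0 subr0 !addr0 mulr1 mulrC.
Qed.

Lemma adapted_frameP : adapted_frame U T1 T2 X e1 e2 e3 e4 n s S k c.
Proof.
split.
- by split; [split|split; [split|]] => //; exact: Cinf_n.
- by move=> q Uq; rewrite s_gt0// S_gt0// k_gt0.
- exact: fr.
- by move=> q Uq; have [n1 n2 _] := mink_n_frame Uq; rewrite mink_nn.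
- by move=> q _; rewrite D1X D2X.
- by move=> q Uq; rewrite s_along1// s_along2// k_along1// k_along2.
- move=> q Uq; have [-> _ _ _] := structure1 Uq; have [-> _] := principal_curvatures Uq.
  by rewrite gE.
- by move=> q Uq; rewrite along1_e2// along2_e2E// gE.
- move=> q Uq; have [_ _ -> ->] := structure1 Uq; have [-> _] := principal_curvatures Uq.
  by have [-> _] := ricci_codazzi4 Uq; rewrite opprK scale0r subr0 gE.
- exact: along2_e2.
- by move=> q Uq; rewrite along1_n// along2_n.
Qed.

End Structure.

(** * Geometry of an immersion *)

Lemma ord2_cases (i : 'I_2) : i = 0 \/ i = 1.
Proof. by case: i => -[|[|//]] ?; [left|right]; exact: val_inj. Qed.

Lemma det2 (R : comNzRingType) (A : 'M[R]_2) :
  \det A = A 0 0 * A 1 1 - A 0 1 * A 1 0.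
Proof.
have l01 : lift 0 0 = 1 :> 'I_2 by exact: val_inj.
have l10 : lift 1 0 = 0 :> 'I_2 by exact: val_inj.
rewrite (expand_det_row _ 0) big_ord_recl big_ord1 /cofactor !det_mx11.
rewrite !mxE !l01 !l10 /= expr0 expr1 mul1r mulN1r mulrN.
by [].
Qed.

Lemma det_col_mx2 (R : comNzRingType) (v w : 'rV[R]_2) :
  \det (col_mx v w : 'M[R]_2) = v 0 0 * w 0 1 - v 0 1 * w 0 0.
Proof.
have E0 j : (col_mx v w : 'M[R]_2) 0 j = v 0 j.
  by rewrite -[RHS](col_mxEu v w); congr (col_mx v w _ j); exact: val_inj.
have E1 j : (col_mx v w : 'M[R]_2) 1 j = w 0 j.
  by rewrite -[RHS](col_mxEd v w); congr (col_mx v w _ j); exact: val_inj.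
by rewrite det2 !E0 !E1.
Qed.

Section MatrixSmooth.
Context {R : realType} {V : normedModType R} (U : set V) (oU : open U).

Lemma Cinf_prod (I : finType) (F : I -> V -> R) :
  (forall i, Cinf U (F i)) -> Cinf U (fun x => \prod_i F i x).
Proof.
move=> H; rewrite unlock /=; elim: (index_enum I) => [|i s IH] /=; first exact: Cinf_cst.
exact: Cinf_mul.
Qed.

Lemma Cinf_det n (A : V -> 'M[R]_n) : (forall i j, Cinf U (fun x => A x i j)) ->
  Cinf U (fun x => \det (A x)).
Proof.
move=> H; apply: (Cinf_sum oU) => s; apply: (Cinf_mul oU (Cinf_cst _ _)).
by apply: Cinf_prod => i.
Qed.

Lemma Cinf_invmx n (A : V -> 'M[R]_n) i j : (forall i j, Cinf U (fun x => A x i j)) ->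
  (forall x, U x -> A x \in unitmx) -> Cinf U (fun x => invmx (A x) i j).
Proof.
move=> H uA.
have Hd := Cinf_det H.
have Hi : Cinf U (fun x => (\det (A x))^-1).
  by apply: (Cinf_inv_comp oU Hd) => x /uA; rewrite unitmxE unitfE.
have Ha : Cinf U (fun x => (\adj (A x)) i j).
  have Hc : Cinf U (fun x => (-1) ^+ (j + i) * \det (row' j (col' i (A x)))).
    apply: (Cinf_mul oU (Cinf_cst _ _)); apply: Cinf_det => k l.
    by apply: (eq_Cinf oU _ (H (lift j k) (lift i l))) => x _; rewrite !mxE.
  by apply: (eq_Cinf oU _ Hc) => x _; rewrite mxE.
apply: (eq_Cinf oU _ (Cinf_mul oU Hi Ha)) => x /uA Ax.
by rewrite /invmx Ax [RHS]mxE.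
Qed.

End MatrixSmooth.

Section ImmersionGeometry.
Context {R : realType}.
Local Notation E2 := 'rV[R]_2.
Local Notation E5 := 'rV[R]_5.
Variables (X : E2 -> E5) (U : set E2).
Hypotheses (oU : open U) (HX : Cinf U X).
Hypothesis XH4 : forall q, U q -> mink (X q) (X q) = -1.
Hypothesis immX : forall q v, U q -> 'D_v X q = 0 -> v = 0.

Lemma tangent_X q v : U q -> mink ('D_v X q) (X q) = 0.
Proof.
move=> Uq; have := along_skew oU (fun=> v) HX HX Uq XH4; rewrite alongE.
by move: (mink _ _) => z zE; lra.
Qed.

Lemma gdotE q v w : U q ->
  gdot X q v w = \sum_a \sum_b v 0 a * w 0 b * metric X q a b.
Proof.
move=> Uq; rewrite /gdot (derive_dir_rV v oU HX Uq) (derive_dir_rV w oU HX Uq) -/(pd _ X q).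
rewrite mink_suml; apply: eq_bigr => a _; rewrite mink_sumr; apply: eq_bigr => b _.
by rewrite !minkE mxE mulrA.
Qed.

Lemma gdotC q v w : gdot X q v w = gdot X q w v.
Proof. by rewrite /gdot; exact: minkC. Qed.

Lemma gdot_mx q v w : U q -> gdot X q v w = (v *m metric X q *m w^T) 0 0.
Proof.
move=> Uq; rewrite gdotE// -mulmxA mxE; apply: eq_bigr => a _.
by rewrite mxE big_distrr; apply: eq_bigr => b _; rewrite !mxE /= mulrAC mulrA.
Qed.

(** Tangent vectors are orthogonal to the timelike X, hence spacelike: the induced metric is
    positive definite. *)
Lemma gdot_gt0 q v : U q -> v != 0 -> 0 < gdot X q v v.
Proof.
move=> Uq v0; apply: (mink_orthogonal_timelike (XH4 Uq)); first exact: tangent_X.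
by apply: contra v0 => /eqP /(immX Uq) ->.
Qed.

Lemma metric_sym q a b : metric X q a b = metric X q b a.
Proof. by rewrite [LHS]mxE [RHS]mxE; exact: minkC. Qed.

Lemma metric_unit q : U q -> metric X q \in unitmx.
Proof.
move=> Uq; rewrite -row_free_unit -kermx_eq0; apply/rowV0P => v /sub_kermxP vM.
apply/eqP; apply: contraT => /(gdot_gt0 Uq).
by rewrite gdot_mx// vM mul0mx mxE ltxx.
Qed.

Lemma imetricK q : U q -> imetric X q *m metric X q = 1%:M.
Proof. by move=> Uq; rewrite mulVmx ?metric_unit. Qed.

Lemma imetric_sym q a b : imetric X q a b = imetric X q b a.
Proof.
have MT : (metric X q)^T = metric X q by apply/matrixP => i j; rewrite mxE metric_sym.
have IT : (invmx (metric X q))^T = invmx (metric X q) by rewrite trmx_inv MT.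
by rewrite /imetric -[in RHS]IT [RHS]mxE.
Qed.

Lemma Cinf_pd m (F : E2 -> 'rV[R]_m) a : Cinf U F -> Cinf U (pd a F).
Proof. exact: Cinf_derive. Qed.

Lemma Cinf_pd_real (f : E2 -> R) a : Cinf U f -> Cinf U (pd a f).
Proof. exact: Cinf_derive. Qed.

Lemma Cinf_metric a b : Cinf U (fun q => metric X q a b).
Proof.
apply: (eq_Cinf oU _ (Cinf_mink oU (Cinf_pd a HX) (Cinf_pd b HX))) => q _.
by rewrite mxE.
Qed.

Lemma Cinf_imetric a b : Cinf U (fun q => imetric X q a b).
Proof. exact: (Cinf_invmx oU _ _ Cinf_metric metric_unit). Qed.

Lemma Cinf_christoffel k a b : Cinf U (christoffel X k a b).
Proof.
have Hm a' b' c' : Cinf U (pd c' (fun r => metric X r a' b')).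
  exact: (Cinf_pd_real _ (Cinf_metric a' b')).
apply: (Cinf_mul oU (Cinf_cst _ _)); apply: (Cinf_sum oU) => l.
apply: (Cinf_mul oU (Cinf_imetric k l)).
exact: (Cinf_sub_fun oU (Cinf_add oU (Hm _ _ _) (Hm _ _ _)) (Hm _ _ _)).
Qed.

Lemma pd_metric a b c q : U q ->
  pd c (fun r => metric X r a b) q =
    mink (pd c (pd a X) q) (pd b X q) + mink (pd a X q) (pd c (pd b X) q).
Proof.
move=> Uq; have H d := Cinf_is_derive (delta_mx 0 c) (Cinf_pd d HX) Uq.
have -> : (fun r => metric X r a b) = (fun r => mink (pd a X r) (pd b X r)).
  by apply/funext => r; rewrite mxE.
exact: (@derive_val _ _ _ _ _ _ _ (is_derive_mink (H a) (H b))).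
Qed.

Lemma pd_comm a b q : U q -> pd a (pd b X) q = pd b (pd a X) q.
Proof. by move=> Uq; exact: (Cinf_derive_comm _ _ oU HX Uq). Qed.

Lemma pd_derive a v q : U q -> pd a ('D_v X) q = 'D_v (pd a X) q.
Proof. by move=> Uq; exact: (Cinf_derive_comm _ _ oU HX Uq). Qed.

Lemma derive_pd m (F : E2 -> 'rV[R]_m) q v : Cinf U F -> U q ->
  'D_v F q = \sum_a v 0 a *: pd a F q.
Proof. by move=> HF Uq; exact: (derive_dir_rV v oU HF Uq). Qed.

Lemma derive_pd_real (f : E2 -> R) q v : Cinf U f -> U q ->
  'D_v f q = \sum_a v 0 a * pd a f q.
Proof. by move=> Hf Uq; exact: (derive_dir v oU Hf Uq). Qed.

Lemma pd_tangent q xi c : (forall v, mink ('D_v X q) xi = 0) -> mink (pd c X q) xi = 0.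
Proof. by move=> H; exact: H. Qed.

Lemma pd_tangent_X q c : U q -> mink (pd c X q) (X q) = 0.
Proof. by move=> Uq; exact: tangent_X. Qed.

Opaque pd.

(* Koszul formula *)
Lemma christoffelE a b c q : U q ->
  \sum_(k < 2) (christoffel X k a b q * metric X q k c) = mink (pd a (pd b X) q) (pd c X q).
Proof.
move=> Uq.
pose K l := pd a (fun r => metric X r b l) q + pd b (fun r => metric X r a l) q
     - pd l (fun r => metric X r a b) q.
have KE : K c = 2 * mink (pd a (pd b X) q) (pd c X q).
  have lin (A B D x x' y y' z z' : R) : A = x + y -> B = x' + z -> D = y' + z' ->
      x' = x -> y = y' -> z = z' -> A + B - D = 2 * x.
    by move=> -> -> -> -> -> ->; ring.
  apply: (lin _ _ _ _ _ _ _ _ _ (pd_metric b c a Uq) (pd_metric a c b Uq) (pd_metric a b c Uq)).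
  - exact: (congr1 (fun v => mink v (pd c X q)) (pd_comm b a Uq)).
  - exact: (etrans (minkC _ _) (congr1 (fun v => mink v (pd b X q)) (pd_comm a c Uq))).
  - exact: (congr1 (mink (pd a X q)) (pd_comm b c Uq)).
have -> : \sum_k christoffel X k a b q * metric X q k c =
    2^-1 * \sum_l K l * \sum_k imetric X q l k * metric X q k c.
  rewrite big_distrr /=; under [RHS]eq_bigr => l _ do rewrite big_distrr big_distrr /=.
  rewrite exchange_big; apply: eq_bigr => k _.
  rewrite /christoffel big_distrr big_distrl; apply: eq_bigr => l _ /=.
  rewrite (imetric_sym q l k) -/(K l).
  by move: (K l) (imetric _ _ _ _) (metric _ _ _ _) => x y z; ring.
have E l : \sum_k imetric X q l k * metric X q k c = (l == c)%:R.
  have /matrixP/(_ l c) := imetricK Uq; rewrite !mxE => <-.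
  by [].
under eq_bigr do rewrite E.
move: (mink _ _) KE => z; move: (K) => {E}K KE.
rewrite (bigD1 c)//= eqxx mulr1 big1 ?addr0; last by move=> l /negbTE ->; rewrite mulr0.
by rewrite KE mulrA mulVf ?mul1r ?pnatr_eq0.
Qed.

(** Against a normal vector the projection and the Christoffel terms drop out, so normal components
    need second partial derivatives only. *)
Lemma mink_sff q a b xi : U q -> mink xi (X q) = 0 ->
  (forall v, mink ('D_v X q) xi = 0) ->
  mink (sff X a b q) xi = mink (pd a (pd b X) q) xi.
Proof.
move=> Uq xX xT; rewrite /sff /nabla /projH minkBl minkDl minkZl (minkC (X q)) xX mulr0 addr0.
rewrite mink_suml big1 ?subr0// => k _.
by rewrite minkZl (pd_tangent k xT) mulr0.
Qed.

(** By the Koszul formula the Christoffel terms cancel the tangential part of the second partial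
    derivative. *)
Lemma sff_normal q a b c : U q -> mink (sff X a b q) (pd c X q) = 0.
Proof.
move=> Uq; rewrite /sff /nabla /projH minkBl minkDl minkZl (minkC (X q)).
rewrite pd_tangent_X// mulr0 addr0 mink_suml -christoffelE//.
rewrite -sumrB big1// => k _; rewrite minkZl [metric _ _ _ _]mxE.
exact: subrr.
Qed.

Lemma sff_X q a b : U q -> mink (sff X a b q) (X q) = 0.
Proof.
move=> Uq; rewrite /sff /nabla /projH minkBl minkDl minkZl XH4// mulrN1 subrr sub0r.
by rewrite mink_suml big1 ?oppr0// => k _; rewrite minkZl pd_tangent_X// mulr0.
Qed.

Lemma mink_mean_vec q xi :
  2 * mink (mean_vec X q) xi = \sum_a \sum_b imetric X q a b * mink (sff X a b q) xi.
Proof.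
rewrite /mean_vec minkZl mulrA divff ?pnatr_eq0// mul1r mink_suml.
apply: eq_bigr => a _; rewrite mink_suml; apply: eq_bigr => b _.
exact: minkZl.
Qed.

Lemma mean_vec_normal q v : U q -> mink (mean_vec X q) ('D_v X q) = 0.
Proof.
move=> Uq; rewrite (derive_pd v HX Uq) mink_sumr big1// => c _.
rewrite minkZr; apply/eqP; rewrite mulf_eq0; apply/orP; right.
have : 2 * mink (mean_vec X q) (pd c X q) = 0.
  rewrite mink_mean_vec big1// => a _; rewrite big1// => b _.
  by rewrite sff_normal// mulr0.
by move/eqP; rewrite mulf_eq0 pnatr_eq0.
Qed.

Lemma mean_vec_X q : U q -> mink (mean_vec X q) (X q) = 0.
Proof.
move=> Uq; have : 2 * mink (mean_vec X q) (X q) = 0.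
  rewrite mink_mean_vec big1// => a _; rewrite big1// => b _.
  by rewrite sff_X// mulr0.
by move/eqP; rewrite mulf_eq0 pnatr_eq0 => /eqP.
Qed.

(** If the rows of P are an orthonormal frame, then P G P^T = 1, whence G^-1 = P^T P. Traces in
    coordinates thereby become sums over the frame. *)
Lemma imetric_frame q v1 v2 a b : U q -> gdot X q v1 v1 = 1 -> gdot X q v2 v2 = 1 ->
  gdot X q v1 v2 = 0 -> imetric X q a b = v1 0 a * v1 0 b + v2 0 a * v2 0 b.
Proof.
move=> Uq h11 h22 h12; pose P : 'M[R]_2 := \matrix_(i < 2) [:: v1; v2]`_i.
have E : P *m metric X q *m P^T = 1%:M.
  apply/matrixP => i j.
  have -> : (P *m metric X q *m P^T) i j = gdot X q (row i P) (row j P).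
    rewrite gdot_mx// tr_row -row_mul !mxE; apply: eq_bigr => k _; rewrite !mxE.
    by congr (_ * _); apply: eq_bigr => l _; rewrite !mxE.
  rewrite !rowK [RHS]mxE.
  have [->|->] := ord2_cases i; have [->|->] := ord2_cases j.
  - exact: h11.
  - exact: h12.
  - exact: (etrans (gdotC _ _ _) h12).
  - exact: h22.
have uM := metric_unit Uq.
have E2 : metric X q *m (P^T *m P) = 1%:M.
  by rewrite mulmxA; apply: mulmx1C; rewrite mulmxA; exact: E.
have -> : imetric X q = P^T *m P.
  by rewrite -[RHS](mulKmx uM) E2 mulmx1.
by rewrite mxE big_ord_recl big_ord1 !mxE.
Qed.

Lemma frame_expand (q v v1 v2 : E2) : U q -> gdot X q v1 v1 = 1 -> gdot X q v2 v2 = 1 ->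
  gdot X q v1 v2 = 0 -> v = gdot X q v v1 *: v1 + gdot X q v v2 *: v2.
Proof.
move=> Uq h11 h22 h12; have MI : metric X q *m imetric X q = 1%:M.
  by rewrite mulmxV ?metric_unit.
apply/rowP => j; rewrite -[in LHS](mulmx1 v) -MI mulmxA mxE.
rewrite [RHS]mxE [X in _ = X + _]mxE [X in _ = _ + X]mxE !gdot_mx// ![(_ *m _^T) 0 0]mxE.
rewrite !big_distrl -big_split; apply: eq_bigr => a _ /=.
rewrite (imetric_frame a j Uq h11 h22 h12) ![_^T _ _]mxE.
by move: ((v *m metric X q) 0 a) (v1 0 a) (v1 0 j) (v2 0 a) (v2 0 j) => x y z t u; ring.
Qed.

Lemma normal_of_frame (q v1 v2 : E2) (xi : E5) :
  U q -> gdot X q v1 v1 = 1 -> gdot X q v2 v2 = 1 -> gdot X q v1 v2 = 0 ->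
  mink ('D_v1 X q) xi = 0 -> mink ('D_v2 X q) xi = 0 -> forall v, mink ('D_v X q) xi = 0.
Proof.
move=> Uq h11 h22 h12 x1 x2 v; have E := frame_expand v Uq h11 h22 h12.
apply: (etrans (congr1 (fun w => mink ('D_w X q) xi) E)).
rewrite (dir_linear oU (gdot X q v v1) (gdot X q v v2) v1 v2 HX Uq).
have L a b (x y : E5) : mink x xi = 0 -> mink y xi = 0 -> mink (a *: x + b *: y) xi = 0.
  by move=> h1 h2; rewrite minkDl !minkZl h1 h2 !mulr0 addr0.
exact: L x1 x2.
Qed.

Lemma second_derivative (q v w : E2) (xi : E5) : U q ->
  mink ('D_w ('D_v X) q) xi = \sum_a \sum_b v 0 a * w 0 b * mink (pd a (pd b X) q) xi.
Proof.
move=> Uq; have HwX := Cinf_derive w HX.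
apply: (etrans (congr1 (fun z => mink z xi) (Cinf_derive_comm w v oU HX Uq))).
apply: (etrans (congr1 (fun z => mink z xi) (derive_pd v HwX Uq))).
rewrite mink_suml; apply: eq_bigr => a _; rewrite minkZl.
have E : pd a ('D_w X) q = \sum_b w 0 b *: pd b (pd a X) q.
  exact: (etrans (pd_derive a w Uq) (derive_pd w (Cinf_pd a HX) Uq)).
rewrite E mink_suml big_distrr; apply: eq_bigr => b _ /=.
rewrite minkZl mulrA; exact: (congr1 (fun v => _ * mink v xi) (pd_comm b a Uq)).
Qed.

(** Differentiating the field T2 itself produces a tangent vector only, which is invisible to a
    normal xi. *)
Lemma second_form_along T1 T2 q xi : U q -> Cinf U T2 ->
  (forall v, mink ('D_v X q) xi = 0) ->
  mink (along T1 (along T2 X) q) xi =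
  \sum_a \sum_b T1 q 0 a * T2 q 0 b * mink (pd a (pd b X) q) xi.
Proof.
move=> Uq HT2 xT; rewrite alongE (derive_along oU HT2 (T1 q) HX Uq) minkDl xT add0r.
exact: (second_derivative (T1 q) (T2 q) xi Uq).
Qed.

Lemma mean_vec_trace (q v1 v2 : E2) (xi : E5) : U q -> gdot X q v1 v1 = 1 -> gdot X q v2 v2 = 1 ->
  gdot X q v1 v2 = 0 -> mink xi (X q) = 0 -> (forall v, mink ('D_v X q) xi = 0) ->
  2 * mink (mean_vec X q) xi =
    \sum_a \sum_b (v1 0 a * v1 0 b + v2 0 a * v2 0 b) * mink (pd a (pd b X) q) xi.
Proof.
move=> Uq h11 h22 h12 xX xT; rewrite mink_mean_vec.
apply: eq_bigr => a _; apply: eq_bigr => b _.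
by rewrite (imetric_frame a b Uq h11 h22 h12) mink_sff.
Qed.

Lemma shapeE (q : E2) (xi : E5) (v w : E2) : U q -> mink xi (X q) = 0 -> (forall v, mink ('D_v X q) xi = 0) ->
  gdot X q (Defs.shape X q xi v) w =
    \sum_a \sum_b v 0 a * w 0 b * mink (pd a (pd b X) q) xi.
Proof.
move=> Uq xX xT; rewrite gdot_mx// /Defs.shape -(mulmxA _ (imetric X q)) imetricK// mulmx1.
rewrite -mulmxA mxE; apply: eq_bigr => a _; rewrite mxE big_distrr; apply: eq_bigr => b _ /=.
by rewrite !mxE mink_sff// mulrA mulrAC.
Qed.

Lemma nabla_perp_normal (q : E2) a (F : E2 -> E5) (xi : E5) : U q -> mink xi (X q) = 0 ->
  (forall v, mink ('D_v X q) xi = 0) ->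
  mink (nabla_perp X a F q) xi = mink (pd a F q) xi.
Proof.
move=> Uq xX xT; rewrite /nabla_perp /normal_part /tangential /trace2 /nabla /projH.
rewrite minkBl minkDl minkZl (minkC (X q)) xX mulr0 addr0 mink_suml big1 ?subr0// => b _.
by rewrite mink_suml big1// => d _; rewrite !minkZl (pd_tangent _ xT) !mulr0.
Qed.

Lemma gdot_grad (h : E2 -> R) q v : U q -> Cinf U h -> gdot X q (grad X h q) v = 'D_v h q.
Proof.
move=> Uq Hh; rewrite gdot_mx// /grad -(mulmxA _ (imetric X q)) imetricK// mulmx1.
rewrite (derive_pd_real v Hh Uq) mxE; apply: eq_bigr => a _.
by rewrite !mxE mulrC.
Qed.

Lemma Cinf_sff a b : Cinf U (sff X a b).
Proof.
have Hab := Cinf_pd a (Cinf_pd b HX).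
apply: (Cinf_sub_fun oU).
  exact: (Cinf_add oU Hab (Cinf_scale oU (Cinf_mink oU Hab HX) HX)).
apply: (Cinf_sum oU) => k.
exact: (Cinf_scale oU (Cinf_christoffel k a b) (Cinf_pd k HX)).
Qed.

Lemma Cinf_mean_vec : Cinf U (mean_vec X).
Proof.
apply: (Cinf_scale oU (Cinf_cst _ _)); apply: (Cinf_sum oU) => a; apply: (Cinf_sum oU) => b.
exact: (Cinf_scale oU (Cinf_imetric a b) (Cinf_sff a b)).
Qed.

Hypothesis mean_gt0 : forall q, U q -> 0 < mean_curv X q.

Lemma mean_vec_norm q : U q -> mink (mean_vec X q) (mean_vec X q) = mean_curv X q ^+ 2.
Proof.
move=> Uq; rewrite /mean_curv sqr_sqrtr//.
by have := mean_gt0 Uq; rewrite /mean_curv sqrtr_gt0 => /ltW.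
Qed.

Lemma Cinf_mean_curv : Cinf U (mean_curv X).
Proof.
apply: (Cinf_sqrt_comp oU (Cinf_mink oU Cinf_mean_vec Cinf_mean_vec)) => q Uq.
by have := mean_gt0 Uq; rewrite /mean_curv sqrtr_gt0.
Qed.

Lemma Cinf_frame3 : Cinf U (frame3 X).
Proof.
apply: (Cinf_scale oU _ Cinf_mean_vec).
by apply: (Cinf_inv_comp oU Cinf_mean_curv) => q /mean_gt0; exact: lt0r_neq0.
Qed.

Lemma frame3_facts q : U q -> [/\ mink (frame3 X q) (frame3 X q) = 1,
  mink (frame3 X q) (X q) = 0 & forall v, mink ('D_v X q) (frame3 X q) = 0].
Proof.
move=> Uq; have f0 := lt0r_neq0 (mean_gt0 Uq); rewrite /frame3; split.
- rewrite minkZl minkZr mean_vec_norm//; move: (mean_curv X q) f0 => f f0.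
  by field.
- by rewrite minkZl mean_vec_X// mulr0.
- by move=> v; rewrite minkZr minkC mean_vec_normal// mulr0.
Qed.

Hypothesis grad_neq0 : forall q, U q -> grad X (mean_curv X) q != 0.

Lemma Cinf_gdot (T1 T2 : E2 -> E2) : Cinf U T1 -> Cinf U T2 ->
  Cinf U (fun q => gdot X q (T1 q) (T2 q)).
Proof.
by move=> H1 H2; exact: (Cinf_mink oU (Cinf_along oU H1 HX) (Cinf_along oU H2 HX)).
Qed.

Lemma Cinf_grad : Cinf U (grad X (mean_curv X)).
Proof.
apply: (Cinf_rV oU) => j.
have H a : Cinf U (fun q => pd a (mean_curv X) q * imetric X q a j).
  exact: (Cinf_mul oU (Cinf_pd_real a Cinf_mean_curv) (Cinf_imetric a j)).
apply: (eq_Cinf oU _ (Cinf_sum oU H)) => q _.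
by rewrite mxE; apply: eq_bigr => a _; rewrite mxE.
Qed.

Lemma grad_norm_gt0 q : U q -> 0 < gdot X q (grad X (mean_curv X) q) (grad X (mean_curv X) q).
Proof. by move=> Uq; exact: gdot_gt0 (grad_neq0 Uq). Qed.

Lemma Cinf_frame1 : Cinf U (frame1 X).
Proof.
have Hg := Cinf_gdot Cinf_grad Cinf_grad.
apply: (Cinf_scale oU _ Cinf_grad).
apply: (Cinf_inv_comp oU (Cinf_sqrt_comp oU Hg grad_norm_gt0)) => q Uq.
by rewrite lt0r_neq0// sqrtr_gt0 grad_norm_gt0.
Qed.

Lemma gdotZl q k (v w : E2) : U q -> gdot X q (k *: v) w = k * gdot X q v w.
Proof. by move=> Uq; rewrite !gdot_mx// -!scalemxAl mxE. Qed.

Lemma gdotZr q k (v w : E2) : U q -> gdot X q v (k *: w) = k * gdot X q v w.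
Proof. by move=> Uq; rewrite (gdotC q v) (gdotZl k w v Uq) (gdotC q w). Qed.

Lemma frame1_unit q : U q -> gdot X q (frame1 X q) (frame1 X q) = 1.
Proof.
move=> Uq; have G0 := grad_norm_gt0 Uq; rewrite /frame1 gdotZl// gdotZr//.
rewrite mulrA -expr2 exprVn sqr_sqrtr ?ltW// mulVf//.
exact: lt0r_neq0.
Qed.

Lemma derive_mean_curv q v : U q -> gdot X q (frame1 X q) v = 0 -> 'D_v (mean_curv X) q = 0.
Proof.
move=> Uq; have G0 := grad_norm_gt0 Uq; rewrite /frame1 gdotZl// => /eqP.
rewrite mulf_eq0 invr_eq0 (gt_eqF (_ : 0 < Num.sqrt _)) ?sqrtr_gt0//= => /eqP.
by rewrite gdot_grad//; exact: Cinf_mean_curv.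
Qed.

Lemma gdot2 q (v w : E2) : U q -> gdot X q v w =
  v 0 0 * w 0 0 * metric X q 0 0 + (v 0 0 * w 0 1 + v 0 1 * w 0 0) * metric X q 0 1 +
  v 0 1 * w 0 1 * metric X q 1 1.
Proof.
move=> Uq; rewrite gdotE// !big_ord_recl !big_ord0.
rewrite [lift _ _](_ : _ = 1); last exact: val_inj.
rewrite (metric_sym q 1 0) -[ord0]/(0 : 'I_2).
by move: (v 0 0) (v 0 1) (w 0 0) (w 0 1) (metric _ _ _ _) (metric _ _ _ _) (metric _ _ _ _) => *; ring.
Qed.

Lemma det_metric_gt0 q : U q -> 0 < \det (metric X q).
Proof.
move=> Uq; rewrite det2 (metric_sym q 1 0).
have m0 : 0 < metric X q 0 0.
  have d0 : (delta_mx 0 0 : E2) != 0.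
    by apply/eqP => /matrixP/(_ 0 0); rewrite !mxE => /eqP; rewrite oner_eq0.
  have := gdot_gt0 Uq d0; rewrite gdot2// !mxE /= !(mulr0,mul0r,mulr1,addr0,mul1r).
  by [].
(* For a metric with entries a, b, d, the vector (- b, a) has squared norm a (a d - b^2). *)
have w0 : pt2 (- metric X q 0 1) (metric X q 0 0) != 0.
  apply/eqP => /matrixP/(_ 0 1); rewrite !mxE /= => E.
  by move: m0; rewrite [metric _ _ _ _]mxE E ltxx.
have := gdot_gt0 Uq w0; rewrite gdot2// !pt2_0 !pt2_1.
move: (metric X q 0 0) (metric X q 0 1) (metric X q 1 1) m0 => a b d a0.
have -> : - b * - b * a + (- b * a + a * - b) * b + a * a * d = a * (a * d - b * b) by ring.
by rewrite pmulr_rgt0.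
Qed.

(* the rotation of v by a right angle for the metric *)
Definition rotate q (v : E2) : E2 :=
  (Num.sqrt (\det (metric X q)))^-1 *:
    pt2 (- (v 0 0 * metric X q 0 1 + v 0 1 * metric X q 1 1))
        (v 0 0 * metric X q 0 0 + v 0 1 * metric X q 0 1).

Lemma rotateP q v : U q -> gdot X q v v = 1 ->
  [/\ gdot X q (rotate q v) (rotate q v) = 1, gdot X q v (rotate q v) = 0 &
      0 < \det (col_mx v (rotate q v) : 'M[R]_2)].
Proof.
move=> Uq; have D0 := det_metric_gt0 Uq.
rewrite det_col_mx2 /rotate gdotZl// !gdotZr// !gdot2// !pt2_0 !pt2_1.
have sE (k : R) (w : E2) j : (k *: w) 0 j = k * w 0 j by rewrite mxE.
rewrite !sE !pt2_0 !pt2_1.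
have rE := sqr_sqrtr (ltW D0).
have r0 : 0 < Num.sqrt (\det (metric X q)) by rewrite sqrtr_gt0.
rewrite [X in _ = X]det2 (metric_sym q 1 0) in rE.
move: (Num.sqrt (\det (metric X q))) r0 rE => r.
move: (metric X q 0 0) (metric X q 0 1) (metric X q 1 1) (v 0 0) (v 0 1).
move=> a b d x y r0 rE vv; split.
- have -> : r^-1 * (r^-1 * (- (x * b + y * d) * - (x * b + y * d) * a +
   (- (x * b + y * d) * (x * a + y * b) + (x * a + y * b) * - (x * b + y * d)) * b +
   (x * a + y * b) * (x * a + y * b) * d)) =
   r^-1 ^+ 2 * (a * d - b * b) * (x * x * a + (x * y + y * x) * b + y * y * d) by ring.
  by rewrite vv mulr1 -rE exprVn mulVf// expf_neq0// lt0r_neq0.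
- by ring.
- rewrite (_ : _ - _ = r^-1 * (x * x * a + (x * y + y * x) * b + y * y * d)); last by ring.
  by rewrite vv mulr1 invr_gt0.
Qed.

Lemma Cinf_rotate (T : E2 -> E2) : Cinf U T -> Cinf U (fun q => rotate q (T q)).
Proof.
move=> HT; have Hj j := Cinf_coord j oU HT.
have Hdet : Cinf U (fun q => \det (metric X q)) by exact: (Cinf_det oU Cinf_metric).
apply: (Cinf_scale oU).
  apply: (Cinf_inv_comp oU (Cinf_sqrt_comp oU Hdet det_metric_gt0)) => q Uq.
  by rewrite lt0r_neq0// sqrtr_gt0 det_metric_gt0.
have Hm j a b := Cinf_mul oU (Hj j) (Cinf_metric a b).
by apply: (Cinf_pt2 oU); [apply: (Cinf_opp oU)|]; exact: (Cinf_add oU (Hm _ _ _) (Hm _ _ _)).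
Qed.

End ImmersionGeometry.

(** * The adapted frame of the surface *)

Section SurfaceFrame.
Context {R : realType}.
Local Notation E2 := 'rV[R]_2.
Local Notation E5 := 'rV[R]_5.

Lemma powR_half3 (x : R) : 0 < x -> x `^ (3 / 2) = Num.sqrt x ^+ 3.
Proof.
move=> x0; rewrite -powR12_sqrt ?ltW// -powR_mulrn ?powR_ge0// -powRrM.
by congr (_ `^ _); field.
Qed.

Lemma powR_34_sqr (x : R) : 0 < x -> (x `^ (3 / 4)) ^+ 2 = Num.sqrt x ^+ 3.
Proof.
move=> x0; rewrite -powR_half3// -powR_mulrn ?powR_ge0// -powRrM.
by congr (_ `^ _); field.
Qed.

Variables (X : E2 -> E5) (U : set E2) (c C : R).
Hypotheses (oU : open U) (HX : Cinf U X).
Hypothesis XH4 : forall q, U q -> mink (X q) (X q) = -1.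
Hypothesis immX : forall q v, U q -> 'D_v X q = 0 -> v = 0.
Hypothesis pnmc : forall q, U q -> pnmc_biconservative_at X q.
Hypothesis constants : forall q, U q -> attached_constants_at X c C q.
Hypotheses (c0 : c != 0) (C0 : C < 0).

Let f := mean_curv X.
Let s q := Num.sqrt (f q).
Let T1 := frame1 X.
Let T2 q := rotate X q (T1 q).
Let e1 := along T1 X.
Let e2 := along T2 X.
Let e3 := frame3 X.
Let S q := 3 / 4 * (along T1 f q / f q).
Let k q := 3 * Num.sqrt (- C) * f q `^ (3 / 4).
(** The part of D_{E_1} e_1 along E_4, whose coefficient is c s^3: the e2- and e3-components are
    subtracted, and so is X, which occurs with coefficient 1. Dividing by c s^3 gives a formula for
    E_4 that is visibly smooth. *)
Let h4 q := along T1 e1 q - mink (along T1 e1 q) (e2 q) *: e2 q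
  - mink (along T1 e1 q) (e3 q) *: e3 q - X q.
Let e4 q := (c * s q ^+ 3)^-1 *: h4 q.

Let f_gt0 q : U q -> 0 < f q. Proof. by move=> /pnmc[]. Qed.
Let grad_neq0 q : U q -> grad X f q != 0. Proof. by move=> /pnmc[]. Qed.
Let s_gt0 q : U q -> 0 < s q. Proof. by move=> /f_gt0 f0; rewrite sqrtr_gt0. Qed.
Let s_sqr q : U q -> s q ^+ 2 = f q. Proof. by move=> /f_gt0/ltW f0; rewrite sqr_sqrtr. Qed.
Let g_neq0 q : U q -> c * s q ^+ 3 != 0.
Proof. by move=> /s_gt0 s0; rewrite mulf_neq0// expf_neq0// lt0r_neq0. Qed.

Let Hf : Cinf U f. Proof. exact: (Cinf_mean_curv oU HX XH4 immX f_gt0). Qed.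
Let HT1 : Cinf U T1. Proof. exact: (Cinf_frame1 oU HX XH4 immX f_gt0 grad_neq0). Qed.
Let HT2 : Cinf U T2. Proof. exact: (Cinf_rotate oU HX XH4 immX HT1). Qed.
Let He1 : Cinf U e1. Proof. exact: (Cinf_along oU HT1 HX). Qed.
Let He2 : Cinf U e2. Proof. exact: (Cinf_along oU HT2 HX). Qed.
Let He3 : Cinf U e3. Proof. exact: (Cinf_frame3 oU HX XH4 immX f_gt0). Qed.
Let Hs : Cinf U s. Proof. exact: (Cinf_sqrt_comp oU Hf f_gt0). Qed.
Let HS : Cinf U S.
Proof.
have Hi : Cinf U (fun q => (f q)^-1).
  by apply: (Cinf_inv_comp oU Hf) => q /f_gt0; exact: lt0r_neq0.
exact: (Cinf_mul oU (Cinf_cst _ _) (Cinf_mul oU (Cinf_along_real oU HT1 Hf) Hi)).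
Qed.
Let Hk : Cinf U k.
Proof. exact: (Cinf_mul oU (Cinf_cst _ _) (Cinf_powR_comp oU _ Hf f_gt0)). Qed.
Let Hg : Cinf U (fun q => c * s q ^+ 3).
Proof. exact: (Cinf_mul oU (Cinf_cst _ _) (Cinf_exp_comp oU _ Hs)). Qed.
Let He4 : Cinf U e4.
Proof.
have HD := Cinf_along oU HT1 He1.
have K2 := Cinf_scale oU (Cinf_mink oU HD He2) He2.
have K3 := Cinf_scale oU (Cinf_mink oU HD He3) He3.
apply: (Cinf_scale oU (Cinf_inv_comp oU Hg g_neq0)).
exact: (Cinf_sub_fun oU (Cinf_sub_fun oU (Cinf_sub_fun oU HD K2) K3) HX).
Qed.

Let e1E q : e1 q = 'D_(T1 q) X q. Proof. exact: alongE. Qed.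
Let e2E q : e2 q = 'D_(T2 q) X q. Proof. exact: alongE. Qed.
Let gdot11 q : gdot X q (T1 q) (T1 q) = mink (e1 q) (e1 q). Proof. by rewrite e1E. Qed.
Let gdot12 q : gdot X q (T1 q) (T2 q) = mink (e1 q) (e2 q). Proof. by rewrite e1E e2E. Qed.
Let gdot22 q : gdot X q (T2 q) (T2 q) = mink (e2 q) (e2 q). Proof. by rewrite e2E. Qed.

Let e11 q : U q -> mink (e1 q) (e1 q) = 1.
Proof. by move=> Uq; rewrite -gdot11; exact: (frame1_unit oU HX XH4 immX grad_neq0 Uq). Qed.

Let T2P q : U q ->
  [/\ gdot X q (T2 q) (T2 q) = 1, gdot X q (T1 q) (T2 q) = 0 &
      0 < \det (col_mx (T1 q) (T2 q) : 'M[R]_2)].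
Proof.
by move=> Uq; apply: (rotateP oU HX XH4 immX Uq); rewrite gdot11 e11.
Qed.

Let e3P q : U q -> [/\ mink (e3 q) (e3 q) = 1, mink (e3 q) (X q) = 0 &
  forall v, mink ('D_v X q) (e3 q) = 0].
Proof. by move=> Uq; exact: (frame3_facts oU HX XH4 immX f_gt0 Uq). Qed.

Let first_ode q : U q -> along T1 f q = ode_rhs c C (f q) /\ 0 < along T1 f q.
Proof. by move=> Uq; have [_ E] := constants Uq; rewrite alongE E. Qed.

Let ode_rhsE q : U q ->
  ode_rhs c C (f q) = 4 / 3 * f q * Num.sqrt (1 + 9 * C * s q ^+ 3 - 9 * s q ^+ 4 - c ^+ 2 * s q ^+ 6).
Proof.
move=> Uq; rewrite /ode_rhs powR_half3 ?f_gt0// -/(s q) -(s_sqr Uq).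
by congr (_ * Num.sqrt _); move: (s q) => x; ring.
Qed.

Let S_E q : U q -> S q = Num.sqrt (1 + 9 * C * s q ^+ 3 - 9 * s q ^+ 4 - c ^+ 2 * s q ^+ 6).
Proof.
move=> Uq; rewrite /S (first_ode Uq).1 ode_rhsE//.
by have := lt0r_neq0 (f_gt0 Uq); move: (f q) (Num.sqrt _) => x y x0; field.
Qed.

Let S_gt0 q : U q -> 0 < S q.
Proof. by move=> Uq; rewrite mulr_gt0 ?divr_gt0 ?f_gt0 ?(first_ode Uq).2. Qed.

Let S_sqr q : U q -> S q ^+ 2 = 1 + 9 * C * s q ^+ 3 - 9 * s q ^+ 4 - c ^+ 2 * s q ^+ 6.
Proof.
by move=> Uq; have := S_gt0 Uq; rewrite S_E// sqrtr_gt0 => /ltW h; rewrite sqr_sqrtr.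
Qed.

Let f_along T q : U q -> along T f q = 2 * s q * along T s q.
Proof.
move=> Uq; have E p : U p -> f p = s p ^+ 2 by move=> Up; rewrite s_sqr.
by rewrite (eq_along oU T E Uq) (alongX oU T 1 Hs Uq) expr1.
Qed.

Let s_along1 q : U q -> along T1 s q = 2 / 3 * s q * S q.
Proof.
move=> Uq; have s0 := lt0r_neq0 (s_gt0 Uq).
have s2 : 2 * s q != 0 by rewrite mulf_neq0 ?pnatr_eq0.
apply: (mulfI s2); rewrite -f_along// /S -(s_sqr Uq).
by move: (along T1 f q) (s q) s0 => x y y0; field.
Qed.

Let s_along2 q : U q -> along T2 s q = 0.
Proof.
move=> Uq; have s0 := lt0r_neq0 (s_gt0 Uq).
have : along T2 f q = 0.
  rewrite alongE; apply: (derive_mean_curv oU HX XH4 immX f_gt0 grad_neq0 Uq).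
  by have [] := T2P Uq.
by rewrite f_along// => /eqP; rewrite !mulf_eq0 pnatr_eq0 (negbTE s0) => /eqP.
Qed.

(** At a fixed point linear algebra provides E_4 with the prescribed orientation; nothing is said
    about its dependence on the point. *)
Let fourth q : U q -> exists2 w, orthoframe (e1 q) (e2 q) (e3 q) w (X q) &
  forall v2 : E2, v2 = T2 q -> is_frame2 X q v2 /\ is_frame4 X q v2 w.
Proof.
move=> Uq; have [t22 t12 dT] := T2P Uq; have [e33 e3X e3t] := e3P Uq.
have tX (v : E2) : mink ('D_v X q) (X q) = 0 by exact: (tangent_X oU HX XH4).
have t1X : mink (e1 q) (X q) = 0 by rewrite e1E; exact: tX.
have t2X : mink (e2 q) (X q) = 0 by rewrite e2E; exact: tX.
have t13 : mink (e1 q) (e3 q) = 0 by rewrite e1E; exact: e3t.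
have t23 : mink (e2 q) (e3 q) = 0 by rewrite e2E; exact: e3t.
have t11 : gdot X q (T1 q) (T1 q) = 1 by rewrite gdot11 e11.
have NF := normal_of_frame oU HX XH4 immX Uq t11 t22 t12.
have m22 : mink (e2 q) (e2 q) = 1 by rewrite -gdot22; exact: t22.
have m12 : mink (e1 q) (e2 q) = 0 by rewrite -gdot12; exact: t12.
have [w ow dw] := exists_fourth_vector (e11 Uq) m22 e33 (XH4 Uq) m12 t13 t1X t23 t2X e3X.
exists w; [exact: ow|move=> v2 ->].
split; first by split; [exact: t22|exact: t12|exact: dT].
have [[_ _ _ ww _] [_ _ h14 _] [_ h24 _] [h34 _ h4X]] := ow.
have wt v : mink w ('D_v X q) = 0.
  apply: (etrans (minkC _ _)); apply: NF; first by rewrite -e1E; exact: h14.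
  by rewrite -e2E; exact: h24.
have h43 : mink w (e3 q) = 0 by rewrite minkC; exact: h34.
rewrite e1E e2E in dw.
by split; [exact: ww|split; [exact: h4X|exact: wt]|exact: h43|exact: dw].
Qed.

(** The hypothesis on A_4 is read in the frame: each entry is the product of w with a second
    derivative of X along the frame. *)
Let frame_shape q w : U q -> orthoframe (e1 q) (e2 q) (e3 q) w (X q) ->
  (is_frame2 X q (T2 q) /\ is_frame4 X q (T2 q) w) ->
  [/\ mink (along T1 e1 q) w = c * s q ^+ 3, mink (along T2 e1 q) w = 0,
      mink (along T1 e2 q) w = 0 & mink (along T2 e2 q) w = - (c * s q ^+ 3)].
Proof.
move=> Uq ow [F2 F4]; have [sh _ _] := constants Uq; have [sh1 sh2] := sh _ _ F2 F4.
have [_ [wX wt] _ _] := F4.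
have wt' v : mink ('D_v X q) w = 0 by rewrite minkC.
have [t22 t12 _] := T2P Uq.
have t11 : gdot X q (T1 q) (T1 q) = 1 by rewrite gdot11 e11.
have ff : mean_curv X q `^ (3 / 2) = s q ^+ 3 by rewrite powR_half3 ?f_gt0.
have II T T' : Cinf U T' ->
    mink (along T (along T' X) q) w = gdot X q (Defs.shape X q w (T q)) (T' q).
  move=> HT'; rewrite (second_form_along oU HX T Uq HT' wt').
  by rewrite (shapeE oU HX XH4 immX _ _ Uq wX wt').
have Z k' v v' a : gdot X q v v' = a -> gdot X q (k' *: v) v' = k' * a.
  by move=> <-; exact: (gdotZl oU HX _ _ _ Uq).
have t21 : gdot X q (T2 q) (T1 q) = 0 by rewrite gdotC; exact: t12.
rewrite ff in sh1 sh2.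
split.
- apply: (etrans (II T1 T1 HT1)); apply: (etrans (congr1 (fun v => gdot X q v (T1 q)) sh1)).
  by apply: (etrans (Z _ _ _ _ t11)); rewrite mulr1.
- apply: (etrans (II T2 T1 HT1)); apply: (etrans (congr1 (fun v => gdot X q v (T1 q)) sh2)).
  by apply: (etrans (Z _ _ _ _ t21)); rewrite mulr0.
- apply: (etrans (II T1 T2 HT2)); apply: (etrans (congr1 (fun v => gdot X q v (T2 q)) sh1)).
  by apply: (etrans (Z _ _ _ _ t12)); rewrite mulr0.
- apply: (etrans (II T2 T2 HT2)); apply: (etrans (congr1 (fun v => gdot X q v (T2 q)) sh2)).
  by apply: (etrans (Z _ _ _ _ t22)); rewrite mulr1.
Qed.

(** Identifies the pointwise oriented normal with the smooth formula, since the expansion of D_{E_1}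
    e_1 has no other unknown term. *)
Let e4_eq q w : U q -> orthoframe (e1 q) (e2 q) (e3 q) w (X q) ->
  mink (along T1 e1 q) w = c * s q ^+ 3 -> e4 q = w.
Proof.
move=> Uq ow gw.
have z1 : mink (along T1 e1 q) (e1 q) = 0.
  have := along_skew oU T1 He1 He1 Uq e11; move: (mink _ _) => z ?; lra.
have zX : mink (along T1 e1 q) (X q) = -1.
  have e1X p : U p -> mink (X p) (e1 p) = 0.
    by move=> Up; rewrite minkC e1E; exact: (tangent_X oU HX XH4).
  by rewrite (along_skew oU T1 HX He1 Uq e1X) e11.
have h4E : h4 q = (c * s q ^+ 3) *: w.
  have gen (D v1 v2 v3 w' x : E5) p1 p2 p3 p4 p5 g :
      D = p1 *: v1 + p2 *: v2 + p3 *: v3 + p4 *: w' - p5 *: x ->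
      p1 = 0 -> p5 = -1 -> p4 = g -> D - p2 *: v2 - p3 *: v3 - x = g *: w'.
    move=> -> -> -> ->; apply/rowP => j; rewrite !mxE.
    by move: (v1 0 j) (v2 0 j) (v3 0 j) (w' 0 j) (x 0 j) => *; ring.
  exact: (gen _ _ _ _ _ _ _ _ _ _ _ _ (orthoframe_expand (along T1 e1 q) ow) z1 zX gw).
by rewrite /e4 h4E scalerA mulVf ?g_neq0// scale1r.
Qed.

Let e4P q : U q -> orthoframe (e1 q) (e2 q) (e3 q) (e4 q) (X q) /\
  [/\ mink (along T1 e1 q) (e4 q) = c * s q ^+ 3, mink (along T2 e1 q) (e4 q) = 0,
      mink (along T1 e2 q) (e4 q) = 0 & mink (along T2 e2 q) (e4 q) = - (c * s q ^+ 3)].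
Proof.
move=> Uq; have [w ow F] := fourth Uq.
have sw := frame_shape Uq ow (F _ erefl).
have gw : mink (along T1 e1 q) w = c * s q ^+ 3 by have [] := sw.
by rewrite (e4_eq Uq ow gw).
Qed.

Let e4t q (v : E2) : U q -> mink ('D_v X q) (e4 q) = 0.
Proof.
move=> Uq; have [[_ [_ _ h14 _] [_ h24 _] _] _] := e4P Uq; have [t22 t12 _] := T2P Uq.
have t11 : gdot X q (T1 q) (T1 q) = 1 by rewrite gdot11 e11.
by apply: (normal_of_frame oU HX XH4 immX Uq t11 t22 t12); rewrite -?e1E -?e2E.
Qed.

(** The trace of A_3 in the frame (E_1, E_2) is 2 <H, E_3> = 2 f. *)
Let trace3 q : U q ->
  mink (along T1 e1 q) (e3 q) + mink (along T2 e2 q) (e3 q) = 2 * s q ^+ 2.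
Proof.
move=> Uq; have [e33 e3X e3t] := e3P Uq; have [t22 t12 _] := T2P Uq.
have t11 : gdot X q (T1 q) (T1 q) = 1 by rewrite gdot11 e11.
have A1 : mink (along T1 e1 q) (e3 q) = _ := second_form_along oU HX T1 Uq HT1 e3t.
have A2 : mink (along T2 e2 q) (e3 q) = _ := second_form_along oU HX T2 Uq HT2 e3t.
have H3 : s q ^+ 2 = mink (mean_vec X q) (e3 q).
  rewrite (minkZr _ (mean_vec X q)) (mean_vec_norm f_gt0 Uq) -/(f q) (s_sqr Uq).
  by have := lt0r_neq0 (f_gt0 Uq); move: (f q) => x x0; field.
have A3 := mean_vec_trace oU HX XH4 immX Uq t11 t22 t12 e3X e3t.
apply: (etrans (congr2 +%R A1 A2)); apply: (etrans _ (congr1 ( *%R 2) (esym H3))).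
apply: (etrans _ (esym A3)); rewrite -big_split; apply: eq_bigr => a _.
by rewrite -big_split; apply: eq_bigr => b _; rewrite /= mulrDl.
Qed.

Let parallel3 q : U q ->
  mink (along T1 e3 q) (e4 q) = 0 /\ mink (along T2 e3 q) (e4 q) = 0.
Proof.
move=> Uq; have [[_ _ _ [_ _ h4X]] _] := e4P Uq.
have H T : mink (along T e3 q) (e4 q) = 0.
  rewrite alongE (derive_pd oU (T q) He3 Uq) mink_suml big1// => a _.
  rewrite minkZl -(nabla_perp_normal a e3 Uq h4X (fun v => e4t v Uq)).
  by have [_ _ _ ->] := pnmc Uq; rewrite mink0l mulr0.
by split; exact: H.
Qed.

Let k_gt0 q : U q -> 0 < k q.
Proof.
by move=> Uq; rewrite mulr_gt0 ?powR_gt0 ?f_gt0// mulr_gt0// sqrtr_gt0 oppr_gt0.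
Qed.

Let k_sqr q : U q -> k q ^+ 2 = - 9 * C * s q ^+ 3.
Proof.
move=> Uq; rewrite /k exprMn powR_34_sqr ?f_gt0// exprMn sqr_sqrtr; last by rewrite oppr_ge0 ltW.
by rewrite -/(s q); move: (s q) => x; ring.
Qed.

Lemma surface_adapted_frame :
  adapted_frame U T1 T2 X e1 e2 e3 e4 (fun q => (k q)^-1 *: along T2 e2 q) s S k c.
Proof.
apply: (@adapted_frameP _ _ _ _ _ _ _ _ _ _ _ _ C erefl erefl oU HT1 HT2 HX He3 He4 Hs HS
  _ immX _ e4t parallel3 _ trace3 s_gt0 S_gt0 S_sqr s_along1 s_along2 c0
  _ _ _ _ _ _ (fun=> erefl) (fun=> erefl) (fun=> erefl) (fun=> erefl) (fun=> erefl) (fun=> erefl)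
  _ _ Hk k_gt0 k_sqr erefl).
- by move=> q /e4P[].
- by move=> q v /e3P[].
- by move=> q /e4P[].
Qed.

Lemma surface_frame_scalars q : U q ->
  [/\ f q = s q ^+ 2, k q = 3 * Num.sqrt (- C) * f q `^ (3 / 4),
      S q ^+ 2 = 1 + 9 * C * s q ^+ 3 - 9 * s q ^+ 4 - c ^+ 2 * s q ^+ 6 &
      S q = Num.sqrt (1 + 9 * C * f q `^ (3 / 2) - 9 * f q ^+ 2 - c ^+ 2 * f q ^+ 3)].
Proof.
move=> Uq; split; [by rewrite s_sqr|by []|exact: S_sqr|].
rewrite S_E// powR_half3 ?f_gt0// -/(s q) -(s_sqr Uq).
by congr (Num.sqrt _); move: (s q) => x; ring.
Qed.

End SurfaceFrame.

(** * The parametrized surface *)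

(** A1 and A2 are the derivatives of e1 along E_1 and of e2 along E_2; the normal part of their sum
    is 2 f e3, which is twice the mean curvature vector. *)
Lemma orthoframe_trace {R : realType} (s S g : R) (e1 e2 e3 e4 x : 'rV[R]_5) :
  orthoframe e1 e2 e3 e4 x ->
  let A1 := - s ^+ 2 *: e3 + g *: e4 + x in
  let A2 := S *: e1 + (3 * s ^+ 2) *: e3 - g *: e4 + x in
  mink A1 e3 + mink A2 e3 = 2 * s ^+ 2 /\ mink A1 e4 + mink A2 e4 = 0.
Proof.
move=> [[h11 h22 h33 h44 hXX] [h12 h13 h14 h1X] [h23 h24 h2X] [h34 h3X h4X]] A1 A2.
rewrite /A1 /A2 !minkE h13 h14 h33 h34 (minkC e4 e3) h34 h44 (minkC x e3) h3X (minkC x e4) h4X.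
by split; ring.
Qed.

Section AdaptedParametrization.
Context {R : realType}.
Local Notation E2 := 'rV[R]_2.
Local Notation E5 := 'rV[R]_5.
Variables (U : set E2) (T1 T2 : E2 -> E2) (X e1 e2 e3 e4 n : E2 -> E5) (s S k : E2 -> R) (c : R).
Hypotheses (oU : open U) (AF : adapted_frame U T1 T2 X e1 e2 e3 e4 n s S k c).
Variables (q0 : E2) (r uc : R) (Th : E2 -> E2).
Let Q := ball (pt2 uc 0) r.
Hypotheses (r0 : 0 < r) (QU : forall y, Q y -> U (Th y)) (HTh : Cinf Q Th).
Hypotheses (Th0 : Th (pt2 uc 0) = q0).
Hypothesis dTh : forall y, Q y ->
  is_derive y (delta_mx 0 0 : E2) Th (T1 (Th y)) /\
  is_derive y (delta_mx 0 1 : E2) Th ((k (Th y))^-1 *: T2 (Th y)).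

Let oQ : open Q. Proof. exact: ball_open. Qed.
Let HX : Cinf U X. Proof. by case: AF => -[[]]. Qed.
Let He1 : Cinf U e1. Proof. by case: AF => -[[]]. Qed.
Let He2 : Cinf U e2. Proof. by case: AF => -[[]]. Qed.
Let Hk : Cinf U k. Proof. by case: AF => -[_ []]. Qed.
Let k0 y : Q y -> k (Th y) != 0.
Proof. by move=> /QU Uy; have [_ _ h] := af_gt0 AF Uy; exact: lt0r_neq0. Qed.

Let Y y := X (Th y).
Let HY : Cinf Q Y. Proof. exact: (Cinf_pullback_rV oU QU HTh HX). Qed.

Let dY0 y : Q y -> 'D_(delta_mx 0 0) Y y = e1 (Th y).
Proof.
move=> Qy; have [[_ E] _] := pullback_rV oU QU dTh HX Qy.
by apply: (etrans E); have [-> _] := af_X AF (QU Qy).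
Qed.

Let dY1 y : Q y -> 'D_(delta_mx 0 1) Y y = (k (Th y))^-1 *: e2 (Th y).
Proof.
move=> Qy; have [_ [_ E]] := pullback_rV oU QU dTh HX Qy.
by apply: (etrans E); have [_ ->] := af_X AF (QU Qy).
Qed.

Let dYv y (v : E2) : Q y -> 'D_v Y y = v 0 0 *: e1 (Th y) + (v 0 1 * (k (Th y))^-1) *: e2 (Th y).
Proof.
move=> Qy; rewrite (derive_dir_rV v oQ HY Qy) big_ord_recl big_ord1.
rewrite [lift _ _](_ : _ = 1); last exact: val_inj.
by rewrite -[ord0]/(0 : 'I_2) dY0// dY1// scalerA.
Qed.

Let YH4 y : Q y -> mink (Y y) (Y y) = -1.
Proof. by move=> /QU/(af_frame AF)[[]]. Qed.

Let immY y v : Q y -> 'D_v Y y = 0 -> v = 0.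
Proof.
move=> Qy; rewrite dYv// => E.
have [[h11 h22 _ _ _] [h12 _ _ _] _ _] := af_frame AF (QU Qy).
have E1 := congr1 (fun w => mink w (e1 (Th y))) E.
have E2' := congr1 (fun w => mink w (e2 (Th y))) E.
rewrite /= mink0l minkDl !minkZl h11 (minkC (e2 _)) h12 mulr0 addr0 mulr1 in E1.
rewrite /= mink0l minkDl !minkZl h22 h12 mulr0 add0r mulr1 in E2'.
apply/rowP => j; rewrite mxE; have [->|->] := ord2_cases j; first exact: E1.
by move/eqP: E2'; rewrite mulf_eq0 invr_eq0 (negbTE (k0 Qy)) orbF => /eqP.
Qed.

(** The orthonormal frame in the coordinates (u, t): d/du and k d/dt are mapped to e1 and e2. *)
Let V1 (y : E2) : E2 := delta_mx 0 0.
Let V2 (y : E2) : E2 := k (Th y) *: delta_mx 0 1.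

Let HV1 : Cinf Q V1. Proof. exact: Cinf_cst. Qed.
Let HV2 : Cinf Q V2.
Proof. exact: (Cinf_scale oQ (Cinf_pullback oU QU HTh Hk) (Cinf_cst _ _)). Qed.

Let alongV1 y : Q y -> along V1 Y y = e1 (Th y).
Proof. by move=> Qy; rewrite alongE; exact: dY0. Qed.

Let alongV2 y : Q y -> along V2 Y y = e2 (Th y).
Proof.
move=> Qy; rewrite alongE (deriveZdir _ (Cinf_derivable _ HY Qy)) dY1// scalerA.
by rewrite divff ?scale1r ?k0.
Qed.

Let second1 y : Q y -> along V1 (along V1 Y) y = along T1 e1 (Th y).
Proof.
move=> Qy; rewrite (eq_along oQ V1 alongV1 Qy) alongE.
by have [[_ E] _] := pullback_rV oU QU dTh He1 Qy.
Qed.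

Let second2 y : Q y -> along V2 (along V2 Y) y = along T2 e2 (Th y).
Proof.
move=> Qy; rewrite (eq_along oQ V2 alongV2 Qy) alongE.
have He2' := Cinf_pullback_rV oU QU HTh He2.
rewrite (deriveZdir _ (Cinf_derivable _ He2' Qy)).
have [_ [_ E]] := pullback_rV oU QU dTh He2 Qy.
by apply: (etrans (congr1 (fun w => _ *: w) E)); rewrite scalerA divff ?scale1r ?k0.
Qed.

(** H is recomputed in the new coordinates from the frame (d/du, k d/dt) and the structure
    equations, which takes the place of a general invariance under changes of coordinates. *)
Lemma mean_vec_adapted y : Q y -> mean_vec Y y = s (Th y) ^+ 2 *: e3 (Th y).
Proof.
move=> Qy; have Uy := QU Qy; have F := af_frame AF Uy.
have [[h11 h22 h33 h44 hXX] [h12 h13 h14 h1X] [h23 h24 h2X] [h34 h3X h4X]] := F.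
have g11 : gdot Y y (V1 y) (V1 y) = 1.
  by rewrite /gdot -!(alongE V1) alongV1.
have g22 : gdot Y y (V2 y) (V2 y) = 1.
  by rewrite /gdot -!(alongE V2) alongV2.
have g12 : gdot Y y (V1 y) (V2 y) = 0.
  by rewrite /gdot -(alongE V1) -(alongE V2) alongV1// alongV2.
have tr (xi : E5) : mink xi (Y y) = 0 -> mink (e1 (Th y)) xi = 0 -> mink (e2 (Th y)) xi = 0 ->
    2 * mink (mean_vec Y y) xi = mink (along T1 e1 (Th y)) xi + mink (along T2 e2 (Th y)) xi.
  move=> xY x1 x2.
  have xt (v : E2) : mink ('D_v Y y) xi = 0.
    by rewrite dYv// minkDl !minkZl x1 x2 !mulr0 addr0.
  rewrite (mean_vec_trace oQ HY YH4 immY Qy g11 g22 g12 xY xt).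
  have A1 := second_form_along oQ HY V1 Qy HV1 xt.
  have A2 := second_form_along oQ HY V2 Qy HV2 xt.
  rewrite second1// in A1; rewrite second2// in A2.
  apply: (etrans _ (esym (congr2 +%R A1 A2))).
  rewrite -big_split; apply: eq_bigr => a _.
  by rewrite -big_split; apply: eq_bigr => b _; rewrite /= mulrDl.
have t3 := tr (e3 (Th y)) h3X h13 h23; have t4 := tr (e4 (Th y)) h4X h14 h24.
have [K3 K4] := orthoframe_trace (s (Th y)) (S (Th y)) (c * s (Th y) ^+ 3) F.
have D1 := af_e1 AF Uy; have [_ D2] := af_e2 AF Uy.
rewrite D1 D2 K3 in t3; rewrite D1 D2 K4 in t4.
have m1 : mink (mean_vec Y y) (e1 (Th y)) = 0.
  exact: (etrans (congr1 (mink _) (esym (dY0 Qy))) (mean_vec_normal oQ HY YH4 immY _ Qy)).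
have m2 : mink (mean_vec Y y) (e2 (Th y)) = 0.
  have := mean_vec_normal oQ HY YH4 immY (V2 y) Qy.
  by move/(etrans (congr1 (mink _) (etrans (esym (alongV2 Qy)) (alongE V2 Y y)))).
have mX : mink (mean_vec Y y) (X (Th y)) = 0 by exact: (mean_vec_X oQ HY YH4 Qy).
have two (x z : R) : 2 * x = 2 * z -> x = z by apply: mulfI; rewrite pnatr_eq0.
have m3 : mink (mean_vec Y y) (e3 (Th y)) = s (Th y) ^+ 2 := two _ _ t3.
have m4 : mink (mean_vec Y y) (e4 (Th y)) = 0.
  by apply: two; rewrite mulr0; exact: t4.
have gen (D v1 v2 v3 v4 x : E5) p1 p2 p3 p4 p5 g :
    D = p1 *: v1 + p2 *: v2 + p3 *: v3 + p4 *: v4 - p5 *: x ->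
    p1 = 0 -> p2 = 0 -> p3 = g -> p4 = 0 -> p5 = 0 -> D = g *: v3.
  by move=> -> -> -> -> -> ->; rewrite !scale0r subr0 addr0 !add0r.
exact: (gen _ _ _ _ _ _ _ _ _ _ _ _ (orthoframe_expand (mean_vec Y y) F) m1 m2 m3 m4 mX).
Qed.

Lemma mean_curv_adapted y : Q y -> mean_curv Y y = s (Th y) ^+ 2.
Proof.
move=> Qy; have [[_ _ h33 _ _] _ _ _] := af_frame AF (QU Qy).
rewrite /mean_curv mean_vec_adapted// minkZl minkZr h33 mulr1 -expr2.
by rewrite sqrtr_sqr ger0_norm// sqr_ge0.
Qed.

Let I := [set u | Q (pt2 u 0)].

Lemma Cinf_base_curve : Cinf setT (fun u : R => pt2 u 0).
Proof. by apply: (Cinf_pt2 openT); [move=> m; exact: Ck_id|exact: Cinf_cst]. Qed.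

Lemma open_base : open I.
Proof.
apply: open_comp oQ => u _; exact: (Cinf_continuous Cinf_base_curve).
Qed.

Lemma is_derive_base_curve u : is_derive u (1:R) (fun u : R => pt2 u 0) (delta_mx 0 0).
Proof.
apply: is_derive_affine => h; apply/rowP => -[[|[|//]] i]; rewrite !mxE /=.
  by rewrite mulr1 [h *: 1]mulr1 addrC.
by rewrite mulr0 addr0.
Qed.

Lemma derive_base_rV m (F : E2 -> 'rV[R]_m) u : Cinf U F -> I u ->
  is_derive u (1:R) (fun u => F (Th (pt2 u 0))) (along T1 F (Th (pt2 u 0))).
Proof.
move=> HF Iu; have HFT := Cinf_pullback_rV oU QU HTh HF.
have := is_derive_compC_rV (F := fun u => pt2 u 0) oQ HFT Iu (is_derive_base_curve u).
by have [[_ ->] _] := pullback_rV oU QU dTh HF Iu.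
Qed.

Lemma derive_base (F : E2 -> R) u : Cinf U F -> I u ->
  is_derive u (1:R) (fun u => F (Th (pt2 u 0))) (along T1 F (Th (pt2 u 0))).
Proof.
move=> HF Iu; have HFT := Cinf_pullback oU QU HTh HF.
have := is_derive_compC (F := fun u => pt2 u 0) oQ HFT Iu (is_derive_base_curve u).
by have [[_ ->] _] := pullback oU QU dTh HF Iu.
Qed.

Lemma Cinf_base_rV m (F : E2 -> 'rV[R]_m) : Cinf U F -> Cinf I (fun u => F (Th (pt2 u 0))).
Proof.
move=> HF; have HFT := Cinf_pullback_rV oU QU HTh HF.
apply: (Cinf_comp_rV open_base oQ _ _ HFT) => //.
exact: (Cinf_sub (@subsetT _ I) Cinf_base_curve).
Qed.

Let HF : [/\ Cinf U e2, Cinf U n & Cinf U k].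
Proof. by case: AF => -[[_ _ _ _ ?] [[_ _ ? _ _] ?]]. Qed.

(** The hyperbolic rotation by t = 0 is the identity, so along the base curve e2 and n keep their
    values at q0, the future b1 and b2. *)
Lemma adapted_base_frame u : I u -> e2 (Th (pt2 u 0)) = e2 q0 /\ n (Th (pt2 u 0)) = n q0.
Proof.
move=> Iu; have [_ Hn _] := HF.
have [] := @hyperbolic_frame _ U T1 T2 e2 n k oU He2 Hn (fun q Uq => (af_e2 AF Uq).1)
  (fun q Uq => (af_dn AF Uq).1) (fun q Uq => af_e2n AF Uq) (fun q Uq => (af_dn AF Uq).2)
  (fun q Uq => let: And3 _ _ h := af_gt0 AF Uq in h) q0 r uc Th r0 QU HTh Th0 dTh _ Iu.
by rewrite !pt2_1 cosh0 sinh0 !scale1r !scale0r addr0 add0r.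
Qed.

End AdaptedParametrization.

(** * The base curve t = 0 *)

Section BaseCurve.
Context {R : realType}.
Local Notation E2 := 'rV[R]_2.
Local Notation E5 := 'rV[R]_5.
Variables (U : set E2) (T1 T2 : E2 -> E2) (X e1 e2 e3 e4 n : E2 -> E5) (s S k : E2 -> R) (c : R).
Hypotheses (oU : open U) (AF : adapted_frame U T1 T2 X e1 e2 e3 e4 n s S k c).
Hypothesis XH4 : forall q, U q -> H4 (X q).
Variables (q0 : E2) (r uc : R) (Th : E2 -> E2).
Let Q := ball (pt2 uc 0) r.
Hypotheses (r0 : 0 < r) (QU : forall y, Q y -> U (Th y)) (HTh : Cinf Q Th).
Hypotheses (Th0 : Th (pt2 uc 0) = q0).
Hypothesis dTh : forall y, Q y ->
  is_derive y (delta_mx 0 0 : E2) Th (T1 (Th y)) /\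
  is_derive y (delta_mx 0 1 : E2) Th ((k (Th y))^-1 *: T2 (Th y)).

Let I := [set u | Q (pt2 u 0)].
Let g u := Th (pt2 u 0).
Let x u := X (g u).

Let oI : open I. Proof. exact: open_base. Qed.
Let IU u : I u -> U (g u). Proof. exact: QU. Qed.

Let smooth : [/\ Cinf U X, Cinf U e1, Cinf U e3 & Cinf U e4] /\ Cinf U s.
Proof. by case: AF => -[[_ _ ? ? _] [[? ? _ ? _] _]]. Qed.

Let dx u : I u -> is_derive u (1:R) x (e1 (g u)).
Proof.
move=> Iu; have [[HX _ _ _] _] := smooth.
have := derive_base_rV oU QU HTh dTh HX Iu.
by have [-> _] := af_X AF (IU Iu).
Qed.

Let de1 u : I u -> is_derive u (1:R) (fun u => e1 (g u))
  (- s (g u) ^+ 2 *: e3 (g u) + (c * s (g u) ^+ 3) *: e4 (g u) + x u).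
Proof.
move=> Iu; have [[_ He1 _ _] _] := smooth.
have := derive_base_rV oU QU HTh dTh He1 Iu.
by rewrite (af_e1 AF (IU Iu)).
Qed.

Let de3 u : I u -> is_derive u (1:R) (fun u => e3 (g u)) (s (g u) ^+ 2 *: e1 (g u)).
Proof.
move=> Iu; have [[_ _ He3 _] _] := smooth.
have := derive_base_rV oU QU HTh dTh He3 Iu.
by have [-> _] := af_e34 AF (IU Iu).
Qed.

Let de4 u : I u -> is_derive u (1:R) (fun u => e4 (g u)) (- (c * s (g u) ^+ 3) *: e1 (g u)).
Proof.
move=> Iu; have [[_ _ _ He4] _] := smooth.
have := derive_base_rV oU QU HTh dTh He4 Iu.
by have [_ ->] := af_e34 AF (IU Iu).
Qed.

Let ds u : I u -> is_derive u (1:R) (fun u => s (g u)) (2 / 3 * s (g u) * S (g u)).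
Proof.
move=> Iu; have [_ Hs] := smooth.
have := derive_base oU QU HTh dTh Hs Iu.
by have [-> _ _ _] := af_scalars AF (IU Iu).
Qed.

Let s_gt0 u : I u -> 0 < s (g u).
Proof. by move=> Iu; have [] := af_gt0 AF (IU Iu). Qed.

Let S_gt0 u : I u -> 0 < S (g u).
Proof. by move=> Iu; have [] := af_gt0 AF (IU Iu). Qed.

Let fr u : I u ->
  [/\ mink (e1 (g u)) (e1 (g u)) = 1, mink (e3 (g u)) (e3 (g u)) = 1,
      mink (e4 (g u)) (e4 (g u)) = 1 & mink (x u) (x u) = -1]
  /\ [/\ mink (e1 (g u)) (x u) = 0, mink (e3 (g u)) (x u) = 0,
         mink (e4 (g u)) (x u) = 0 & mink (e3 (g u)) (e4 (g u)) = 0].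
Proof. by move=> Iu; have [[? _ ? ? ?] [_ _ _ ?] _ [? ? ?]] := af_frame AF (IU Iu). Qed.

Let base_frame u : I u -> e2 (g u) = e2 q0 /\ n (g u) = n q0.
Proof. by move=> Iu; exact: (adapted_base_frame oU AF r0 QU HTh Th0 dTh Iu). Qed.

Let frb u : I u ->
  [/\ mink (x u) (e2 q0) = 0, mink (e1 (g u)) (e2 q0) = 0,
      mink (e3 (g u)) (e2 q0) = 0 & mink (e4 (g u)) (e2 q0) = 0].
Proof.
move=> Iu; have [<- _] := base_frame Iu.
have [_ [h12 _ _ _] [h23 h24 h2X] _] := af_frame AF (IU Iu).
by rewrite (minkC (x u)) (minkC (e3 _)) (minkC (e4 _)) h12 h23 h24 h2X.
Qed.

(** X is orthogonal to e2, and e2 is the constant vector b1 along the curve. *)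
Lemma base_curve_in_H3 : unit_speed_curve_in_H3 (e2 q0) x I.
Proof.
have [[HX _ _ _] _] := smooth; split.
- by apply/smooth_onP; exact: (Cinf_base_rV oU QU HTh HX).
- by move=> u Iu; split; [exact: (XH4 (IU Iu))|have [h _ _ _] := frb Iu; exact: h].
- by move=> u Iu; rewrite (derive1_tangent dx Iu); have [[] ] := fr Iu.
Qed.

Lemma base_curve_frenet u : I u ->
  [/\ frenet_curvature (e2 q0) x u = s (g u) ^+ 2 * Num.sqrt (1 + c ^+ 2 * s (g u) ^+ 2),
      frenet_torsion (e2 q0) x u =
        2 * `|c| * s (g u) / (3 * (1 + c ^+ 2 * s (g u) ^+ 2)) * S (g u) &
      mink (x u) (n q0) = - (k (g u))^-1].
Proof.
move=> Iu; split.
- exact: (frenet_curvatureE oI dx de1 fr frb Iu).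
- exact: (frenet_torsionE oI dx de1 de3 de4 ds s_gt0 S_gt0 fr frb Iu).
- by have [_ <-] := base_frame Iu; have [] := af_n AF (IU Iu).
Qed.

Lemma mean_curv_base_derive u : I u ->
  is_derive u (1:R) (fun u => s (g u) ^+ 2) (4 / 3 * s (g u) ^+ 2 * S (g u)).
Proof.
move=> Iu; have d := ds Iu.
rewrite [X in is_derive _ _ X _](_ : _ = (fun u => s (g u)) * (fun u => s (g u))).
  rewrite [X in is_derive _ _ _ X](_ : _ = s (g u) *: (2 / 3 * s (g u) * S (g u)) +
      s (g u) *: (2 / 3 * s (g u) * S (g u))); first exact: is_deriveM.
  by rewrite /GRing.scale /=; move: (s _) (S _) => y z; field.
by apply/funext => v; rewrite expr2.
Qed.

End BaseCurve.

(** * Assembly of the parametrization *)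

Lemma adapted_frame_chart (R : realType) (U : set 'rV[R]_2) T1 T2 X e1 e2 e3 e4 n s S k
    (c C : R) q0 :
  open U -> adapted_frame U T1 T2 X e1 e2 e3 e4 n s S k c ->
  (forall q, U q -> S q ^+ 2 = 1 + 9 * C * s q ^+ 3 - 9 * s q ^+ 4 - c ^+ 2 * s q ^+ 6) ->
  U q0 ->
  exists (r uc : R) (Psi Th : 'rV[R]_2 -> 'rV[R]_2) (W : set 'rV[R]_2),
  [/\ 0 < r, open W, W q0, W `<=` U & Cinf W Psi] /\
  [/\ forall q, W q -> ball (pt2 uc 0) r (Psi q) /\ Th (Psi q) = q,
      forall y, ball (pt2 uc 0) r y -> W (Th y) /\ Psi (Th y) = y,
      Cinf (ball (pt2 uc 0) r) Th, Psi q0 = pt2 uc 0 &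
      forall y, ball (pt2 uc 0) r y ->
        is_derive y (delta_mx 0 0 : 'rV[R]_2) Th (T1 (Th y)) /\
        is_derive y (delta_mx 0 1 : 'rV[R]_2) Th ((k (Th y))^-1 *: T2 (Th y))].
Proof.
move=> oU AF S_sqr Uq0.
have [[HT1 HT2 _ _ He2] [[_ _ Hn Hs _] Hk]] := af_smooth AF.
apply: (@adapted_chart _ _ _ _ e2 n s S k c C oU HT1 HT2 He2 Hn Hs Hk
  _ _ _ _ _ _ _ _ _ _ _ _ _ q0 Uq0) => q Uq.
- by have [] := af_e2 AF Uq.
- by have [] := af_dn AF Uq.
- exact: (af_e2n AF Uq).
- by have [] := af_dn AF Uq.
- by have [] := af_scalars AF Uq.
- by have [] := af_scalars AF Uq.
- by have [] := af_gt0 AF Uq.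
- by have [] := af_gt0 AF Uq.
- exact: (S_sqr _ Uq).
- by have [] := af_gt0 AF Uq.
- by have [[]] := af_frame AF Uq.
- by have [] := af_n AF Uq.
- by have [] := af_n AF Uq.
Qed.

(** The explicit frame is hidden behind existential quantifiers, so that only the structure
    equations and the relations between the scalars are used afterwards. *)
Lemma surface_frame_exists (R : realType) (X : 'rV[R]_2 -> 'rV[R]_5) (U : set 'rV[R]_2) (c C : R) :
  open U -> Cinf U X -> (forall q, U q -> mink (X q) (X q) = -1) ->
  (forall q v, U q -> 'D_v X q = 0 -> v = 0) ->
  (forall q, U q -> pnmc_biconservative_at X q) ->
  (forall q, U q -> attached_constants_at X c C q) -> c != 0 -> C < 0 ->
  exists T1 T2 e1 e2 e3 e4 n s S k,
    adapted_frame U T1 T2 X e1 e2 e3 e4 n s S k c /\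
    forall q, U q -> [/\ mean_curv X q = s q ^+ 2,
      k q = 3 * Num.sqrt (- C) * mean_curv X q `^ (3 / 4),
      S q ^+ 2 = 1 + 9 * C * s q ^+ 3 - 9 * s q ^+ 4 - c ^+ 2 * s q ^+ 6 &
      S q = Num.sqrt (1 + 9 * C * mean_curv X q `^ (3 / 2) - 9 * mean_curv X q ^+ 2
                      - c ^+ 2 * mean_curv X q ^+ 3)].
Proof.
move=> oU HX XH4 immX pnmc constants c0 C0.
do 10!eexists; split; first exact: (surface_adapted_frame oU HX XH4 immX pnmc constants c0 C0).
by move=> q Uq; exact: (surface_frame_scalars pnmc constants Uq).
Qed.

Theorem theorem2p11 (R : realType) (M : surface R) (phi : M -> 'rV[R]_5)
  (c C : R) (hphi : pnmc_biconservative phi)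
  (hcC : attached_constants phi c C) (hC : C < 0) (p : M) :
  exists (chi : chart M) (u0 u1 t0 t1 : R)
         (f kh : R -> R) (sh : R -> 'rV[R]_5) (b1 b2 : 'rV[R]_5),
    let I := `]u0, u1[%classic : set R in
    let J := `]t0, t1[%classic : set R in
    let pt u t : 'rV[R]_2 := \row_i [:: u; t]`_i in
    (* local parametrization cinv chi : I x J -> M around p *)
    [/\ smooth_chart chi, cdom chi p &
        crange chi = [set q : 'rV[R]_2 | I (q 0 0) /\ J (q 0 1)]] /\
    (forall u t, I u -> J t ->
       phi (cinv chi (pt u t)) =
       sh u + (kh u)^-1 *: (sinh t *: b1 + (cosh t - 1) *: b2)) /\
    (* (i) *)
    (forall u t, I u -> J t ->
       mean_curv (phi \o cinv chi) (pt u t) = f u) /\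
    (forall u, I u ->
       [/\ 0 < f u,
           is_derive u (1 : R) f (ode_rhs c C (f u)) &
           0 < ode_rhs c C (f u)]) /\
    (* (ii) *)
    (forall u, I u -> kh u = 3 * Num.sqrt (- C) * f u `^ (3 / 4) /\ 0 < kh u) /\
    (* (iii) *)
    [/\ mink b1 b2 = 0, mink b1 b1 = 1 & mink b2 b2 = - 1] /\
    (* (iv) *)
    unit_speed_curve_in_H3 b1 sh I /\
    (forall u, I u ->
       [/\ frenet_curvature b1 sh u = f u * Num.sqrt (1 + c ^+ 2 * f u),
           frenet_torsion b1 sh u =
             2 * `|c| * Num.sqrt (f u) / (3 * (1 + c ^+ 2 * f u)) *
             Num.sqrt (1 + 9 * C * f u `^ (3 / 2)
                       - 9 * f u ^+ 2 - c ^+ 2 * f u ^+ 3) &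
           mink (sh u) b2 = - (kh u)^-1]).
Proof.
have [[phiH4 phi_smooth phi_imm] phi_pnmc _] := hphi.
have [c0 phi_constants] := hcC.
(* Any chart of the atlas around p will do; p becomes the centre, with t = 0, of the new coordinate
   square. *)
have [chi0 chi0M pchi0] := atlas_cover p.
pose X := phi \o cinv chi0; pose U := crange chi0; pose q0 := cmap chi0 p.
have oU : open U by exact: crange_open.
have Uq0 : U q0 by exists p.
have HX : Cinf U X by apply/smooth_onP; exact: phi_smooth.
have XH4 q : U q -> H4 (X q) by move=> _; exact: phiH4.
have Xm1 q : U q -> mink (X q) (X q) = -1 by move=> /XH4[].
have immX q v : U q -> 'D_v X q = 0 -> v = 0 by move=> Uq; exact: (phi_imm _ chi0M _ Uq).
have [T1 [T2 [e1 [e2 [e3 [e4 [n [s [S [k [AF sc]]]]]]]]]]] :=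
  surface_frame_exists oU HX Xm1 immX (phi_pnmc _ chi0M) (phi_constants _ chi0M) c0 hC.
have S_sqr q : U q -> S q ^+ 2 = 1 + 9 * C * s q ^+ 3 - 9 * s q ^+ 4 - c ^+ 2 * s q ^+ 6.
  by move=> /sc[].
have [r [uc [Psi [Th [W [[r0 oW Wq0 WU HPsi] [PsiK ThK HTh Psi0 dTh]]]]]]] :=
  adapted_frame_chart oU AF S_sqr Uq0.
set Q := ball (pt2 uc 0) r in PsiK ThK HTh dTh.
have oQ : open Q by exact: ball_open.
have QU y : Q y -> U (Th y) by move=> /ThK[/WU].
have Th0 : Th (pt2 uc 0) = q0 by rewrite -Psi0; have [] := PsiK _ Wq0.
have [chi [chi_smooth chi_dom chi_range chi_inv]] :=
  reparametrized_chart chi0M oW oQ WU HPsi HTh PsiK ThK.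
(* The ball Q of the sup norm is the square I x J required of the range of the chart. *)
have IE u : `]uc - r, uc + r[%classic u <-> Q (pt2 u 0).
  rewrite /Q ball_pt2// !pt2_0 !pt2_1 subrr normr0 /= in_itv /= distrC ltr_distl.
  by split=> [->|[]].
have QE u t : `]uc - r, uc + r[%classic u -> `](- r), r[%classic t -> Q (pt2 u t).
  rewrite /Q ball_pt2// !pt2_0 !pt2_1 sub0r normrN /= !in_itv /= distrC ltr_distl ltr_norml.
  by [].
exists chi, (uc - r), (uc + r), (- r), r.
(* All functions of u are restrictions to the line t = 0, and the constant vectors are the values of
   e2 and n at the image q0 of p. *)
exists (fun u => s (Th (pt2 u 0)) ^+ 2), (fun u => k (Th (pt2 u 0))), (fun u => X (Th (pt2 u 0))).
exists (e2 q0), (n q0) => I J pt.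
have [[_ _ HX' _ He2] [[_ _ Hn Hs _] Hk]] := af_smooth AF.
have facts u : I u -> [/\ 0 < s (Th (pt2 u 0)), 0 < S (Th (pt2 u 0)) & 0 < k (Th (pt2 u 0))].
  by move=> /IE/QU/(af_gt0 AF).
have S_E u : I u -> S (Th (pt2 u 0)) = Num.sqrt (1 + 9 * C * (s (Th (pt2 u 0)) ^+ 2) `^ (3 / 2)
    - 9 * (s (Th (pt2 u 0)) ^+ 2) ^+ 2 - c ^+ 2 * (s (Th (pt2 u 0)) ^+ 2) ^+ 3).
  by move=> /IE/QU/sc[<- _ _ ->].
split.
  split; [exact: chi_smooth| |].
    by rewrite chi_dom.
  rewrite chi_range; apply/seteqP; split=> y.
    by rewrite /Q /I /J ball_pt2// pt2_0 pt2_1 sub0r normrN /= !in_itv /= distrC ltr_distl ltr_norml.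
  by move=> [Iy Jy]; rewrite -(pt2_eq y); exact: QE.
split.
  move=> u t Iu Jt; rewrite chi_inv.
  have D2 := fun q (Uq : U q) => (af_scalars AF Uq).
  apply: (parametrization oU HX He2 Hn Hk (fun q Uq => (af_X AF Uq).2)
    (fun q Uq => (af_e2 AF Uq).1) (fun q Uq => (af_dn AF Uq).1) (af_e2n AF)
    (fun q Uq => (af_dn AF Uq).2) _ _ r0 QU HTh Th0 dTh (QE _ _ Iu Jt)).
    by move=> q /D2[].
  by move=> q /(af_gt0 AF)[].
split.
  move=> u t Iu Jt; rewrite chi_inv.
  apply: (etrans (mean_curv_adapted oU AF QU HTh dTh (QE _ _ Iu Jt))).
  congr (_ ^+ 2); apply: (s_constant_in_t oU Hs _ r0 QU HTh dTh (QE _ _ Iu Jt)).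
  by move=> q /(af_scalars AF)[].
split.
  move=> u Iu; have [s0 S0 k0] := facts u Iu.
  have oE : ode_rhs c C (s (Th (pt2 u 0)) ^+ 2) = 4 / 3 * s (Th (pt2 u 0)) ^+ 2 * S (Th (pt2 u 0)).
    by rewrite /ode_rhs S_E.
  rewrite oE; split; first exact: exprn_gt0.
    exact: (mean_curv_base_derive oU AF QU HTh dTh ((IE u).1 Iu)).
  by rewrite !mulr_gt0// ?exprn_gt0// ?divr_gt0.
split.
  move=> u Iu; have [s0 S0 k0] := facts u Iu; split; last exact: k0.
  by have [<- E _ _] := sc _ (QU _ ((IE u).1 Iu)); exact: E.
split.
  have [n1 n2 _] := af_n AF Uq0; have [[_ h22 _ _ _] _ _ _] := af_frame AF Uq0.
  by rewrite minkC.
have IQ : I = [set u | Q (pt2 u 0)] by apply/seteqP; split=> u /IE.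
split.
  rewrite IQ; exact: (base_curve_in_H3 oU AF XH4 r0 QU HTh Th0 dTh).
move=> u Iu; have [s0 S0 k0] := facts u Iu.
have [E1 E2 E3] := base_curve_frenet oU AF r0 QU HTh Th0 dTh ((IE u).1 Iu).
(* f is given as s^2 with s > 0, so sqrt f = s, and S is the square root in the torsion. *)
by rewrite sqrtr_sqr (gtr0_norm s0) -S_E.
Qed.
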